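(* Let $v\in\mathbb N^n$ and let $a,b,c,d,e$ be parameters satisfying $abc=de$. Then $$\sum_{u\in\mathbb N^n}\frac{(b)_u}{(d)_u\,(et^{n-1})_u}\,\mathsf E_{u/v}(a,ac)\,\mathsf M_u(x)=\frac{(b)_v}{(d/c)_v}\left(\prod_{i=1}^n\frac{(at^{n-i})_\infty\,(ex_i)_\infty}{(et^{n-i})_\infty\,(ax_i)_\infty}\right)\sum_{u\in\mathbb N^n}\frac{(d/c)_u}{(d)_u\,(at^{n-1})_u}\,\mathsf E_{u/v}(e,ac)\,\mathsf M_u(x).$$
   Context: Notation. Fix $n\ge 1$, a complex $q$ with $|q|<1$, and $t$, with $q,t$ generic (the coefficients of all polynomials below are rational functions of $q,t$). $\mathbb N=\{0,1,2,\dots\}$, $x=(x_1,\dots,x_n)$. A composition is $u=(u_1,\dots,u_n)\in\mathbb N^n$; $|u|=u_1+\cdots+u_n$; $u^+$ is the weakly decreasing rearrangement of $u$; $0=(0,\dots,0)$. $(b)_\infty=\prod_{i\ge0}(1-bq^i)$, $(b)_k=\prod_{i=0}^{k-1}(1-bq^i)$ for $k\in\mathbb N$, and for a composition $u$, $(b)_u=\prod_{i=1}^n(bt^{1-i})_{u^+_i}$. The spectral vector $\langle u\rangle\in\mathbb C^n$ has entries $\langle u\rangle_i=q^{u_i}t^{k_i}$, where $k_i=\#\{j:u_j<u_i\}+\#\{j>i:u_j=u_i\}$; so $\langle 0\rangle=(t^{n-1},\dots,t,1)$. The diagram of $u$ is the set of $s=(i,j)$ with $1\le i\le n$, $1\le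 j\le u_i$; for such $s$, $a(s)=u_i-j$ and $l(s)=\#\{k>i: j\le u_k\le u_i\}+\#\{k<i: j\le u_k+1\le u_i\}$. Put $n(u)=\sum_{s\in u}l(s)$, $n'(u)=\sum_i\binom{u_i}{2}$, $c'_u=\prod_{s\in u}(1-q^{a(s)+1}t^{l(s)})$. The interpolation Macdonald polynomial $M_u(x)$ is the unique polynomial of degree $|u|$ in $x_1,\dots,x_n$ such that $M_u(\langle v\rangle)=0$ for all $v\in\mathbb N^n$ with $|v|\le|u|$, $v\ne u$, and such that the coefficient of $x^u=x_1^{u_1}\cdots x_n^{u_n}$ is $q^{-n'(u)}$. Its normalised version is $\mathsf M_u(x)=q^{n'(u)}t^{n(u)}M_u(x)/c'_u$. Let $\mathsf E_u(x)=\lim_{z\to0}z^{|u|}\mathsf M_u(x/z)$ be the top-degree homogeneous component of $\mathsf M_u$ (a normalised nonsymmetric Macdonald polynomial: $\mathsf E_u=t^{n(u)}E_u/c'_u$, with $E_u$ the nonsymmetric Macdonald polynomial in which $x^u$ has coefficient 1). Connection coefficients: define $c_{uv}(a,b)$ by $\mathsf M_u(ax)=\sum_v c_{uv}(a,b)\mathsf M_v(bx)$, and $\mathsf E_{u/v}(a,b)=\dfrac{\mathsf E_v(\langle 0\rangle/a)}{\mathsf E_u(\langle 0\rangle/b)}\,c_{uv}(a,b)$. It is a polynomial in $a,b$, homogeneous of degree $|u|-|v|$ (and zero if $|v|>|u|$). Parameters are generic subject to $abc=de$. The identity is understood as one of formal power series: replacing $(a,e)$ by $(za,ze)$ with $b,c,d,x$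 fixed (which preserves $abc=de$), both sides are expanded as formal power series in $z$. *)

(* Defs.v *)
From HB Require Import structures.
From mathcomp Require Import all_boot all_order all_algebra.
(* The notations of mpoly and of MathComp-Analysis clash. *)
From mathcomp Require Import -(notations) mpoly.
From mathcomp Require Import all_classical all_reals all_analysis.
From mathcomp Require Import complex.

Set Implicit Arguments.
Unset Strict Implicit.
Unset Printing Implicit Defensive.

Import Order.TTheory GRing.Theory Num.Theory numFieldNormedType.Exports.

Local Open Scope classical_set_scope.
Local Open Scope ring_scope.

(* A composition u in N^n is a [multinom n], so that |u| is [mdeg u] and x^u is
   the monomial with exponent u.  Positions are numbered from 0: the entry u_i
   of the text is [u i] with i shifted by one. *)
Section Compositions.
Variable n : nat.
Implicit Types u v : multinom n.

Definition sortedparts u : seq nat := sort geq (codom u).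

Definition spec_exp u (i : 'I_n) : nat :=
  (#|[pred j : 'I_n | u j < u i]|
   + #|[pred j : 'I_n | (i < j) && (u j == u i)]|)%N.

(* Arm and leg of the box in row i and column j, with columns numbered from 1
   (the sums over the diagram below take column j.+1 for j < u i). *)
Definition arm u (i : 'I_n) (j : nat) : nat := (u i - j)%N.

Definition leg u (i : 'I_n) (j : nat) : nat :=
  (#|[pred k : 'I_n | (i < k) && (j <= u k <= u i)]|
   + #|[pred k : 'I_n | (k < i) && (j <= (u k).+1 <= u i)]|)%N.

Definition nstat u : nat := (\sum_(i < n) \sum_(j < u i) leg u i j.+1)%N.

Definition nstat' u : nat := (\sum_(i < n) 'C(u i, 2))%N.

End Compositions.

(* q-shifted factorials over a ring A; they are used both over the field of
   scalars and over the polynomials in z. *)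
Section Pochhammer.
Variable A : comUnitRingType.

Definition qpoch (q b : A) (k : nat) : A := \prod_(i < k) (1 - b * q ^+ i).

Definition qtpoch n (q t b : A) (u : multinom n) : A :=
  \prod_(i < n) qpoch q (b / t ^+ i) (nth 0%N (sortedparts u) i).

End Pochhammer.

Section FormalPowerSeries.
Variable K : fieldType.

Definition fps := nat -> K.

Implicit Types f g : fps.

Definition fps_of_poly (p : {poly K}) : fps := fun N => p`_N.

Definition fps_one : fps := fps_of_poly 1.

Definition fps_mul f g : fps := fun N => \sum_(k < N.+1) f k * g (N - k)%N.

Fixpoint fps_inv_seq f N : seq K :=
  if N is N'.+1 then
    let s := fps_inv_seq f N' in
    rcons s (- ((f 0%N)^-1 * \sum_(k < N'.+1) f k.+1 * s`_(N' - k)))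
  else [:: (f 0%N)^-1].

Definition fps_inv f : fps := fun N => (fps_inv_seq f N)`_N.

Definition fps_div f g : fps := fps_mul f (fps_inv g).

(* Coefficientwise sum of a family in which every power of z occurs in finitely
   many members only. *)
Definition fps_sum (I : choiceType) (F : I -> fps) : fps :=
  fun N => \sum_(i \in [set: I]) F i N.

Lemma size_fps_inv_seq f N : size (fps_inv_seq f N) = N.+1.
Proof. by elim: N => //= N IH; rewrite size_rcons IH. Qed.

Lemma nth_fps_inv_seq f N k : (k <= N)%N -> (fps_inv_seq f N)`_k = fps_inv f k.
Proof.
elim: N => [|N IH]; first by case: k.
rewrite leq_eqVlt => /predU1P[->//|lt_kN].
by rewrite /= nth_rcons size_fps_inv_seq lt_kN IH.
Qed.

Lemma fps_mulV f : f 0%N != 0 -> fps_mul f (fps_inv f) =1 fps_one.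
Proof.
move=> f0 [|N]; rewrite /fps_mul /fps_one /fps_of_poly coef1.
  by rewrite big_ord1 /fps_inv /= mulfV.
rewrite big_ord_recl subn0 {1}/fps_inv /= nth_rcons size_fps_inv_seq ltnn eqxx.
rewrite mulrN mulrA mulfV // mul1r.
apply/eqP; rewrite addrC subr_eq0; apply/eqP; apply: eq_bigr => k _.
by rewrite nth_fps_inv_seq ?leq_subr //= subSS.
Qed.

End FormalPowerSeries.

Declare Scope fps_scope.
Delimit Scope fps_scope with fps.
Bind Scope fps_scope with fps.
Notation "1" := (fps_one _) : fps_scope.
Notation "f * g" := (fps_mul f g) : fps_scope.
Notation "f / g" := (fps_div f g) : fps_scope.
Notation "\prod_ ( i < n ) F" := (\big[@fps_mul _/fps_one _]_(i < n) F%fps)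
  : fps_scope.
Notation "\sum_ ( i : I ) F" := (fps_sum (fun i : I => F%fps)) : fps_scope.

Section InterpolationMacdonald.
Variables (K : numFieldType) (n : nat) (q t : K).
Implicit Types (u v : multinom n) (a b c : K).

Definition generic_qt : Prop :=
  [/\ q != 0, t != 0 & forall i j : int, q ^ i * t ^ j = 1 -> i = 0 /\ j = 0].

(* The coefficients of the expansion of (z c)_oo as a power series in z are the
   limits of the coefficients of the polynomials (z c)_k. *)
Definition qpoch_inf c : fps K :=
  fun N => limn (fun k : nat => (qpoch q%:P (c *: 'X) k)`_N).

(* (z c)_u as a polynomial in z. *)
Definition qtpochX c u : {poly K} := qtpoch q%:P t%:P (c *: 'X) u.

Definition cprime u : K :=
  \prod_(i < n) \prod_(j < u i)
    (1 - q ^+ (arm u i j.+1).+1 * t ^+ leg u i j.+1).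

Definition spectral u (i : 'I_n) : K := q ^+ u i * t ^+ spec_exp u i.

Lemma horner_qtpochX c u z :
  t != 0 -> (qtpochX c u).[z] = qtpoch q t (z * c) u.
Proof.
move=> t0; rewrite /qtpochX /qtpoch horner_prod; apply: eq_bigr => i _.
rewrite /qpoch horner_prod; apply: eq_bigr => k _.
rewrite -!polyC_exp polyCV -[c *: 'X]mul_polyC !hornerE.
by congr (1 - _); rewrite [c * z]mulrC.
Qed.

(* [msize p] is the total degree of p plus one. *)
Definition is_interp u (p : mpoly n K) : Prop :=
  [/\ msize p = (mdeg u).+1,
      forall v, (mdeg v <= mdeg u)%N -> v != u -> meval (spectral v) p = 0
    & mcoeff u p = q ^- nstat' u].

(* Descriptions by [xget] return a default value when nothing satisfies the
   property; for generic q and t the interpolation polynomial exists and is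
   unique, and so are the connection coefficients for b != 0. *)
Definition interp u : mpoly n K := xget 0 [set p | is_interp u p].

Definition Minterp u : mpoly n K :=
  (q ^+ nstat' u * t ^+ nstat u / cprime u) *: interp u.

Definition Etop u : mpoly n K := pihomog mdeg (mdeg u) (Minterp u).

Definition is_connection u a b (c : multinom n -> K) : Prop :=
  finite_set [set v | c v != 0] /\
  forall x : 'I_n -> K,
    meval (fun i => a * x i) (Minterp u) =
    \sum_(v \in [set: multinom n]) c v * meval (fun i => b * x i) (Minterp v).

Definition connection u a b : multinom n -> K :=
  xget (fun=> 0) [set c | is_connection u a b c].

Definition Eskew u v a b : K :=
  meval (fun i => spectral mnm0 i / a) (Etop v)
  / meval (fun i => spectral mnm0 i / b) (Etop u) * connection u a b v.

(* E_{u/v}(z a, z b) as a polynomial in z: it is a polynomial in a and b, but the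
   quotient [Eskew] has no meaning at z = 0. *)
Definition EskewX u v a b : {poly K} :=
  xget 0 [set p | forall z, z != 0 -> p.[z] = Eskew u v (z * a) (z * b)].

End InterpolationMacdonald.

(* Main.v *)
Require Import Defs.
From HB Require Import structures.
From mathcomp Require Import all_boot all_order all_algebra.
From mathcomp Require Import -(notations) mpoly ssrcomplements.
From mathcomp Require Import all_classical all_reals all_analysis.
From mathcomp Require Import complex perm.
From mathcomp Require Import zify ring lra.

Set Implicit Arguments.
Unset Strict Implicit.
Unset Printing Implicit Defensive.

Import Order.TTheory GRing.Theory Num.Theory numFieldNormedType.Exports.

Local Open Scope ring_scope.

(* Everything is checked on the lattice of spectral vectors <u>, on which the
   polynomials M_u form a triangular basis.  Two moves on compositions,
   u -> (u_2, .., u_n, u_1 + 1) and the adjacent transpositions, have dual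
   operators on polynomials (Phi and the Hecke operators T_i, after Knop and
   Sahi).  They yield the existence of M_u, the extra vanishing property
     M_v(<w>) <> 0  =>  (z)_v divides (z)_w,
   and the binomial formula
     E_w(x) / E_w(<0>) = sum_v M_v(<w>) / (lc_v E_v(<0>)) M_v(x),
   where lc_v is the leading coefficient of (z t^{n-1})_v: the right-hand side
   satisfies the recursions of a reproducing kernel, which force it to be
   homogeneous.

   Let Q(a)_{uv} = a^{|u|-|v|} M_v(<u>) / lc_v.  The binomial formula says that
   the matrix X = (E_{u/v}(a, f)) satisfies Q(f) X = Q(a).  Interpolation at the
   lattice points and extra vanishing give
     prod_i (e t^{n-i})_oo / (e x_i)_oo  M_v(x) / (e t^{n-1})_v
       = sum_w Q(e)_{wv} M_w(x),
   so after multiplication by this product the theorem becomes an identity of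
   matrices in Q(a), Q(e), Q(ac)^{-1} and diagonal ones.  It holds because the
   matrices A_s(a) = Q(a) diag((a s t^{n-1})_u) commute for different a: up to a
   diagonal conjugation A_s(a) is the operator of multiplication by the function
   w -> (a s t^{n-1})_w on the lattice. *)

(** * Compositions *)

(** Homogeneity in the binomial formula is an induction along the two moves. Passing from w to its
    shift applies the degree-preserving T_i to the kernel and multiplies it by x_n; a transposition
    combines the kernel with its image under T_i. Starting from the constant 1, the kernel at <w> is
    homogeneous of degree |w|. Its component of that degree is a multiple of E_w: terms with |v| <
    |w| have too small a degree, and the other terms with v <> w vanish at <w>.

    The relation Q(f) X = Q(a) comes from E_w(a x) = (a/f)^{|w|} E_w(f x), both sides being expanded
    by the binomial formula.

    For the final identity let D(a) be the diagonal factor of A_s(a), so that A_s(a) = Q(a) D(a). As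
    A_s(f) and A_s(e) commute, A_s(f) Q(e) D(e) D(f)^{-1} X = A_s(e) Q(f) X = A_s(e) Q(a).
    Multiplying column v by its entry of D(a) gives A_s(e) A_s(a), which is symmetric in a and e,
    and A_s(f) can be cancelled because it is triangular with nonzero diagonal. *)

Section Compositions.
Variable r : nat.
Notation mnm := (multinom r.+1).
Implicit Types (u v w m : mnm) (i j k : 'I_r.+1).

Definition swapm i j u : mnm := Multinom [tuple u (tperm i j k) | k < r.+1].
(* u -> (u_2, .., u_n, u_1 + 1) *)
Definition shiftm u : mnm :=
  Multinom [tuple (u (ordS k) + (k == ord_max))%N | k < r.+1].
Definition unshiftm u : mnm :=
  Multinom [tuple (u (ord_pred k) - (k == ord0))%N | k < r.+1].

Lemma swapmE i j u k : swapm i j u k = u (tperm i j k).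
Proof. exact: mnmE. Qed.

Lemma shiftmE u k : shiftm u k = (u (ordS k) + (k == ord_max))%N.
Proof. exact: mnmE. Qed.

Lemma unshiftmE u k : unshiftm u k = (u (ord_pred k) - (k == ord0))%N.
Proof. exact: mnmE. Qed.

Lemma ordS_max : ordS (ord_max : 'I_r.+1) = ord0.
Proof. by apply/val_inj; rewrite /= modnn. Qed.

Lemma ord_pred0 : ord_pred (ord0 : 'I_r.+1) = ord_max.
Proof. by rewrite -ordS_max ordSK. Qed.

Lemma ordS_neq_max k : k != ord_max -> ordS k = k.+1 :> nat.
Proof.
move=> h; rewrite /= modn_small // ltnS ltn_neqAle -ltnS ltn_ord andbT.
by apply: contra h => /eqP e; apply/eqP/val_inj.
Qed.

Lemma succ_neq i j : j = i.+1 :> nat -> i != j.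
Proof. by move=> h; rewrite -val_eqE neq_ltn /= h ltnSn. Qed.

Lemma ordS_eq0 k : (ordS k == ord0) = (k == ord_max).
Proof. by rewrite -[X in _ == X]ordS_max (inj_eq (can_inj (@ordSK r.+1))). Qed.

Lemma unshiftmK u : (0 < u ord_max)%N -> shiftm (unshiftm u) = u.
Proof.
move=> h; apply/mnmP => k; rewrite shiftmE unshiftmE ordSK ordS_eq0.
by case: eqP => [->|_]; rewrite /= ?subnK // subn0 addn0.
Qed.

Lemma shiftmK u : unshiftm (shiftm u) = u.
Proof.
apply/mnmP => k; rewrite unshiftmE shiftmE ord_predK.
by rewrite -ordS_eq0 ord_predK addnK.
Qed.

Lemma shiftm_max u : shiftm u ord_max = (u ord0).+1.
Proof. by rewrite shiftmE ordS_max eqxx addn1. Qed.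

Lemma mdeg_shiftm u : mdeg (shiftm u) = (mdeg u).+1.
Proof.
rewrite !mdegE; under eq_bigr do rewrite shiftmE.
rewrite [LHS]big_split /= -[RHS]addn1.
congr (_ + _)%N; last by rewrite -big_mkcond /= big_pred1_eq.
rewrite [RHS](reindex_inj (can_inj (@ordSK r.+1))) //.
Qed.

Lemma mdeg_unshiftm u : (0 < u ord_max)%N -> mdeg u = (mdeg (unshiftm u)).+1.
Proof. by move=> h; rewrite -mdeg_shiftm unshiftmK. Qed.

Lemma mdeg_swapm i j u : mdeg (swapm i j u) = mdeg u.
Proof. exact: mdeg_mperm. Qed.

Lemma swapmK i j : involutive (swapm i j).
Proof. by move=> u; apply/mnmP => k; rewrite !swapmE tpermK. Qed.

Lemma swapm_id i j u : u i = u j -> swapm i j u = u.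
Proof. by move=> h; apply/mnmP => k; rewrite swapmE; case: tpermP => [->|->|]. Qed.

Lemma mdeg_eq0_mnm u : mdeg u = 0%N -> u = @mnm0 _.
Proof. by move/eqP; rewrite mdeg_eq0 => /eqP. Qed.

(* The i-th exponent of t in the spectral vector is the rank of position i in
   the total order [below u]. *)
Definition below u j i := (u j < u i)%N || (u j == u i) && (i < j)%N.

Lemma spec_expE u i : spec_exp u i = (\sum_j below u j i)%N.
Proof.
rewrite /spec_exp -!sum1_card [X in (X + _)%N]big_mkcond.
rewrite [X in (_ + X)%N]big_mkcond -big_split /=; apply: eq_bigr => j _.
rewrite !inE /below; case: ltngtP => //= h; case: ltnP => //.
Qed.

Lemma below_irr u i : below u i i = false.
Proof. by rewrite /below ltnn ltnn andbF. Qed.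

Lemma below_trans u i j k : below u i j -> below u j k -> below u i k.
Proof. by rewrite /below; lia. Qed.

Lemma below_total u i j : i != j -> below u i j || below u j i.
Proof. by move=> h; have : (i : nat) != j by []; rewrite /below; lia. Qed.

Lemma spec_exp_lt u i j : below u i j -> (spec_exp u i < spec_exp u j)%N.
Proof.
move=> h; rewrite !spec_expE (bigD1 i) //= [X in (_ < X)%N](bigD1 i) //=.
rewrite below_irr h add0n add1n ltnS leq_sum // => k _.
by case e : (below u k i); rewrite // (below_trans e h).
Qed.

Lemma spec_exp_inj u : injective (spec_exp u).
Proof.
move=> i j e; apply/eqP/negPn/negP => /(below_total u) /orP[] /spec_exp_lt;
by rewrite e ltnn.
Qed.

Lemma spec_exp_bound u i : (spec_exp u i < r.+1)%N.
Proof.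
rewrite spec_expE (bigD1 i) //= below_irr add0n.
apply: (@leq_ltn_trans (\sum_(j | j != i) 1)%N).
  by apply: leq_sum => j _; case: below.
by rewrite sum1_card cardC1 card_ord.
Qed.

(** Positions i and j are adjacent, so no third position separates them and ties with it are broken
    as before; between the two there is no tie, as their values differ. *)
Lemma below_swapm i j u a b : j = i.+1 :> nat -> u i != u j ->
  below (swapm i j u) a b = below u (tperm i j a) (tperm i j b).
Proof.
move=> hij huij; rewrite /below !swapmE.
have ord k l : k <> l :> 'I_r.+1 -> (k : nat) <> l by move=> h /val_inj.
by do 2 case: tpermP => [->|->|/ord ? /ord ?]; move: huij; lia.
Qed.

Lemma spec_exp_swapm i j u k : j = i.+1 :> nat -> u i != u j ->
  spec_exp (swapm i j u) k = spec_exp u (tperm i j k).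
Proof.
move=> hij huij; rewrite !spec_expE [RHS](reindex_inj (@perm_inj _ (tperm i j))).
by apply: eq_bigr => l _; rewrite below_swapm.
Qed.

Lemma spec_exp_eq i j u : j = i.+1 :> nat -> u i = u j ->
  spec_exp u i = (spec_exp u j).+1.
Proof.
move=> hij huij; have ij : i != j by rewrite -val_eqE /= hij neq_ltn ltnSn.
rewrite !spec_expE (bigD1 j) //= [in RHS](bigD1 j) //= below_irr add0n.
have -> : below u j i by rewrite /below huij eqxx hij ltnSn orbT.
rewrite add1n; congr S; apply: eq_bigr => k kj; rewrite /below huij.
by have : (k : nat) != j by []; lia.
Qed.

(** Of two equal entries the one further left ranks higher. The first entry therefore wins its ties;
    moved to the end and increased by one, it loses the ties with entries that were already above
    it, and keeps its rank. *)
Lemma below_shiftm u a b : below (shiftm u) a b = below u (ordS a) (ordS b).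
Proof.
rewrite /below !shiftmE.
case: (eqVneq a ord_max) => [->|ha]; case: (eqVneq b ord_max) => [->|hb] /=;
  rewrite ?ordS_max ?(ordS_neq_max ha) ?(ordS_neq_max hb) ?modnn //=;
  rewrite ?addn0 ?addn1 //.
- by rewrite !ltnn !andbF.
- have hb' : (b < r)%N by rewrite ltn_neqAle -ltnS ltn_ord andbT.
  by rewrite ltn0; lia.
- have ha' : (a < r)%N by rewrite ltn_neqAle -ltnS ltn_ord andbT.
  have -> : (a.+1 %% r.+1 = a.+1)%N by rewrite modn_small.
  lia.
- have : (a < r)%N by rewrite ltn_neqAle -ltnS ltn_ord andbT.
  have : (b < r)%N by rewrite ltn_neqAle -ltnS ltn_ord andbT.
  by move=> hb' ha'; rewrite !modn_small; lia.
Qed.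

Lemma spec_exp_shiftm u k : spec_exp (shiftm u) k = spec_exp u (ordS k).
Proof.
rewrite !spec_expE [RHS](reindex_inj (can_inj (@ordSK r.+1))).
by apply: eq_bigr => l _; rewrite below_shiftm.
Qed.

Lemma spec_exp_max0 u : u ord_max = 0%N -> spec_exp u ord_max = 0%N.
Proof.
move=> h; rewrite spec_expE big1 // => j _; rewrite /below h ltn0 /=.
by have := ltn_ord j; rewrite [X in (X < _)%N]/=; case: ltnP; lia.
Qed.

Lemma spec_exp0 k : spec_exp (@mnm0 r.+1) k = (r - k)%N.
Proof.
have : (spec_exp (@mnm0 r.+1) k + k = r)%N; last by lia.
have [d] := ubnP (r - k)%N; elim: d k => // d IH k hd.
have [e|h] := eqVneq k ord_max.
  by rewrite e spec_exp_max0 ?mnm0E.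
have e := ordS_neq_max h; rewrite (spec_exp_eq e) ?mnm0E //.
have hk : (k < r)%N.
  by have := ltn_ord (ordS k); rewrite e ltnS.
by have := IH (ordS k); rewrite e; lia.
Qed.

(** A positive last entry can be unshifted, which lowers the degree. Otherwise a descent is swapped
    away; with no descent and last entry 0 the composition is zero. *)
Lemma composition_ind (P : mnm -> Prop) :
  P (@mnm0 _) ->
  (forall u, P u -> P (shiftm u)) ->
  (forall u i j, j = i.+1 :> nat -> (u i < u j)%N -> P u -> P (swapm i j u)) ->
  forall u, P u.
Proof.
move=> P0 Psh Psw u; have [d] := ubnP (mdeg u); elim: d u => // d IHd u hd.
(* Moving the larger of two adjacent entries to the right decreases this weighted sum. *)
pose L u := (\sum_(k < r.+1) (r - k) * u k)%N.
have [l] := ubnP (L u); elim: l u hd => // l IHl u hd hl.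
case: (posnP (u ord_max)) => [u0|upos]; last first.
  rewrite -(unshiftmK upos); apply/Psh/IHd.
  by move: hd; rewrite (mdeg_unshiftm upos).
have [/existsP[i hi]|] := boolP [exists i : 'I_r.+1,
    (i != ord_max) && (u (ordS i) < u i)%N].
  case/andP: hi => i_max hi; set j := ordS i; have e : j = i.+1 :> nat.
    exact: ordS_neq_max.
  have ij : i != j by apply: succ_neq e.
  rewrite -(swapmK i j u); apply: Psw => //.
    by rewrite !swapmE tpermL tpermR.
  apply: IHl; first by rewrite mdeg_swapm.
  apply: (@leq_trans (L u)); last by rewrite -ltnS.
  rewrite /L (bigD1 i) //= (bigD1 j) 1?eq_sym //=.
  rewrite [X in (_ < X)%N](bigD1 i) //= [X in (_ < (_ + X))%N](bigD1 j) 1?eq_sym //=.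
  rewrite !swapmE tpermL tpermR !addnA.
  rewrite (eq_bigr (fun k => (r - k) * u k)%N); last first.
    by move=> k /andP[ki kj]; rewrite swapmE tpermD // eq_sym.
  have hr : (i < r)%N by have := ltn_ord j; rewrite e ltnS.
  rewrite -addSn leq_add2r modn_small ?ltnS //.
  move: hi; rewrite -/j; nia.
rewrite negb_exists => /forallP h.
have mono k : u k = 0%N.
  have [c] := ubnP (r - k)%N; elim: c k => // c IHc k hc.
  have [->//|hk] := eqVneq k ord_max; have e := ordS_neq_max hk.
  have := h k; rewrite hk /= -leqNgt (IHc (ordS k)) ?leqn0; first by move/eqP.
  have hr : (k < r)%N by have := ltn_ord (ordS k); rewrite e ltnS.
  by rewrite e; lia.
by suff -> : u = @mnm0 _ by []; apply/mnmP => k; rewrite mono mnm0E.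
Qed.

End Compositions.

(** * A Bruhat order on compositions *)

Section Dominance.
Variable r : nat.
Notation mnm := (multinom r.+1).
Implicit Types (u v w m : mnm) (i j k : 'I_r.+1).

(* With u extended to all integer positions by u_{j+n} = u_j - 1, the number
   [prefix_count a c u] counts the pairs (j, b) with j < a, b >= c and
   b < u_j; comparing these counts is a Bruhat order, stable under
   [shiftm]. *)
Definition prefix_count (a c : nat) u : nat :=
  (\sum_(j < r.+1) (u j + (j < a) - c))%N.

Definition dominated m u :=
  mdeg m = mdeg u /\
  forall a c : nat, (a <= r.+1)%N ->
    (prefix_count a c m <= prefix_count a c u)%N.

Lemma dominated_refl u : dominated u u. Proof. by []. Qed.

Lemma prefix_count_shiftm (a c : nat) u : (a <= r)%N ->
  prefix_count a c (shiftm u) = prefix_count a.+1 c u.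
Proof.
move=> kr; rewrite /prefix_count [RHS](reindex_inj (can_inj (@ordSK r.+1))).
apply: eq_bigr => j _; rewrite shiftmE; case: eqVneq => [->|hj].
  by rewrite ordS_max /= ltnNge kr /= addn0.
by rewrite (ordS_neq_max hj) addn0.
Qed.

Lemma prefix_count0 (a : nat) u :
  prefix_count a 0 u = (mdeg u + \sum_(j < r.+1) (j < a))%N.
Proof.
by rewrite /prefix_count mdegE -big_split /=; apply: eq_bigr => j _; rewrite subn0.
Qed.

(** The periodicity of the extended composition, which closes the order up under the cyclic
    shift. *)
Lemma prefix_count_wrap c u : prefix_count r.+1 c.+1 u = prefix_count 0 c u.
Proof. by apply: eq_bigr => j _; rewrite ltn_ord addn1 subSS addn0. Qed.

Lemma dominated_shiftm m u : dominated m u -> dominated (shiftm m) (shiftm u).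
Proof.
case=> hd h; split; first by rewrite !mdeg_shiftm hd.
move=> a c; rewrite leq_eqVlt ltnS => /predU1P[->|ar]; last first.
  by rewrite !prefix_count_shiftm // h.
case: c => [|c]; first by rewrite !prefix_count0 !mdeg_shiftm hd.
by rewrite !prefix_count_wrap !prefix_count_shiftm // h.
Qed.

Lemma sum_split2 i j (F : 'I_r.+1 -> nat) : i != j ->
  (\sum_(k < r.+1) F k =
   F i + (F j + \sum_(k < r.+1 | (k != i) && (k != j)) F k))%N.
Proof. by move=> ij; rewrite (bigD1 i) //= (bigD1 j) // eq_sym. Qed.

(** Stated for every m' that can be an exponent of T_i x^m, including m itself. *)
Lemma dominated_swapm i j m m' u : j = i.+1 :> nat -> (u i < u j)%N ->
  dominated m u ->
  (forall k, k != i -> k != j -> m' k = m k) ->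
  (m' i + m' j = m i + m j)%N ->
  (m' i <= maxn (m i) (m j))%N -> (m' j <= maxn (m i) (m j))%N ->
  dominated m' (swapm i j u).
Proof.
move=> hij huij [hd h] hm hs hi hj; have ij := succ_neq hij.
have rest (f g : mnm) (a b c : nat) :
  (forall k, k != i -> k != j -> f k = g k) ->
  (forall k, k != i -> k != j -> (k < a) = (k < b))%N ->
  (\sum_(k < r.+1 | (k != i) && (k != j)) (f k + (k < a) - c) =
   \sum_(k < r.+1 | (k != i) && (k != j)) (g k + (k < b) - c))%N.
  by move=> e1 e2; apply: eq_bigr => k /andP[ki kj]; rewrite e1 ?e2.
have hu k : k != i -> k != j -> swapm i j u k = u k.
  by move=> ki kj; rewrite swapmE tpermD // eq_sym.
have ui : swapm i j u i = u j by rewrite swapmE tpermL.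
have uj : swapm i j u j = u i by rewrite swapmE tpermR.
split.
  rewrite mdeg_swapm -hd !mdegE !(sum_split2 _ ij) !addnA hs; congr addn.
  by apply: eq_bigr => k /andP[ki kj]; rewrite hm.
(* Unless a = j, the prefix contains both of i and j or neither, and convexity of the truncated
   subtraction suffices. *)
move=> a c ar; have [aj|aj] := eqVneq a (j : nat); last first.
  have e : (i < a)%N = (j < a)%N by move: aj; rewrite hij; lia.
  apply: leq_trans (_ : prefix_count a c u <= _)%N; last first.
    rewrite /prefix_count !(sum_split2 _ ij) ui uj (rest _ _ a a c hu) // e.
    lia.
  apply: leq_trans (h a c ar).
  rewrite /prefix_count !(sum_split2 _ ij) (rest _ _ a a c hm) // e.
  lia.
(* The prefix j separates i from j. Its count is controlled by the prefix i when c <= u_j and by the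
   prefix j + 1 otherwise. *)
have hi1 := h i c (ltnW (ltn_ord i)); have hi2 := h j.+1 c (ltn_ord j).
rewrite /prefix_count !(sum_split2 _ ij) in hi1 hi2 *.
rewrite (rest _ _ a j c hu) ?(rest _ _ a j c hm) ?aj ?ui ?uj //.
have ko k : k != i -> k != j -> (k < i)%N = (k < j)%N /\ (k < j.+1)%N = (k < j)%N.
  have ord (l : 'I_r.+1) : k != l -> (k : nat) != l by [].
  by move=> /ord + /ord; rewrite hij; lia.
have e1 f := rest f f i j c (fun _ _ _ => erefl)
  (fun k ki kj => proj1 (ko k ki kj)).
have e2 f := rest f f j.+1 j c (fun _ _ _ => erefl)
  (fun k ki kj => proj2 (ko k ki kj)).
rewrite !e1 in hi1; rewrite !e2 in hi2.
move: hi1 hi2; rewrite !hij !ltnn.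
move: (\sum_(k < r.+1 | _) (m k + _ - c))%N => A.
move: (\sum_(k < r.+1 | _) (u k + _ - c))%N => B.
have [-> -> ->] : [/\ (i.+1 < i)%N = false, (i < i.+2)%N = true
  & (i < i.+1)%N = true] by split; lia.
rewrite !addn0 !addn1.
case: (leqP c (u j)) => hc h1 h2.
  have -> : ((u j).+1 - c = (u j - c).+1)%N by lia.
  have : ((m' i).+1 - c + (m' j - c) <= (m i - c + (m j - c)).+1)%N.
    case: (leqP (m i) (m j)) hi hj => hm' hi hj; lia.
  lia.
have -> : ((u j).+1 - c = 0)%N by lia.
case: (leqP (m i) (m j)) hi hj => hm' hi hj; lia.
Qed.

(** At level u_j the prefix i bounds both m_i and m_j by u_j, and the prefix j excludes m_i = u_j.
    This isolates the leading coefficient of T_i p. *)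
Lemma dominated_extreme i j m u : j = i.+1 :> nat -> (u i < u j)%N ->
  dominated m u ->
  (forall k, k != i -> k != j -> m k = u k) ->
  (u j <= maxn (m i) (m j))%N -> m = u.
Proof.
move=> hij huij [hd h] hm hx; have ij := succ_neq hij.
have hs : (m i + m j = u i + u j)%N.
  have : (\sum_(k < r.+1 | (k != i) && (k != j)) m k =
          \sum_(k < r.+1 | (k != i) && (k != j)) u k)%N.
    by apply: eq_bigr => k /andP[ki kj]; rewrite hm.
  by move: hd; rewrite !mdegE !(sum_split2 _ ij); lia.
have e a c : (\sum_(k < r.+1 | (k != i) && (k != j)) (m k + (k < a) - c) =
   \sum_(k < r.+1 | (k != i) && (k != j)) (u k + (k < a) - c))%N.
  by apply: eq_bigr => k /andP[ki kj]; rewrite hm.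
have h1 := h i (u j) (ltnW (ltn_ord i)).
have h2 := h j (u j) (ltnW (ltn_ord j)).
rewrite /prefix_count !(sum_split2 _ ij) !e !addnA !leq_add2r !hij !ltnn ltnSn
  in h1 h2.
have [mi mj] : m i = u i /\ m j = u j.
  have e0 : (i.+1 < i)%N = false by lia.
  by move: h1 h2; rewrite e0; lia.
apply/mnmP => k; case: (eqVneq k i) => [->//|ki]; case: (eqVneq k j) => [->//|kj].
exact: hm.
Qed.

End Dominance.

(** * Legs under the two moves *)

Section Legs.
Variable r : nat.
Notation mnm := (multinom r.+1).
Implicit Types (u v w m : mnm) (i j k : 'I_r.+1).

Definition leg_at u i (c : nat) k : bool :=
  (i < k)%N && (c <= u k <= u i)%N || (k < i)%N && (c <= (u k).+1 <= u i)%N.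

Lemma legE u i c : leg u i c = (\sum_k leg_at u i c k)%N.
Proof.
rewrite /leg -!sum1_card [X in (X + _)%N]big_mkcond.
rewrite [X in (_ + X)%N]big_mkcond -big_split /=; apply: eq_bigr => k _.
rewrite !inE /leg_at; case: ltngtP => //= _; by case: andP.
Qed.

Lemma leg_shiftm u k c : k != ord_max -> leg (shiftm u) k c = leg u (ordS k) c.
Proof.
move=> hk; rewrite !legE [RHS](reindex_inj (can_inj (@ordSK r.+1))).
have hkr : (k < r)%N by have := ltn_ord (ordS k); rewrite (ordS_neq_max hk) ltnS.
apply: eq_bigr => l _; rewrite /leg_at (ordS_neq_max hk).
have [->|hl] := eqVneq l ord_max.
  rewrite ordS_max shiftm_max shiftmE (negPf hk) addn0 /=.
  by rewrite hkr; lia.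
by rewrite (ordS_neq_max hl) !shiftmE (negPf hk) (negPf hl) !addn0 !ltnS.
Qed.

Lemma leg_shiftm_max u c : leg (shiftm u) ord_max c.+2 = leg u ord0 c.+1.
Proof.
rewrite !legE [RHS](reindex_inj (can_inj (@ordSK r.+1))).
apply: eq_bigr => l _; rewrite /leg_at.
have [->|hl] := eqVneq l ord_max; first by rewrite ordS_max /= !ltnn.
rewrite (ordS_neq_max hl) shiftm_max shiftmE (negPf hl) addn0 ltn0 /=.
have hlr : (l < r)%N by have := ltn_ord (ordS l); rewrite (ordS_neq_max hl) ltnS.
by rewrite hlr; lia.
Qed.

Lemma leg_shiftm_new u : leg (shiftm u) ord_max 1 = spec_exp u ord0.
Proof.
rewrite legE spec_expE [RHS](reindex_inj (can_inj (@ordSK r.+1))).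
apply: eq_bigr => l _; rewrite /leg_at /below.
have [->|hl] := eqVneq l ord_max; first by rewrite ordS_max; lia.
rewrite (ordS_neq_max hl) shiftm_max shiftmE (negPf hl) addn0 /=.
have hlr : (l < r)%N by have := ltn_ord (ordS l); rewrite (ordS_neq_max hl) ltnS.
by rewrite hlr; lia.
Qed.

(** A row above is compared with its length increased by one, a row below with its length itself.
    Exchanging adjacent rows of lengths u_i < u_j thus affects only the box of the longer row in
    column u_i + 1. *)
Lemma leg_at_swapm i j u k l c : j = i.+1 :> nat -> (u i < u j)%N ->
  ((k != i) || (c != (u i).+1)) ->
  leg_at (swapm i j u) k c l = leg_at u (tperm i j k) c (tperm i j l).
Proof.
move=> hij huij; rewrite /leg_at !swapmE => hk.
have ord (a b : 'I_r.+1) : a <> b -> (a : nat) <> b by move=> h /val_inj.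
have hk' : (k : nat) <> i \/ c <> (u i).+1.
  by case/orP: hk => /eqP; [move/ord; left | right].
by move: hk' {hk}; do 2 case: tpermP => [->|->|/ord ? /ord ?]; lia.
Qed.

Lemma leg_swapm i j u k c : j = i.+1 :> nat -> (u i < u j)%N ->
  ((k != i) || (c != (u i).+1)) ->
  leg (swapm i j u) k c = leg u (tperm i j k) c.
Proof.
move=> hij huij hk.
rewrite !legE [RHS](reindex_inj (@perm_inj _ (tperm i j))).
by apply: eq_bigr => l _; rewrite leg_at_swapm.
Qed.

Lemma leg_swapm_new i j u : j = i.+1 :> nat -> (u i < u j)%N ->
  leg u j (u i).+1 = (leg (swapm i j u) i (u i).+1).+1.
Proof.
move=> hij huij; have ij := succ_neq hij.
rewrite !legE [in RHS](reindex_inj (@perm_inj _ (tperm i j))).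
rewrite [LHS](bigD1 i) //= [X in _ = X.+1](bigD1 i) //= tpermL.
have -> : leg_at u j (u i).+1 i.
  by rewrite /leg_at leqnn hij ltnSn huij orbT.
have -> : leg_at (swapm i j u) i (u i).+1 j = false.
  by rewrite /leg_at !swapmE tpermL tpermR hij; lia.
rewrite add0n add1n; congr S; apply: eq_bigr => l li; congr nat_of_bool.
have ord (a b : 'I_r.+1) : a <> b -> (a : nat) <> b by move=> h /val_inj.
move/eqP/ord: li => li.
rewrite /leg_at !swapmE tpermK tpermL.
by case: tpermP => [e|->|/ord ? /ord ?]; rewrite ?e in li *; lia.
Qed.

(** The leg counts the positions from i, included, to j, excluded, in the order [below u]. *)
Lemma leg_spec_exp i j u : j = i.+1 :> nat -> (u i < u j)%N ->
  (leg u j (u i).+1 + spec_exp u i = spec_exp u j)%N.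
Proof.
move=> hij huij; rewrite legE !spec_expE -big_split /=; apply: eq_bigr => l _.
rewrite /leg_at /below.
have [->|li] := eqVneq l i; first by lia.
have [->|lj] := eqVneq l j; first by lia.
by have : (l : nat) != i /\ (l : nat) != j by []; lia.
Qed.

End Legs.

(** * Spectral vectors and leading coefficients *)

Section SpectralVectors.
Variables (K : numFieldType) (q t : K) (hqt : generic_qt q t) (r : nat).
Notation mnm := (multinom r.+1).
Implicit Types (u v w m : mnm) (i j k : 'I_r.+1).
Local Notation spc := (spectral q t).

Lemma q_neq0 : q != 0. Proof. by case: hqt. Qed.
Lemma t_neq0 : t != 0. Proof. by case: hqt. Qed.

Lemma qt_inj (a b c d : nat) :
  q ^+ a * t ^+ b = q ^+ c * t ^+ d -> a = c /\ b = d.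
Proof.
move=> e; case: hqt => q0 t0 /(_ (a%:Z - c%:Z) (b%:Z - d%:Z)).
rewrite !expfzDr // -!exprnN -!exprnP mulrACA -invfM e mulfV.
  by case=> // /eqP + /eqP; rewrite !subr_eq0 => /eqP[->] /eqP[->].
by rewrite mulf_neq0 // expf_neq0.
Qed.

Lemma spectral_neq0 u i : spc u i != 0.
Proof. by rewrite mulf_neq0 // expf_neq0 ?q_neq0 ?t_neq0. Qed.

Lemma spectral_swapm i j u k : j = i.+1 :> nat -> u i != u j ->
  spc (swapm i j u) k = spc u (tperm i j k).
Proof. by move=> hij huij; rewrite /spectral spec_exp_swapm // swapmE. Qed.

Lemma spectral_shiftm u k :
  spc (shiftm u) k = spc u (ordS k) * (if k == ord_max then q else 1).
Proof.
rewrite /spectral spec_exp_shiftm shiftmE; case: eqP => _; last first.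
  by rewrite addn0 mulr1.
by rewrite addn1 exprSr mulrAC.
Qed.

Lemma spectral_shiftm_max u : spc (shiftm u) ord_max = q * spc u ord0.
Proof. by rewrite spectral_shiftm eqxx ordS_max mulrC. Qed.

Lemma spectral_eq i j u : j = i.+1 :> nat -> u i = u j ->
  spc u i = t * spc u j.
Proof.
by move=> hij e; rewrite /spectral e (spec_exp_eq hij e) exprS mulrCA.
Qed.

Lemma spectral_max0 u : u ord_max = 0%N -> spc u ord_max = 1.
Proof. by move=> h; rewrite /spectral h spec_exp_max0 // mulr1. Qed.

Lemma spectral_max_eq1 u : (0 < u ord_max)%N -> spc u ord_max != 1.
Proof.
move=> h; apply/eqP => e; have [] := @qt_inj (u ord_max) (spec_exp u ord_max) 0 0.
  by rewrite mulr1.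
by move=> e'; rewrite e' in h.
Qed.

Lemma spectral_inj u v i j : spc u i = spc v j -> u i = v j.
Proof. by case/qt_inj. Qed.

Lemma spectral_neq u i j : i != j -> spc u i != spc u j.
Proof.
by move=> ij; apply/eqP => /qt_inj[_ /spec_exp_inj e]; rewrite e eqxx in ij.
Qed.

Lemma t_neq1 : t != 1.
Proof.
by apply/eqP => e; have [] := @qt_inj 0 1 0 0; rewrite ?expr0 ?mul1r ?expr1.
Qed.

Lemma qt_neq1 (a b : nat) : (0 < a)%N -> 1 - q ^+ a * t ^+ b != 0.
Proof.
move=> a0; rewrite subr_eq0 eq_sym; apply/eqP => e.
have [] := @qt_inj a b 0 0; first by rewrite mulr1.
by move=> e'; rewrite e' in a0.
Qed.

(** The coefficient of the transposition when T_i is evaluated at <u>. For adjacent positions it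
    vanishes exactly when u_i = u_j, that is when transposing <u> leaves the lattice. *)
Definition tau i j u := (spc u i - t * spc u j) / (spc u i - spc u j).

Lemma tau_eq0 i j u : j = i.+1 :> nat -> u i = u j -> tau i j u = 0.
Proof. by move=> hij e; rewrite /tau (spectral_eq hij e) subrr mul0r. Qed.

Lemma tau_neq0 i j u : i != j -> u i != u j -> tau i j u != 0.
Proof.
move=> ij e; rewrite mulf_neq0 ?invr_eq0 ?subr_eq0 ?spectral_neq //.
apply/eqP => h; case/eqP: e.
have := @qt_inj (u i) (spec_exp u i) (u j) (spec_exp u j).+1.
by case=> //; rewrite exprS mulrCA.
Qed.

(** The coefficient of x^u in [Minterp q t u]: the powers of q in its two normalisations cancel. *)
Definition eta u : K := t ^+ nstat u / cprime q t u.

Definition box_weight u i (c : nat) : K :=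
  t ^+ leg u i c.+1 / (1 - q ^+ (u i - c) * t ^+ leg u i c.+1).

Lemma etaE u : eta u = \prod_i \prod_(c < u i) box_weight u i c.
Proof.
rewrite /eta /nstat /cprime -prodrXr -prodfV -big_split /=; apply: eq_bigr => i _.
rewrite -prodrXr -prodfV -big_split /=; apply: eq_bigr => c _.
by rewrite /box_weight /arm -subSn ?subSS.
Qed.

Lemma cprime_neq0 u : cprime q t u != 0.
Proof.
by apply/prodf_neq0 => i _; apply/prodf_neq0 => c _; apply: qt_neq1.
Qed.

Lemma eta_neq0 u : eta u != 0.
Proof. by rewrite mulf_neq0 ?invr_eq0 ?cprime_neq0 ?expf_neq0 ?t_neq0. Qed.

Lemma eta0 : eta (@mnm0 r.+1) = 1.
Proof. by rewrite etaE big1 // => i _; rewrite big1 // => -[c]; rewrite mnm0E. Qed.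

(** The added box is best placed in the first column of the new last row: its leg is
    [spec_exp u ord0], and all other boxes keep their arms and legs. *)
Lemma eta_shiftm u :
  eta (shiftm u) =
  eta u * (q ^- u ord0 * spc u ord0 / (1 - q * spc u ord0)).
Proof.
rewrite !etaE [LHS](bigD1 ord_max) //=.
rewrite [in RHS](reindex_inj (can_inj (@ordSK r.+1))) /=.
rewrite [X in _ = X * _](bigD1 ord_max) //= [RHS]mulrC mulrA ordS_max.
congr (_ * _); last first.
  apply: eq_bigr => k hk; rewrite shiftmE (negPf hk) addn0.
  by apply: eq_bigr => c _; rewrite /box_weight leg_shiftm // shiftmE (negPf hk) addn0.
rewrite shiftm_max big_ord_recl; congr (_ * _).
  rewrite /box_weight leg_shiftm_new subn0 shiftm_max /spectral.
  by rewrite mulKf ?expf_neq0 ?q_neq0 // mulrA -exprS.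
apply: eq_bigr => c _.
by rewrite /box_weight leg_shiftm_max shiftm_max /= /bump leq0n add1n subSS.
Qed.

(** Only the box of the longer row in column u_i + 1 changes its weight, and the ratio of its two
    weights is [tau] at the swapped composition. *)
Lemma eta_swapm i j u : j = i.+1 :> nat -> (u i < u j)%N ->
  eta (swapm i j u) * tau i j (swapm i j u) = eta u.
Proof.
move=> hij huij; have ij := succ_neq hij.
have huij' : u i != u j by rewrite neq_ltn huij.
rewrite !etaE [X in _ = X](reindex_inj (@perm_inj _ (tperm i j))) /=.
rewrite (bigD1 i) //= [RHS](bigD1 i) //= mulrAC swapmE tpermL.
congr (_ * _); last first.
  apply: eq_bigr => k ki; rewrite swapmE; apply: eq_bigr => c _.
  by rewrite /box_weight leg_swapm ?ki // swapmE.
rewrite (bigD1 (Ordinal huij)) //= [RHS](bigD1 (Ordinal huij)) //= mulrAC.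
congr (_ * _); last first.
  apply: eq_bigr => c hc; rewrite /box_weight leg_swapm ?swapmE ?tpermL //.
  apply/orP; right; apply: contra hc => /eqP[e]; apply/eqP/val_inj.
  by rewrite /= e.
rewrite /box_weight (leg_swapm_new hij huij) swapmE tpermL.
rewrite /tau !spectral_swapm // tpermL tpermR /spectral.
have := leg_spec_exp hij huij; rewrite (leg_swapm_new hij huij) => <-.
move: (leg _ _ _) (spec_exp u i) => l k.
have -> : u j = (u i + (u j - u i))%N by rewrite subnKC // ltnW.
rewrite addKn; set d := (u j - u i)%N; set a := u i.
have d0 : (0 < d)%N by rewrite subn_gt0.
rewrite !exprD !exprS.
have h1 := qt_neq1 l d0; have h2 := qt_neq1 l.+1 d0; rewrite exprS in h2.
have qa : q ^+ a != 0 by rewrite expf_neq0 ?q_neq0.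
have tk : t ^+ k != 0 by rewrite expf_neq0 ?t_neq0.
have h3 : q ^+ a * q ^+ d * (t * t ^+ l * t ^+ k) - q ^+ a * t ^+ k != 0.
  have -> : q ^+ a * q ^+ d * (t * t ^+ l * t ^+ k) - q ^+ a * t ^+ k =
    - (q ^+ a * t ^+ k * (1 - q ^+ d * (t * t ^+ l))) by ring.
  by rewrite oppr_eq0 !mulf_neq0.
move: h1 h2 h3 qa tk; move: (q ^+ a) (q ^+ d) (t ^+ l) (t ^+ k) => A D L k' *.
field.
by apply/and3P; split.
Qed.

End SpectralVectors.

(** * Operators on polynomials *)

Section MonomialMaps.
Variables (K : numFieldType) (n : nat).
Notation MP := (mpoly n K).
Notation mnm := (multinom n).
Implicit Types (p f g : MP) (m u v : mnm).

Definition hom (d : nat) : qualifier 0 MP := @ishomog1 n K d mdeg.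

Lemma homP d p : reflect (forall m, mcoeff m p != 0 -> mdeg m = d) (p \is hom d).
Proof.
apply: (iffP (dhomogP _ d p)) => h m; first by rewrite -mcoeff_msupp => /h.
by rewrite mcoeff_msupp => /h.
Qed.

Lemma msize_leP d p :
  reflect (forall m, (d < mdeg m)%N -> mcoeff m p = 0) (msize p <= d.+1)%N.
Proof.
apply: (iffP idP) => [h m hm|h].
  by apply/memN_msupp_eq0/mmeasure_mnm_ge/(leq_trans h).
rewrite mmeasureE; apply/bigmax_leqP_seq => m hm _; rewrite ltnS leqNgt.
by apply/negP => /h; apply/eqP; rewrite -mcoeff_msupp.
Qed.

Lemma mcoeff_pihomog d p m :
  mcoeff m (pihomog mdeg d p) = if mdeg m == d then mcoeff m p else 0.
Proof.
rewrite pihomogE [in RHS](mpolyE p) !raddf_sum big_mkcond /=.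
case: eqP => h.
  apply: eq_bigr => l _; case: eqP => // hl.
  rewrite mcoeffZ mcoeffX; case: eqP => [e|]; last by rewrite mulr0.
  by rewrite e in hl.
apply: big1 => l _; case: eqP => // hl.
rewrite mcoeffZ mcoeffX; case: eqP => [e|]; last by rewrite mulr0.
by rewrite -e in h.
Qed.

Lemma pihomog_hom d p : p \is hom d -> pihomog mdeg d p = p.
Proof. exact: pihomog_dE. Qed.

Lemma pihomog_hom_neq d e p : p \is hom d -> d != e -> pihomog mdeg e p = 0.
Proof.
move=> /homP h de; apply/mpolyP => m; rewrite mcoeff_pihomog mcoeff0.
case: eqP => // hm; apply/eqP/negPn/negP => /h e'.
by rewrite -e' hm eqxx in de.
Qed.

Lemma pihomog_small d p : (msize p <= d)%N -> pihomog mdeg d p = 0.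
Proof.
case: d => [|d] h.
  have -> : p = 0 by apply/eqP; rewrite -(@mmeasure_poly_eq0 _ _ mdeg) -leqn0.
  exact: pihomog0.
apply/mpolyP => m; rewrite mcoeff_pihomog mcoeff0; case: eqP => // hm.
by move/msize_leP: h; apply; rewrite hm.
Qed.

(** Operators are given on monomials and extended linearly, so that degree bounds and homogeneity
    are checked on monomials only. *)
Definition mlin (V : lmodType K) (F : mnm -> V) p : V :=
  \sum_(m <- msupp p) mcoeff m p *: F m.

Lemma mlinwE (V : lmodType K) (F : mnm -> V) d p : (msize p <= d)%N ->
  mlin F p = \sum_(m : bmultinom n d) mcoeff m p *: F m.
Proof.
move=> le_pd; pose I : subFinType _ := bmultinom n d.
rewrite /mlin (big_mksub I) //=; first last.
- by move=> x /msize_mdeg_lt /leq_trans; apply.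
- exact: msupp_uniq.
by rewrite big_rmcond //= => j /memN_msupp_eq0 ->; rewrite scale0r.
Qed.

Lemma mlin_is_linear (V : lmodType K) (F : mnm -> V) : linear (mlin F).
Proof.
move=> c p g; pose d := maxn (msize (c *: p + g)) (maxn (msize p) (msize g)).
rewrite !(@mlinwE _ F d) ?leq_max ?leqnn ?orbT //.
rewrite scaler_sumr -big_split /=; apply: eq_bigr => m _.
by rewrite mcoeffD mcoeffZ scalerDl scalerA.
Qed.

HB.instance Definition _ (V : lmodType K) (F : mnm -> V) :=
  GRing.isLinear.Build K MP V *:%R (mlin F) (mlin_is_linear F).

Lemma mlinX (V : lmodType K) (F : mnm -> V) m : mlin F (mpolyX K m) = F m.
Proof. by rewrite /mlin msuppX big_seq1 mcoeffX eqxx scale1r. Qed.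

Lemma mlinMl (c : MP) (F : mnm -> MP) p :
  mlin (fun m => c * F m) p = c * mlin F p.
Proof.
by rewrite /mlin mulr_sumr; apply: eq_bigr => m _; rewrite scalerAr.
Qed.

Lemma mlinD (V : lmodType K) (F G : mnm -> V) p :
  mlin (fun m => F m + G m) p = mlin F p + mlin G p.
Proof.
by rewrite /mlin -big_split; apply: eq_bigr => m _; rewrite scalerDr.
Qed.

Lemma mlin_id p : mlin (fun m => mpolyX K m) p = p.
Proof. by rewrite [RHS]mpolyE. Qed.

Lemma mlinZ (V : lmodType K) (c : K) (F : mnm -> V) p :
  mlin (fun m => c *: F m) p = c *: mlin F p.
Proof.
by rewrite /mlin scaler_sumr; apply: eq_bigr => m _; rewrite !scalerA mulrC.
Qed.

Lemma mcoeff_mlin (F : mnm -> MP) p m :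
  mcoeff m (mlin F p) = \sum_(l <- msupp p) mcoeff l p * mcoeff m (F l).
Proof.
by rewrite /mlin raddf_sum /=; apply: eq_bigr => l _; rewrite mcoeffZ.
Qed.

Lemma meval_mlin (F : mnm -> MP) p (x : 'I_n -> K) :
  meval x (mlin F p) = \sum_(l <- msupp p) mcoeff l p * meval x (F l).
Proof.
by rewrite /mlin raddf_sum /=; apply: eq_bigr => l _; rewrite mevalZ.
Qed.

Lemma msize_mlin (F : mnm -> MP) (a : nat) p :
  (forall m, (msize (F m) <= mdeg m + a.+1)%N) ->
  (msize (mlin F p) <= msize p + a)%N.
Proof.
move=> h; apply: leq_trans (mmeasure_sum _ _ _ _) _.
apply/bigmax_leqP_seq => m hm _; apply: leq_trans (mmeasureZ_le _ _ _) _.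
apply: leq_trans (h m) _.
by rewrite -addSnnS leq_add2r; apply: mmeasure_mnm_lt.
Qed.

Lemma pihomog_mlin (F : mnm -> MP) d p :
  (forall m, F m \is hom (mdeg m)) ->
  pihomog mdeg d (mlin F p) = mlin F (pihomog mdeg d p).
Proof.
move=> h; rewrite /mlin linear_sum /= [in RHS]pihomogE -/(mlin F _).
rewrite linear_sum [in RHS]big_mkcond /=; apply: eq_bigr => m _.
rewrite linearZ /=; case: eqP => [e|/eqP e].
  by rewrite linearZ /= mlinX; congr (_ *: _); apply: pihomog_hom; rewrite -e.
by rewrite (pihomog_hom_neq (h m) e) scaler0.
Qed.

Lemma msize_hom d p : p \is hom d -> (msize p <= d.+1)%N.
Proof.
move=> /homP h; apply/msize_leP => m hm; apply/eqP/negPn/negP => /h e.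
by rewrite e ltnn in hm.
Qed.

Lemma homX m d : mdeg m = d -> mpolyX K m \is hom d.
Proof. by move=> <-; rewrite /hom dhomogX. Qed.

Lemma homM d e p g : p \is hom d -> g \is hom e -> p * g \is hom (d + e).
Proof. exact: dhomogM. Qed.

End MonomialMaps.

(** * Hecke operators and the raising operator *)

Section Operators.
Variables (K : numFieldType) (q t : K) (r : nat).
Notation MP := (mpoly r.+1 K).
Notation mnm := (multinom r.+1).
Implicit Types (p f g : MP) (m u v : mnm) (i j k : 'I_r.+1) (x : 'I_r.+1 -> K).

Definition Xv i : MP := mpolyX K (mnm1 i).

Lemma meval_Xv x i : meval x (Xv i) = x i.
Proof. exact: mevalXU. Qed.

Lemma Xv_hom i : Xv i \is hom K r.+1 1.
Proof. by apply: homX; rewrite mdeg1. Qed.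

Definition setm i j m (a b : nat) : mnm :=
  Multinom [tuple (if k == i then a else if k == j then b else m k) | k < r.+1].

Lemma setmE i j m a b k :
  setm i j m a b k = if k == i then a else if k == j then b else m k.
Proof. exact: mnmE. Qed.

Lemma setm_id i j m : setm i j m (m i) (m j) = m.
Proof.
by apply/mnmP => k; rewrite setmE; case: eqP => [->//|_]; case: eqP => [->|].
Qed.

Lemma swapm_setm i j m : i != j -> swapm i j m = setm i j m (m j) (m i).
Proof.
move=> ij; apply/mnmP => k; rewrite setmE swapmE.
case: tpermP => [->|->|/eqP/negPf -> /eqP/negPf -> //]; rewrite ?eqxx //.
by rewrite eq_sym (negPf ij).
Qed.

Lemma mdeg_setm i j m a b : i != j -> (a + b = m i + m j)%N ->
  mdeg (setm i j m a b) = mdeg m.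
Proof.
move=> ij h; rewrite !mdegE !(sum_split2 _ ij) !addnA !setmE !eqxx.
rewrite [j == i]eq_sym (negPf ij) h; congr addn; apply: eq_bigr => k /andP[ki kj].
by rewrite setmE (negPf ki) (negPf kj).
Qed.

Lemma mpolyX_setm i j m a b : i != j ->
  mpolyX K (setm i j m a b) = mpolyX K (setm i j m 0 0) * (Xv i ^+ a * Xv j ^+ b).
Proof.
move=> ij; rewrite /Xv !mpolyXn -!mpolyXD; congr (mpolyX K _).
apply/mnmP => k; rewrite !mnmDE !mulmnE !mnm1E !setmE.
rewrite [i == k]eq_sym [j == k]eq_sym.
case: (eqVneq k i) => [->|ki].
  by rewrite (negPf ij) mul1n mul0n addn0.
by case: eqP => _; rewrite ?mul1n ?mul0n ?addn0 ?add0n.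
Qed.

Lemma Xvi_setm i j m a b : i != j ->
  Xv i * mpolyX K (setm i j m a b) = mpolyX K (setm i j m a.+1 b).
Proof.
move=> ij; rewrite (mpolyX_setm m a b ij) (mpolyX_setm m a.+1 b ij) exprS.
by rewrite mulrCA !mulrA.
Qed.

Lemma Xvj_setm i j m a b : i != j ->
  Xv j * mpolyX K (setm i j m a b) = mpolyX K (setm i j m a b.+1).
Proof.
move=> ij; rewrite (mpolyX_setm m a b ij) (mpolyX_setm m a b.+1 ij) exprS.
by rewrite mulrCA [Xv j * (_ * _)]mulrCA.
Qed.

(** The divided difference of x^m, written as a geometric sum so that no division by x_i - x_j is
    involved. *)
Definition divdiffX i j m : MP :=
  if (m i <= m j)%N
  then \sum_(k < m j - m i) mpolyX K (setm i j m (m j - k.+1) (m i + k))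
  else - \sum_(k < m i - m j) mpolyX K (setm i j m (m i - k.+1) (m j + k)).

Lemma divdiffXP i j m : i != j ->
  (Xv i - Xv j) * divdiffX i j m = mpolyX K (swapm i j m) - mpolyX K m.
Proof.
move=> ij; rewrite swapm_setm //.
have -> : mpolyX K m = mpolyX K (setm i j m (m i) (m j)) by rewrite setm_id.
rewrite [mpolyX K (setm i j m (m j) _)]mpolyX_setm //.
rewrite [mpolyX K (setm i j m (m i) _)]mpolyX_setm // -mulrBr /divdiffX.
set Z := mpolyX K _; set X := Xv i; set Y := Xv j.
have key (a b : nat) : (a <= b)%N ->
  (X - Y) * (\sum_(k < b - a) mpolyX K (setm i j m (b - k.+1) (a + k))) =
  Z * (X ^+ b * Y ^+ a - X ^+ a * Y ^+ b).
  move=> ab.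
  have -> : \sum_(k < b - a) mpolyX K (setm i j m (b - k.+1) (a + k)) =
    Z * (X ^+ a * Y ^+ a) * \sum_(k < b - a) X ^+ ((b - a).-1 - k) * Y ^+ k.
    rewrite mulr_sumr; apply: eq_bigr => k _.
    rewrite mpolyX_setm // -/Z -!mulrA; congr (_ * _).
    rewrite exprD -/X -/Y.
    have -> : (b - k.+1 = a + ((b - a).-1 - k))%N by have := ltn_ord k; lia.
    by rewrite exprD -!mulrA; congr (_ * _); rewrite mulrCA.
  rewrite mulrCA -subrXX -mulrA; congr (_ * _).
  have [d ->] : exists d, b = (a + d)%N by exists (b - a)%N; rewrite subnKC.
  by rewrite addKn !exprD; ring.
case: leqP => h; first exact: key.
by rewrite mulrN key ?(ltnW h) // -mulrN opprB.
Qed.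

Definition divdiff i j : MP -> MP := mlin (divdiffX i j).

Lemma msym_swapm i j m :
  msym (tperm i j) (mpolyX K m) = mpolyX K (swapm i j m).
Proof. by rewrite msymX tpermV. Qed.

Lemma divdiffP i j p : i != j ->
  (Xv i - Xv j) * divdiff i j p = msym (tperm i j) p - p.
Proof.
move=> ij; rewrite /divdiff -mlinMl /mlin.
under eq_bigr do rewrite divdiffXP // scalerBr.
rewrite sumrB -mpolyE; congr (_ - _).
rewrite [in RHS](mpolyE p) raddf_sum /=; apply: eq_bigr => m _.
by rewrite msymZ msym_swapm.
Qed.

Lemma meval_msym (s : 'S_r.+1) x p :
  meval x (msym s p) = meval (x \o s) p.
Proof.
rewrite [RHS]mevalE {1}(mpolyE p) (raddf_sum (msym s)) (raddf_sum (meval x)) /=.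
apply: eq_bigr => m _.
rewrite msymZ mevalZ msymX mevalX; congr (_ * _).
rewrite (reindex_inj (@perm_inj _ s)); apply: eq_bigr => k _.
by rewrite mnmE permK.
Qed.

(** The Demazure-Lusztig operator t + (x_i - t x_j) (s_i - 1) / (x_i - x_j) on a monomial. *)
Definition heckeX i j m : MP :=
  t *: mpolyX K m + (Xv i - t *: Xv j) * divdiffX i j m.

Definition hecke i j : MP -> MP := mlin (heckeX i j).

Lemma heckeE i j p :
  hecke i j p = t *: p + (Xv i - t *: Xv j) * divdiff i j p.
Proof. by rewrite /hecke mlinD mlinZ mlin_id mlinMl. Qed.

Lemma meval_hecke i j x p : i != j -> x i != x j ->
  meval x (hecke i j p) = t * meval x p
    + (x i - t * x j) / (x i - x j) * (meval (x \o tperm i j) p - meval x p).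
Proof.
move=> ij xij; rewrite heckeE mevalD mevalZ mevalM; congr (_ + _).
rewrite -meval_msym -mevalB -divdiffP // mevalM !mevalB mevalZ !meval_Xv.
by rewrite mulrA divfK // subr_eq0.
Qed.

(** Unlike [meval_hecke] this allows x_j = 0 as well, so T_i moves a vanishing coordinate at every
    point. *)
Lemma meval_hecke0 i j x p : i != j -> x i = 0 ->
  meval x (hecke i j p) = t * meval (x \o tperm i j) p.
Proof.
move=> ij xi; rewrite heckeE mevalD mevalZ mevalM mevalB mevalZ !meval_Xv xi.
have := congr1 (meval x) (divdiffP p ij).
rewrite mevalM !mevalB !meval_Xv meval_msym xi !sub0r => h.
have -> : - (t * x j) * meval x (divdiff i j p) =
          t * (- x j * meval x (divdiff i j p)) by ring.
by rewrite h; ring.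
Qed.

Lemma mcoeffX_setm i j m a b c d : i != j ->
  mcoeff (setm i j m a b) (mpolyX K (setm i j m c d)) = ((c == a) && (d == b))%:R.
Proof.
move=> ij; rewrite mcoeffX; congr (nat_of_bool _)%:R.
apply/eqP/andP => [/mnmP h|[/eqP-> /eqP->] //].
have := h i; have := h j; rewrite !setmE !eqxx [j == i]eq_sym (negPf ij).
by move=> -> ->.
Qed.

(* Every monomial of T_i x^m arises from x^m by replacing (m_i, m_j) by a pair
   with the same sum and entries at most max(m_i, m_j). *)
Definition between i j m m' :=
  exists a b, [/\ m' = setm i j m a b, (a + b = m i + m j)%N,
    (a <= maxn (m i) (m j))%N & (b <= maxn (m i) (m j))%N].

Lemma heckeX_supp i j m m' : i != j ->
  mcoeff m' (heckeX i j m) != 0 -> between i j m m'.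
Proof.
move=> ij; pose P (g : MP) := forall l, mcoeff l g != 0 -> between i j m l.
suff : P (heckeX i j m) by apply.
have PD g h : P g -> P h -> P (g + h).
  move=> hg hh l; rewrite mcoeffD; case: (eqVneq (mcoeff l g) 0) => [->|/hg //].
  by rewrite add0r => /hh.
have PZ c g : P g -> P (c *: g).
  move=> hg l; rewrite mcoeffZ; case: (eqVneq (mcoeff l g) 0) => [->|/hg //].
  by rewrite mulr0 eqxx.
have PN g : P g -> P (- g) by rewrite -scaleN1r; apply: (PZ).
have P0 : P 0 by move=> l; rewrite mcoeff0 eqxx.
have PX a b : (a + b = m i + m j)%N -> (a <= maxn (m i) (m j))%N ->
    (b <= maxn (m i) (m j))%N -> P (mpolyX K (setm i j m a b)).
  move=> e1 e2 e3 l; rewrite mcoeffX; case: (_ =P l) => [<- _|_]; first by exists a, b.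
  by rewrite eqxx.
have XiE a b := Xvi_setm m a b ij.
have XjE a b := Xvj_setm m a b ij.
have Psum (N : nat) (F : 'I_N -> MP) : (forall k : 'I_N, P (F k)) -> P (\sum_(k < N) F k).
  by move=> hF; elim/big_ind: _ => // g h; apply: (PD).
rewrite /heckeX; apply: (PD).
  by apply: (PZ); rewrite -{1}(setm_id i j m); apply: (PX); rewrite ?leq_max ?leqnn ?orbT.
rewrite /divdiffX mulrBl; case: leqP => hm; rewrite ?mulrN; last first.
  apply: (PD); first apply/PN; last apply/PN/PN; rewrite -?scalerAl ?mulr_sumr.
    by apply: (Psum) => k; rewrite XiE; apply: (PX); have := ltn_ord k; lia.
  apply: (PZ).
  by apply: (Psum) => k; rewrite XjE; apply: (PX); have := ltn_ord k; lia.
apply: (PD); last apply/PN; rewrite -?scalerAl ?mulr_sumr.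
  by apply: (Psum) => k; rewrite XiE; apply: (PX); have := ltn_ord k; lia.
apply: (PZ).
by apply: (Psum) => k; rewrite XjE; apply: (PX); have := ltn_ord k; lia.
Qed.

Lemma between_mdeg i j m m' : i != j -> between i j m m' -> mdeg m' = mdeg m.
Proof. by move=> ij [a [b [-> h _ _]]]; apply: mdeg_setm. Qed.

Lemma heckeX_hom i j m : i != j -> heckeX i j m \is hom K r.+1 (mdeg m).
Proof. by move=> ij; apply/homP => l /(heckeX_supp ij) /between_mdeg; apply. Qed.

Lemma mcoeff_heckeX_swapm i j m : i != j -> (m i < m j)%N ->
  mcoeff (swapm i j m) (heckeX i j m) = 1.
Proof.
move=> ij hm; rewrite /heckeX /divdiffX ltnW // mcoeffD mcoeffZ swapm_setm //.
have -> : mpolyX K m = mpolyX K (setm i j m (m i) (m j)) by rewrite setm_id.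
rewrite mcoeffX_setm //.
have -> : (m i == m j) = false by apply/eqP; lia.
rewrite mulr0 add0r mulrBl mcoeffB -scalerAl mcoeffZ !mulr_sumr !raddf_sum /=.
have XiE a b := Xvi_setm m a b ij.
have XjE a b := Xvj_setm m a b ij.
rewrite [X in _ - _ * X]big1 ?mulr0 ?subr0; last first.
  move=> k _; rewrite XjE mcoeffX_setm //.
  have -> // : (m j - k.+1 == m j)%N = false by apply/eqP; lia.
have h0 : (0 < m j - m i)%N by rewrite subn_gt0.
rewrite (bigD1 (Ordinal h0)) //= XiE mcoeffX_setm // addn0.
have -> : ((m j - 1).+1 = m j)%N by lia.
rewrite !eqxx big1 ?addr0 // => k hk; rewrite XiE mcoeffX_setm //.
have : (k : nat) != 0%N by apply: contra hk => /eqP e; apply/eqP/val_inj.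
move=> k0; have -> // : ((m j - k.+1).+1 == m j) = false.
by apply/eqP; have := ltn_ord k; lia.
Qed.

Lemma msize_hecke i j p : i != j -> (msize (hecke i j p) <= msize p)%N.
Proof.
move=> ij; rewrite -[X in (_ <= X)%N]addn0; apply: msize_mlin => m.
by rewrite addn1; apply/msize_hom/heckeX_hom.
Qed.

Lemma pihomog_hecke i j d p : i != j ->
  pihomog mdeg d (hecke i j p) = hecke i j (pihomog mdeg d p).
Proof. by move=> ij; apply: pihomog_mlin => m; apply: heckeX_hom. Qed.

Definition rotm m : mnm := Multinom [tuple m (ordS k) | k < r.+1].

Lemma mdeg_rotm m : mdeg (rotm m) = mdeg m.
Proof.
rewrite !mdegE [RHS](reindex_inj (can_inj (@ordSK r.+1))).
by apply: eq_bigr => k _; rewrite mnmE.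
Qed.

(** The linear extension maps p to p(x_n / q, x_1, .., x_{n-1}), whose value at the spectral vector
    of [shiftm u] is that of p at <u>. *)
Definition DeltaX m : MP := q ^- m ord0 *: mpolyX K (rotm m).
Definition Delta : MP -> MP := mlin DeltaX.

Lemma DeltaX_hom m : DeltaX m \is hom K r.+1 (mdeg m).
Proof. by rewrite /DeltaX; apply/dhomogZ/homX/mdeg_rotm. Qed.

Lemma msize_Delta p : (msize (Delta p) <= msize p)%N.
Proof.
rewrite -[X in (_ <= X)%N]addn0; apply: msize_mlin => m.
by rewrite addn1; apply/msize_hom/DeltaX_hom.
Qed.

Definition shiftx x k := x (ord_pred k) * (if k == ord0 then q^-1 else 1).

Lemma meval_Delta x p : meval x (Delta p) = meval (shiftx x) p.
Proof.
rewrite meval_mlin mevalE; apply: eq_bigr => m _; congr (_ * _).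
rewrite mevalZ mevalX [in LHS](reindex_inj (can_inj (@ord_predK r.+1))) /=.
rewrite (bigD1 ord0) //= [RHS](bigD1 ord0) //= mulrA; congr (_ * _).
  by rewrite mnmE ord_predK /shiftx eqxx exprMn exprVn mulrC.
apply: eq_bigr => k hk; rewrite mnmE ord_predK /shiftx (negPf hk) mulr1 //.
Qed.

Definition rotVm m : mnm := Multinom [tuple m (ord_pred k) | k < r.+1].

Lemma mdeg_rotVm m : mdeg (rotVm m) = mdeg m.
Proof.
rewrite !mdegE [RHS](reindex_inj (can_inj (@ord_predK r.+1))).
by apply: eq_bigr => k _; rewrite mnmE.
Qed.

Definition DeltaVX m : MP := q ^+ m ord_max *: mpolyX K (rotVm m).
Definition DeltaV : MP -> MP := mlin DeltaVX.

Lemma msize_DeltaV p : (msize (DeltaV p) <= msize p)%N.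
Proof.
rewrite -[X in (_ <= X)%N]addn0; apply: msize_mlin => m.
by rewrite addn1; apply: msize_hom; rewrite /DeltaVX; apply/dhomogZ/homX/mdeg_rotVm.
Qed.

Definition shiftVx x k := x (ordS k) * (if k == ord_max then q else 1).

Lemma meval_DeltaV x p : meval x (DeltaV p) = meval (shiftVx x) p.
Proof.
rewrite meval_mlin mevalE; apply: eq_bigr => m _; congr (_ * _).
rewrite mevalZ mevalX [in LHS](reindex_inj (can_inj (@ordSK r.+1))) /=.
rewrite (bigD1 ord_max) //= [RHS](bigD1 ord_max) //= mulrA; congr (_ * _).
  by rewrite mnmE ordSK /shiftVx eqxx exprMn mulrC.
apply: eq_bigr => k hk; rewrite mnmE ordSK /shiftVx (negPf hk) mulr1 //.
Qed.

(** The raising operator of Knop and Sahi. The factor x_n - 1 vanishes at <w> exactly when w_n = 0,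
    that is when w is not a shift. *)
Definition Phi p : MP := (Xv ord_max - 1) * Delta p.

Lemma PhiE p : Phi p = mlin (fun m => (Xv ord_max - 1) * DeltaX m) p.
Proof. by rewrite mlinMl. Qed.

Lemma msize_Phi p : (msize (Phi p) <= (msize p).+1)%N.
Proof.
rewrite PhiE -[X in (_ <= X)%N]addn1; apply: msize_mlin => m.
have h : ((Xv ord_max : MP) \is hom K r.+1 1) := Xv_hom _.
rewrite mulrBl mul1r; apply: leq_trans (mmeasureD_le _ _ _) _.
rewrite mmeasureN geq_max; apply/andP; split.
  have := homM h (DeltaX_hom m); rewrite add1n => /msize_hom; by rewrite addn2.
by apply: leq_trans (msize_hom (DeltaX_hom m)) _; rewrite addn2.
Qed.

Lemma Phi_is_linear : linear Phi.
Proof. by move=> c p g; rewrite !PhiE linearP. Qed.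

HB.instance Definition _ := GRing.isLinear.Build K MP MP *:%R Phi Phi_is_linear.
HB.instance Definition _ i j := GRing.Linear.copy (hecke i j) (mlin (heckeX i j)).
HB.instance Definition _ := GRing.Linear.copy Delta (mlin DeltaX).
HB.instance Definition _ := GRing.Linear.copy DeltaV (mlin DeltaVX).

End Operators.

(** * Interpolation polynomials *)

Section PochhammerPolynomial.
Variables (K : numFieldType) (q t : K) (hqt : generic_qt q t) (r : nat).
Notation mnm := (multinom r.+1).
Implicit Types (u v w m : mnm) (i j k : 'I_r.+1).
Local Notation spc := (spectral q t).

(* The polynomial (z t^{n-1})_u in z, with the rows of u taken in place: the
   row at position k gets the shift t^{spec_exp u k}. *)
Definition gpoch u : {poly K} :=
  \prod_k qpoch q%:P (t ^+ spec_exp u k *: 'X) (u k).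

Lemma gpoch_swapm i j u : j = i.+1 :> nat -> gpoch (swapm i j u) = gpoch u.
Proof.
move=> hij; case: (eqVneq (u i) (u j)) => [/swapm_id -> //|huij].
rewrite /gpoch [RHS](reindex_inj (@perm_inj _ (tperm i j))).
by apply: eq_bigr => k _; rewrite spec_exp_swapm // swapmE.
Qed.

Lemma gpoch_shiftm u : gpoch (shiftm u) = gpoch u * (1 - spc u ord0 *: 'X).
Proof.
rewrite /gpoch (bigD1 ord_max) //= shiftm_max spec_exp_shiftm ordS_max.
rewrite [X in _ = X * _](reindex_inj (can_inj (@ordSK r.+1))) /=.
rewrite [X in _ = X * _](bigD1 ord_max) //= ordS_max mulrAC; congr (_ * _).
  rewrite /qpoch big_ord_recr /=; congr (_ * (1 - _)).
  by rewrite -polyC_exp mulrC mul_polyC scalerA.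
apply: eq_bigr => k hk.
by rewrite spec_exp_shiftm shiftmE (negPf hk) addn0.
Qed.

Lemma gpoch0 : gpoch (@mnm0 r.+1) = 1.
Proof. by rewrite /gpoch big1 // => k _; rewrite mnm0E /qpoch big_ord0. Qed.

Definition gpoch_lc u := lead_coef (gpoch u).

Lemma linfactor_size (a : K) : a != 0 -> size (1 - a *: 'X : {poly K}) = 2%N.
Proof.
move=> a0; rewrite addrC size_polyDl size_polyN size_scale // size_polyX //.
by rewrite size_poly1.
Qed.

Lemma linfactor_lc (a : K) : a != 0 -> lead_coef (1 - a *: 'X : {poly K}) = - a.
Proof.
move=> a0; rewrite lead_coefE linfactor_size // coefB coefZ coefX coef1 /=.
by rewrite mulr1 sub0r.
Qed.

Lemma size_gpoch u : size (gpoch u) = (mdeg u).+1.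
Proof.
elim/composition_ind: u => [|u IH|u i j hij huij IH].
- by rewrite gpoch0 size_poly1 mdeg0.
- have s0 := spectral_neq0 hqt u ord0.
  have h1 : gpoch u != 0 by rewrite -size_poly_eq0 IH.
  have h2 : 1 - spc u ord0 *: 'X != 0 :> {poly K}.
    by rewrite -size_poly_eq0 linfactor_size.
  by rewrite gpoch_shiftm size_mul // linfactor_size // IH mdeg_shiftm addn2.
by rewrite gpoch_swapm // mdeg_swapm.
Qed.

Lemma gpoch_neq0 u : gpoch u != 0.
Proof. by rewrite -size_poly_eq0 size_gpoch. Qed.

Lemma gpoch_lc_neq0 u : gpoch_lc u != 0.
Proof. by rewrite lead_coef_eq0 gpoch_neq0. Qed.

Lemma gpoch_lc_swapm i j u : j = i.+1 :> nat ->
  gpoch_lc (swapm i j u) = gpoch_lc u.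
Proof. by move=> hij; rewrite /gpoch_lc gpoch_swapm. Qed.

Lemma gpoch_lc_shiftm u : gpoch_lc (shiftm u) = - spc u ord0 * gpoch_lc u.
Proof.
rewrite /gpoch_lc gpoch_shiftm lead_coefM linfactor_lc ?spectral_neq0 //.
exact: mulrC.
Qed.

Lemma gpoch_lc0 : gpoch_lc (@mnm0 r.+1) = 1.
Proof. by rewrite /gpoch_lc gpoch0 lead_coef1. Qed.

Lemma gpoch_coef0 u : (gpoch u)`_0 = 1.
Proof.
rewrite -horner_coef0 /gpoch horner_prod big1 // => k _.
rewrite /qpoch horner_prod big1 // => l _.
by rewrite hornerD hornerN hornerM hornerZ hornerX mulr0 mul0r oppr0 addr0 hornerC.
Qed.

End PochhammerPolynomial.

(** * Existence and uniqueness of the interpolation polynomials *)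

Section Existence.
Variables (K : numFieldType) (q t : K) (hqt : generic_qt q t) (r : nat).
Notation MP := (mpoly r.+1 K).
Notation mnm := (multinom r.+1).
Implicit Types (p f g : MP) (u v w m : mnm) (i j k : 'I_r.+1).
Local Notation spc := (spectral q t).
Local Notation lc := (gpoch_lc q t).
Local Notation T := (hecke t).
Local Notation Phi := (Phi q).
Local Notation tau := (tau q t).

(** For w_i = w_j the transposed vector leaves the lattice, but [tau] is then 0. Hence the lattice
    values of T_i p depend only on those of p. *)
Lemma hecke_spectral i j w p : j = i.+1 :> nat ->
  meval (spc w) (T i j p) = t * meval (spc w) p
    + tau i j w * (meval (spc (swapm i j w)) p - meval (spc w) p).
Proof.
move=> hij; have ij := succ_neq hij.
rewrite meval_hecke ?spectral_neq // -/(tau i j w).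
case: (eqVneq (w i) (w j)) => [e|e]; first by rewrite tau_eq0 // !mul0r.
congr (_ + _ * (_ - _)); apply: meval_eq => k /=.
by rewrite spectral_swapm.
Qed.

Lemma Delta_spectral u p :
  meval (spc (shiftm u)) (Delta q p) = meval (spc u) p.
Proof.
rewrite meval_Delta; apply: meval_eq => k; rewrite /shiftx spectral_shiftm.
rewrite ord_predK -ordS_eq0 ord_predK; case: eqP => _; rewrite ?mulr1 //.
by rewrite mulfK ?(q_neq0 hqt).
Qed.

Lemma DeltaV_spectral u p :
  meval (spc u) (DeltaV q p) = meval (spc (shiftm u)) p.
Proof.
by rewrite meval_DeltaV; apply: meval_eq => k; rewrite /shiftVx spectral_shiftm.
Qed.

Lemma Phi_spectral_shiftm u p :
  meval (spc (shiftm u)) (Phi p) = (q * spc u ord0 - 1) * meval (spc u) p.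
Proof.
rewrite mevalM mevalB meval_Xv meval1 Delta_spectral.
by rewrite spectral_shiftm_max.
Qed.

Lemma Phi_spectral0 w p : w ord_max = 0%N -> meval (spc w) (Phi p) = 0.
Proof.
by move=> h; rewrite mevalM mevalB meval_Xv meval1 spectral_max0 // subrr mul0r.
Qed.

Lemma sum_msupp_delta p m0 (c : mnm -> K) :
  \sum_(l <- msupp p) mcoeff l p * (c l * (l == m0)%:R) = mcoeff m0 p * c m0.
Proof.
have [h|h] := boolP (m0 \in msupp p).
  rewrite (bigD1_seq m0) ?msupp_uniq //= eqxx mulr1 big1 ?addr0 // => l /negPf ->.
  by rewrite !mulr0.
rewrite (memN_msupp_eq0 h) mul0r big1_seq // => l /andP[_ hl].
case: eqP => [e|_]; last by rewrite !mulr0.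
by rewrite -e hl in h.
Qed.

Lemma shiftm_rotm m : shiftm m = mnm_add (mnm1 ord_max) (rotm m).
Proof.
by apply/mnmP => k; rewrite mnmDE mnm1E shiftmE mnmE addnC eq_sym.
Qed.

Lemma mcoeff_Phi d m p : (msize p <= d.+1)%N -> mdeg m = d.+1 ->
  mcoeff m (Phi p) =
  if (0 < m ord_max)%N
  then mcoeff (unshiftm m) p * q ^- unshiftm m ord0 else 0.
Proof.
move=> /msize_leP hp hm; rewrite PhiE mcoeff_mlin.
transitivity (\sum_(l <- msupp p) mcoeff l p * (q ^- l ord0 * (shiftm l == m)%:R)).
  apply: eq_bigr => l _; rewrite /DeltaX -scalerAr mcoeffZ mulrBl mul1r mcoeffB.
  (* The summand coming from - Delta p has degree at most d and cannot contribute. *)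
  rewrite -mpolyXD -shiftm_rotm !mcoeffX; case: (rotm l =P m) => [e|_].
    by rewrite (hp l) ?mul0r // -hm -e mdeg_rotm.
  by rewrite subr0.
case: posnP => h.
  apply: big1 => l _; case: (shiftm l =P m) => [e|_]; last by rewrite !mulr0.
  by rewrite -e shiftm_max in h.
rewrite -(@sum_msupp_delta p (unshiftm m) (fun l => q ^- l ord0)).
apply: eq_bigr => l _; congr (_ * (_ * _%:R)); congr nat_of_bool.
apply/eqP/eqP => [<-|->]; first by rewrite shiftmK.
by rewrite unshiftmK.
Qed.

(* The dominance clause is what lets the moves track the coefficient of x^u. *)
Definition interp_spec u p :=
  [/\ (msize p <= (mdeg u).+1)%N,
      forall w, (mdeg w <= mdeg u)%N ->
        meval (spc w) p = if w == u then lc u else 0,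
      forall m, mdeg m = mdeg u -> mcoeff m p != 0 -> dominated m u
    & mcoeff u p = eta q t u].

(** With s the first entry of <u>, the value of Phi(M_u) at the shifted point is (q s - 1) lc_u,
    whereas the new polynomial must take the value - s lc_u there; this is the quotient. *)
Definition phi_coef u := (1 - q * spc u ord0) / spc u ord0.

Lemma phi_coef_neq0 u : phi_coef u != 0.
Proof.
rewrite mulf_neq0 ?invr_eq0 ?spectral_neq0 // /spectral mulrA -exprS.
exact: qt_neq1.
Qed.

Lemma interp_spec0 : interp_spec (@mnm0 _) 1.
Proof.
split.
- by rewrite mmeasure1 mdeg0.
- move=> w; rewrite mdeg0 leqn0 => /eqP /mdeg_eq0_mnm ->.
  by rewrite eqxx meval1 gpoch_lc0.
- by move=> m; rewrite mdeg0 => /mdeg_eq0_mnm -> _; apply: dominated_refl.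
by rewrite mcoeff1 eqxx eta0.
Qed.

Lemma interp_spec_shiftm u p :
  interp_spec u p -> interp_spec (shiftm u) ((phi_coef u)^-1 *: Phi p).
Proof.
case=> h1 h2 h3 h4; split.
- apply: leq_trans (mmeasureZ_le _ _ _) _; apply: leq_trans (msize_Phi _ _) _.
  by rewrite mdeg_shiftm ltnS.
- move=> w hw; rewrite mevalZ; case: (posnP (w ord_max)) => [w0|w0].
    rewrite Phi_spectral0 // mulr0; case: eqP => // e.
    by rewrite e shiftm_max in w0.
  rewrite -(unshiftmK w0) Phi_spectral_shiftm h2; last first.
    by rewrite (mdeg_unshiftm w0) mdeg_shiftm in hw.
  rewrite (inj_eq (can_inj (@shiftmK r))); case: eqP => [->|_]; last first.
    by rewrite !mulr0.
  rewrite gpoch_lc_shiftm // mulrA; congr (_ * _).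
  rewrite -(mulKf (phi_coef_neq0 u) (- spc u ord0)).
  by congr (_ * _); rewrite /phi_coef mulrN divfK ?spectral_neq0 // opprB.
- move=> m; rewrite mdeg_shiftm => hm; rewrite mcoeffZ (mcoeff_Phi h1 hm).
  case: posnP => [_|m0]; first by rewrite mulr0 eqxx.
  case: (eqVneq (mcoeff (unshiftm m) p) 0) => [->|hne _].
    by rewrite mul0r mulr0 eqxx.
  rewrite -(unshiftmK m0); apply/dominated_shiftm/h3 => //.
  by apply: eq_add_S; rewrite -hm (mdeg_unshiftm m0).
rewrite mcoeffZ (mcoeff_Phi h1 (mdeg_shiftm u)) shiftm_max shiftmK h4.
rewrite (eta_shiftm hqt) mulrCA; congr (_ * _).
by rewrite /phi_coef invf_div -mulrA mulrC mulrA.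
Qed.

(** Subtracting t - tau_i(u) cancels the value at u, so that up to degree |u| only the value at
    [swapm i j u] survives. By dominance the leading coefficient is produced by x^u alone. *)
Lemma interp_spec_swapm u p i j : j = i.+1 :> nat -> (u i < u j)%N ->
  interp_spec u p ->
  interp_spec (swapm i j u)
    ((tau i j (swapm i j u))^-1 *: (T i j p - (t - tau i j u) *: p)).
Proof.
move=> hij huij [h1 h2 h3 h4]; have ij := succ_neq hij.
have nu : u i != u j by rewrite neq_ltn huij.
have nsu : swapm i j u <> u.
  by move=> /mnmP /(_ i); rewrite swapmE tpermL => e; rewrite e eqxx in nu.
have t0 : tau i j (swapm i j u) != 0.
  by apply: tau_neq0 => //; rewrite !swapmE tpermL tpermR eq_sym.
split.
- apply: leq_trans (mmeasureZ_le _ _ _) _; apply: leq_trans (mmeasureD_le _ _ _) _.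
  rewrite mmeasureN geq_max mdeg_swapm (leq_trans (msize_hecke _ _ ij)) //=.
  exact: leq_trans (mmeasureZ_le _ _ _) h1.
- move=> w; rewrite mdeg_swapm => hw.
  rewrite mevalZ mevalB mevalZ hecke_spectral // !h2 ?mdeg_swapm //.
  rewrite (can2_eq (@swapmK _ i j) (@swapmK _ i j)) gpoch_lc_swapm //.
  case: (eqVneq w u) => [->|nw].
    rewrite eq_sym; move/eqP/negPf: nsu => ->.
    rewrite (_ : _ - _ = 0) ?mulr0 //; ring.
  case: eqP => [->|_]; last by rewrite !mulr0 subrr mulr0 addr0 subrr mulr0.
  by rewrite !mulr0 !subr0 add0r mulKf.
- move=> m; rewrite mdeg_swapm mcoeffZ => hm hne.
  have {hne} : mcoeff m (T i j p) != 0 \/ mcoeff m p != 0.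
    case: (eqVneq (mcoeff m p) 0) hne => [e|]; last by right.
    rewrite mcoeffB mcoeffZ e mulr0 subr0.
    by case: (eqVneq (mcoeff m (T i j p)) 0) => [->|]; [rewrite mulr0 eqxx | left].
  case=> [hne|/(h3 _ hm) hd]; last first.
    by apply: (dominated_swapm hij huij hd) => //; rewrite leq_max leqnn ?orbT.
  have [l [hl hlm]] : exists l, mcoeff l p != 0 /\ mcoeff m (heckeX t i j l) != 0.
    apply: contrapT => hno; case/eqP: hne; rewrite mcoeff_mlin big1 // => l _.
    apply/eqP/negPn/negP; rewrite mulf_eq0 negb_or => /andP[h5 h6].
    by apply: hno; exists l.
  have hb := heckeX_supp ij hlm.
  have dl : mdeg l = mdeg u by rewrite -hm (between_mdeg ij hb).
  have [a [b [-> e1 e2 e3]]] := hb.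
  apply: (dominated_swapm hij huij (h3 _ dl hl)); rewrite ?setmE ?eqxx //.
  - by move=> k ki kj; rewrite setmE (negPf ki) (negPf kj).
  - by rewrite eq_sym (negPf ij).
  by rewrite eq_sym (negPf ij).
have c0 : mcoeff (swapm i j u) p = 0.
  apply/eqP/negPn/negP => /(h3 _ (mdeg_swapm _ _ _)) hd.
  apply: nsu; apply: (dominated_extreme hij huij hd).
    by move=> k ki kj; rewrite swapmE tpermD // eq_sym.
  by rewrite !swapmE tpermL leq_max leqnn.
rewrite mcoeffZ mcoeffB mcoeffZ c0 mulr0 subr0 mcoeff_mlin.
have -> : eta q t (swapm i j u) = (tau i j (swapm i j u))^-1 * eta q t u.
  by rewrite -(eta_swapm hqt hij huij) mulrCA mulVf ?mulr1.
congr (_ * _); rewrite -h4 -[RHS]mulr1.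
rewrite -(@sum_msupp_delta p u (fun=> 1)); apply: eq_big_seq => l hl.
rewrite mul1r; congr (_ * _); case: (eqVneq l u) => [->|nl].
  exact: mcoeff_heckeX_swapm.
apply/eqP/negPn/negP => hlm; case/eqP: nl.
have hb := heckeX_supp ij hlm.
have dl : mdeg l = mdeg u by rewrite -(between_mdeg ij hb) mdeg_swapm.
have hl' : dominated l u by apply: h3 => //; rewrite -mcoeff_msupp.
have [a [b [/mnmP e e1 e2 e3]]] := hb.
apply: (dominated_extreme hij huij hl').
  move=> k ki kj; have := e k; rewrite setmE (negPf ki) (negPf kj) => <-.
  by rewrite swapmE tpermD // eq_sym.
by have := e i; rewrite setmE eqxx swapmE tpermL => ->.
Qed.

Lemma interp_spec_ex u : exists p, interp_spec u p.
Proof.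
elim/composition_ind: u => [|u [p hp]|u i j hij huij [p hp]].
- by exists 1; apply: interp_spec0.
- by eexists; apply: interp_spec_shiftm hp.
by eexists; apply: interp_spec_swapm hp.
Qed.

Lemma big_enum_ord (I : finType) (F : I -> K) :
  \sum_i F i = \sum_(a < #|I|) F (enum_val a).
Proof. by rewrite (reindex _ (onW_bij _ (enum_val_bij I))). Qed.

(** Existence implies uniqueness, as there are as many lattice points as monomials. The values of
    the constructed polynomials form an invertible triangular matrix L = C E, so the matrix E of
    monomials at lattice points is invertible. *)
Lemma spectral_unique d f : (msize f <= d)%N ->
  (forall w, (mdeg w < d)%N -> meval (spc w) f = 0) -> f = 0.
Proof.
move=> hf hv.
have [P hP] := boolp.choice interp_spec_ex.
pose I : finType := bmultinom r.+1 d.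
pose N := #|I|.
pose ev (a : 'I_N) : mnm := (enum_val a : I).
have ev_deg a : (mdeg (ev a) < d)%N by apply: bmdeg.
have ev_inj : injective ev by move=> a b /val_inj /enum_val_inj.
pose L : 'M[K]_N := \matrix_(a, b) meval (spc (ev b)) (P (ev a)).
pose C : 'M[K]_N := \matrix_(a, b) mcoeff (ev b) (P (ev a)).
pose E : 'M[K]_N := \matrix_(a, b) meval (spc (ev b)) (mpolyX K (ev a)).
have expand (g : MP) w : (msize g <= d)%N ->
    meval (spc w) g = \sum_a mcoeff (ev a) g * meval (spc w) (mpolyX K (ev a)).
  move=> hg; rewrite {1}(mpolywE hg) (raddf_sum (meval (spc w))) /= big_enum_ord.
  by apply: eq_bigr => a _; rewrite mevalZ.
have LCE : L = C *m E.
  apply/matrixP => a b; rewrite !mxE expand; last first.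
    by case: (hP (ev a)) => + _ _ _; move/leq_trans; apply; apply: ev_deg.
  by apply: eq_bigr => l _; rewrite !mxE.
have Lunit : L \in unitmx.
  rewrite -row_free_unit; apply: inj_row_free => y hy; apply/rowP => a.
  rewrite [RHS]mxE.
  have [s] := ubnP (mdeg (ev a)); elim: s a => // s IH a ha.
  have := congr1 (fun M : 'rV_N => M 0 a) hy; rewrite !mxE (bigD1 a) //= big1.
    rewrite addr0 mxE; case: (hP (ev a)) => _ -> // _ _; rewrite eqxx => /eqP.
    by rewrite mulf_eq0 (negPf (gpoch_lc_neq0 hqt _)) orbF => /eqP.
  move=> b ba; rewrite mxE; case: (ltnP (mdeg (ev b)) (mdeg (ev a))) => hba.
    by rewrite IH ?mul0r //; apply: leq_trans hba _.
  case: (hP (ev b)) => _ -> // _ _.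
  by rewrite (inj_eq ev_inj) eq_sym (negPf ba) mulr0.
have Eunit : E \in unitmx by move: Lunit; rewrite LCE unitmx_mul => /andP[].
have : (\row_a mcoeff (ev a) f) *m E = 0.
  apply/rowP => b; rewrite [RHS]mxE -(hv (ev b) (ev_deg b)) expand //.
  by rewrite mxE; apply: eq_bigr => a _; rewrite !mxE.
move/(congr1 (mulmx^~ (invmx E))); rewrite mulmxK // mul0mx => /rowP h.
apply/mpolyP => m; rewrite mcoeff0; case: (ltnP (mdeg m) d) => hm; last first.
  by apply/memN_msupp_eq0/mmeasure_mnm_ge/(leq_trans hf).
have := h (enum_rank (BMultinom hm : I)); rewrite !mxE /ev enum_rankK //.
Qed.

Lemma spectral_eq_poly f g :
  (forall w, meval (spc w) f = meval (spc w) g) -> f = g.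
Proof.
move=> h; apply/eqP; rewrite -subr_eq0; apply/eqP.
by apply: (@spectral_unique (msize (f - g))) => // w _; rewrite mevalB h subrr.
Qed.

(** By uniqueness the polynomial chosen by [xget] is a multiple of p; the constant c adjusts the
    leading coefficient from [eta] to q^{-n'(u)}. *)
Lemma interp_spec_interp u p : interp_spec u p -> Minterp q t u = p.
Proof.
case=> h1 h2 h3 h4.
have q0 : q ^+ nstat' u != 0 by rewrite expf_neq0 ?(q_neq0 hqt).
pose c := q ^- nstat' u / eta q t u.
have c0 : c != 0 by rewrite mulf_neq0 ?invr_eq0 ?eta_neq0 // expf_neq0 ?(q_neq0 hqt).
have hcp : is_interp q t u (c *: p).
  split.
  - apply/eqP; rewrite eqn_leq (leq_trans (mmeasureZ_le _ _ _) h1) /=.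
    apply: mmeasure_mnm_lt; rewrite mcoeff_msupp mcoeffZ h4.
    by rewrite mulf_neq0 ?eta_neq0.
  - by move=> v hv vu; rewrite mevalZ h2 // (negPf vu) mulr0.
  by rewrite mcoeffZ h4 divfK ?eta_neq0.
have uniq (p' : MP) : is_interp q t u p' -> p' = c *: p.
  case=> e1 e2 e3; pose b := meval (spc u) p' / lc u.
  have lc0 := gpoch_lc_neq0 hqt u.
  have e : p' = b *: p.
    apply/eqP; rewrite -subr_eq0; apply/eqP.
    apply: (@spectral_unique (mdeg u).+1).
      apply: leq_trans (mmeasureD_le _ _ _) _.
      by rewrite mmeasureN geq_max e1 leqnn (leq_trans (mmeasureZ_le _ _ _) h1).
    move=> w; rewrite ltnS => hw; rewrite mevalB mevalZ h2 //.
    case: eqP => [->|/eqP wu]; first by rewrite divfK // subrr.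
    by rewrite e2 // mulr0 subrr.
  rewrite e; congr (_ *: _); move: e3; rewrite e mcoeffZ h4 /c => <-.
  by rewrite mulfK ?eta_neq0.
have -> : Minterp q t u = (q ^+ nstat' u * eta q t u) *: interp q t u.
  by rewrite /Minterp /eta mulrA.
have -> : interp q t u = c *: p.
  by apply: uniq; rewrite /interp; apply: xgetPex; exists (c *: p).
rewrite scalerA /c mulrACA mulfV // mulfV ?eta_neq0 // mulr1 scale1r //.
Qed.

Lemma Minterp_spec u : interp_spec u (Minterp q t u).
Proof. by have [p hp] := interp_spec_ex u; rewrite (interp_spec_interp hp). Qed.

End Existence.

(** * Operator identities for the interpolation polynomials *)

Section InterpolationTheory.
Variables (K : numFieldType) (q t : K) (hqt : generic_qt q t) (r : nat).
Notation MP := (mpoly r.+1 K).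
Notation mnm := (multinom r.+1).
Implicit Types (p f g : MP) (u v w m : mnm) (i j : 'I_r.+1) (k : nat).
Local Notation spc := (spectral q t).
Local Notation lc := (gpoch_lc q t).
Local Notation T := (hecke t).
Local Notation Phi := (Phi q).
Local Notation tau := (tau q t).

Local Notation phi_coef := (phi_coef q t).

(** Locked, so that conversion never unfolds the choice operator. *)
Definition imac u : MP := locked (Minterp q t u).
Local Notation M := imac.

Lemma imacE u : M u = Minterp q t u. Proof. by rewrite /imac -lock. Qed.

Lemma msize_M u : (msize (M u) <= (mdeg u).+1)%N.
Proof. by rewrite imacE; case: (Minterp_spec hqt u). Qed.

Lemma M_spectral u w : (mdeg w <= mdeg u)%N ->
  meval (spc w) (M u) = lc u * (w == u)%:R.
Proof.
rewrite imacE; case: (Minterp_spec hqt u) => _ h _ _ /h ->.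
by case: eqP => _; rewrite ?mulr1 ?mulr0.
Qed.

Lemma M_small u w : (mdeg w <= mdeg u)%N -> w != u -> meval (spc w) (M u) = 0.
Proof. by move=> h /negPf e; rewrite M_spectral // e mulr0. Qed.

Lemma M_diag u : meval (spc u) (M u) = lc u.
Proof. by rewrite M_spectral // eqxx mulr1. Qed.

Lemma M_unique u f (c : K) : (msize f <= (mdeg u).+1)%N ->
  (forall w, (mdeg w <= mdeg u)%N -> meval (spc w) f = c * lc u * (w == u)%:R) ->
  f = c *: M u.
Proof.
move=> hf hv; apply/eqP; rewrite -subr_eq0; apply/eqP.
apply: (spectral_unique hqt (d := (mdeg u).+1)).
  apply: leq_trans (mmeasureD_le _ _ _) _.
  by rewrite mmeasureN geq_max hf (leq_trans (mmeasureZ_le _ _ _) (msize_M u)).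
by move=> w hw; rewrite mevalB mevalZ hv // M_spectral // mulrA subrr.
Qed.

Lemma M0 : M (@mnm0 r.+1) = 1.
Proof. by rewrite imacE (interp_spec_interp hqt (interp_spec0 q t r)). Qed.

Lemma Phi_M u : Phi (M u) = phi_coef u *: M (shiftm u).
Proof.
rewrite !imacE.
rewrite (interp_spec_interp hqt (interp_spec_shiftm hqt (Minterp_spec hqt u))).
by rewrite scalerA mulfV ?scale1r ?phi_coef_neq0.
Qed.

(** Both sides have degree at most |v|, so the lattice values up to that degree decide. The case v_i
    = v_j is included, since [tau] is 0 there. *)
Lemma hecke_M i j v : j = i.+1 :> nat ->
  T i j (M v) = (t - tau i j v) *: M v + tau i j (swapm i j v) *: M (swapm i j v).
Proof.
move=> hij; have ij := succ_neq hij; apply/eqP; rewrite -subr_eq0; apply/eqP.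
apply: (spectral_unique hqt (d := (mdeg v).+1)).
  apply: leq_trans (mmeasureD_le _ _ _) _; rewrite mmeasureN geq_max.
  rewrite (leq_trans (msize_hecke _ _ ij) (msize_M v)) /=.
  apply: leq_trans (mmeasureD_le _ _ _) _; rewrite geq_max.
  rewrite (leq_trans (mmeasureZ_le _ _ _) (msize_M v)) /=.
  apply: leq_trans (mmeasureZ_le _ _ _) _.
  by apply: leq_trans (msize_M _) _; rewrite mdeg_swapm.
move=> w; rewrite ltnS => hw.
rewrite mevalB mevalD !mevalZ (hecke_spectral hqt) // !M_spectral ?mdeg_swapm //.
rewrite gpoch_lc_swapm // (can2_eq (@swapmK _ i j) (@swapmK _ i j)).
have e1 : tau i j w * (w == v)%:R = tau i j v * (w == v)%:R.
  by case: eqP => [->|]; rewrite ?mulr0.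
have e2 : tau i j w * (w == swapm i j v)%:R =
          tau i j (swapm i j v) * (w == swapm i j v)%:R.
  by case: eqP => [->|]; rewrite ?mulr0.
rewrite mulrBr [tau i j w * (_ * (w == v)%:R)]mulrCA.
rewrite [tau i j w * (_ * _)]mulrCA e1 e2; ring.
Qed.

Definition heckek (k : nat) : MP -> MP := T (inord k) (inord k.+1).

HB.instance Definition _ k := GRing.Linear.copy (heckek k)
  (T (inord k) (inord k.+1)).

(* [hecke_up k] is T_0 ... T_{k-1}, [hecke_down k] is T_{k-1} ... T_0. *)
Fixpoint hecke_up (k : nat) p : MP :=
  if k is k'.+1 then hecke_up k' (heckek k' p) else p.
Fixpoint hecke_down (k : nat) p : MP :=
  if k is k'.+1 then heckek k' (hecke_down k' p) else p.

Lemma hecke_up_is_linear k : linear (hecke_up k).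
Proof.
by elim: k => [|k IH] c p g //=; rewrite linearP IH.
Qed.

HB.instance Definition _ k :=
  GRing.isLinear.Build K MP MP *:%R (hecke_up k) (hecke_up_is_linear k).

Lemma inordS (k : nat) : (k < r)%N ->
  (inord k.+1 : 'I_r.+1) = (inord k : 'I_r.+1).+1 :> nat.
Proof. by move=> h; rewrite !inordK // ltnS ltnW. Qed.

Lemma inord_neq (k : nat) : (k < r)%N ->
  (inord k : 'I_r.+1) != (inord k.+1 : 'I_r.+1).
Proof. by move=> h; apply/succ_neq/inordS. Qed.

Lemma msize_hecke_up k p : (k <= r)%N -> (msize (hecke_up k p) <= msize p)%N.
Proof.
elim: k p => [|k IH] p h //=; apply: leq_trans (IH _ (ltnW h)) _.
exact/msize_hecke/inord_neq.
Qed.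

Lemma pihomog_hecke_up k d p : (k <= r)%N ->
  pihomog mdeg d (hecke_up k p) = hecke_up k (pihomog mdeg d p).
Proof.
elim: k p => [|k IH] p h //=; rewrite IH ?(ltnW h) // pihomog_hecke //.
exact: inord_neq.
Qed.

Lemma hecke_hom i j d p : i != j ->
  p \is hom K r.+1 d -> T i j p \is hom K r.+1 d.
Proof.
move=> ij hp; rewrite /hom homog_piE pihomog_hecke // pihomog_hom //.
Qed.

Lemma hecke_down_hom k d p : (k <= r)%N -> p \is hom K r.+1 d ->
  hecke_down k p \is hom K r.+1 d.
Proof.
elim: k p => [|k IH] p h hp //=; apply/hecke_hom/IH => //; last exact: ltnW.
exact: inord_neq.
Qed.

Lemma hecke_up_vanish (S : pred mnm) k p : (k <= r)%N ->
  (forall i j w, j = i.+1 :> nat -> S w -> S (swapm i j w)) ->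
  (forall w, S w -> meval (spc w) p = 0) ->
  forall w, S w -> meval (spc w) (hecke_up k p) = 0.
Proof.
move=> kr hS; elim: k p kr => [|k IH] p h hp w hw /=; first exact: hp.
apply: IH => // [|w' hw']; first exact: ltnW.
rewrite (hecke_spectral hqt) ?inordS // !hp //; last exact/hS/hw'/inordS.
by rewrite mulr0 subrr mulr0 addr0.
Qed.

(** A cross relation of the affine Hecke algebra, checked on lattice values. *)
Lemma hecke_X_hecke i j p : j = i.+1 :> nat ->
  T i j (Xv K j * T i j p) = t *: (Xv K i * p).
Proof.
move=> hij; have ij := succ_neq hij; apply: (spectral_eq_poly hqt) => w.
rewrite (hecke_spectral hqt) // mevalZ !mevalM !meval_Xv !(hecke_spectral hqt) //.
rewrite swapmK.
case: (eqVneq (w i) (w j)) => [e|e].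
  rewrite tau_eq0 // !mul0r !addr0 (spectral_eq q t hij e); ring.
rewrite /tau !spectral_swapm // tpermL tpermR.
have : spc w i - spc w j != 0 by rewrite subr_eq0 spectral_neq.
have : spc w j - spc w i != 0 by rewrite subr_eq0 spectral_neq // eq_sym.
move: (spc w i) (spc w j) (meval (spc w) p) (meval _ p) => X Y A B h1 h2.
by field; rewrite h1 h2.
Qed.

Lemma hecke_up_X_down k p : (k <= r)%N ->
  hecke_up k (Xv K (inord k) * hecke_down k p) = t ^+ k *: (Xv K ord0 * p).
Proof.
elim: k => [_|k IH h] /=.
  by rewrite expr0 scale1r; congr (Xv K _ * _); apply/val_inj; rewrite /= inordK.
rewrite /heckek hecke_X_hecke ?inordS // linearZ /= IH ?(ltnW h) //.
by rewrite scalerA exprS.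
Qed.

Definition movex (k : nat) (x : 'I_r.+1 -> K) i : K :=
  if (i < k)%N then x (inord i.+1) else if (i : nat) == k then x ord0 else x i.

(** Each T_i carries the vanishing coordinate one step to the right and contributes a factor t. *)
Lemma meval_hecke_up0 k (x : 'I_r.+1 -> K) p : (k <= r)%N -> x ord0 = 0 ->
  meval x (hecke_up k p) = t ^+ k * meval (movex k x) p.
Proof.
move=> + x0; elim: k p => [|k IH] p h /=.
  rewrite mul1r; apply: meval_eq => i; rewrite /movex ltn0; case: eqP => // e.
  by congr x; apply/val_inj.
rewrite IH ?(ltnW h) // meval_hecke0 ?inord_neq //; last first.
  by rewrite /movex inordK ?ltnn ?eqxx // ltnS ltnW.
rewrite mulrA -exprSr; congr (_ * _); apply: meval_eq => i /=.
have e1 : (inord k : 'I_r.+1) = k :> nat by rewrite inordK // ltnS ltnW.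
have e2 : (inord k.+1 : 'I_r.+1) = k.+1 :> nat by rewrite inordK.
rewrite /movex; case: tpermP => [->|->|n1 n2].
- rewrite e1 e2 ltnSn; have -> : (k.+1 < k)%N = false by lia.
  by have -> : (k.+1 == k) = false by lia.
- by rewrite e1 e2 ltnn eqxx ltnn eqxx.
have m1 : (i : nat) != k by apply/eqP => e; apply: n1; apply/ord_inj; rewrite e1.
have m2 : (i : nat) != k.+1 by apply/eqP => e; apply: n2; apply/ord_inj; rewrite e2.
by rewrite (negPf m1) (negPf m2) ltnS [(i <= k)%N]leq_eqVlt (negPf m1).
Qed.

Lemma divide_Xmax p :
  (forall x : 'I_r.+1 -> K, x ord_max = 0 -> meval x p = 0) ->
  exists2 g, p = Xv K ord_max * g & ((msize g).+1 <= msize p)%N \/ g = 0.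
Proof.
move=> hp.
pose p0 := mlin (fun m => if m ord_max == 0%N then mpolyX K m else 0) p.
pose g := mlin (fun m => if m ord_max == 0%N then 0
                         else mpolyX K (mnm_sub m (mnm1 ord_max))) p.
have e : p = p0 + Xv K ord_max * g.
  rewrite /p0 /g -mlinMl -mlinD -[LHS]mlin_id; apply: eq_bigr => m _.
  congr (_ *: _); case: eqP => h; first by rewrite mulr0 addr0.
  rewrite add0r /Xv -mpolyXD addmC submK //.
  by rewrite lep1mP; apply/eqP.
(* [p0] collects the monomials free of x_n, so its value at <w> is also its value at the point with
   last coordinate replaced by 0. *)
have p00 : p0 = 0.
  apply: (spectral_eq_poly hqt) => w; rewrite meval0.
  pose x i := if i == ord_max then 0 else spc w i.
  have x0 : x ord_max = 0 by rewrite /x eqxx.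
  transitivity (meval x p0); last first.
    by have := hp x x0; rewrite {1}e mevalD mevalM meval_Xv x0 mul0r addr0.
  rewrite !meval_mlin; apply: eq_bigr => m _; congr (_ * _).
  case: eqP => h; last by rewrite !meval0.
  rewrite !mevalX; apply: eq_bigr => k _; rewrite /x; case: eqP => // ->.
  by rewrite h !expr0.
rewrite p00 add0r in e; exists g => //.
case: (eqVneq g 0) => [|g0]; [by right | left].
rewrite e msizeM //; last by rewrite -(@mmeasure_poly_eq0 _ _ mdeg) mmeasureX.
by rewrite mmeasureX /= mdeg1.
Qed.

Lemma spectral_low_closed d :
  forall i j w, j = i.+1 :> nat -> (mdeg w < d)%N -> (mdeg (swapm i j w) < d)%N.
Proof. by move=> i j w _; rewrite mdeg_swapm. Qed.

Lemma hecke_up_M_small k v w : (k <= r)%N -> (mdeg w < mdeg v)%N ->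
  meval (spc w) (hecke_up k (M v)) = 0.
Proof.
move=> hk; apply: (@hecke_up_vanish (fun w => mdeg w < mdeg v)%N) => //.
  exact: spectral_low_closed.
move=> w' hw'; apply: M_small; first exact: ltnW.
by apply: contraTneq hw' => ->; rewrite ltnn.
Qed.

(* Phi lowers the lattice point by one box. *)
Lemma Phi_vanish p w : (forall w', (mdeg w' < mdeg w)%N -> meval (spc w') p = 0) ->
  meval (spc w) (Phi p) = 0.
Proof.
move=> h; case: (posnP (w ord_max)) => [/Phi_spectral0 -> //|w0].
rewrite -(unshiftmK w0) (Phi_spectral_shiftm hqt) h ?mulr0 //.
by rewrite (mdeg_unshiftm w0).
Qed.

(** x_n times the inhomogeneous Cherednik operator of index n, multiplied out to avoid division by
    x_n. The eigenvalue on M_v is the inverse of the last entry of <v>. *)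
Definition cherednik p := p + t ^- r *: Phi (hecke_up r p).

Lemma cherednik_is_linear : linear cherednik.
Proof.
move=> c p g; rewrite /cherednik !linearP /= [c *: (p + _)]scalerDr.
by rewrite [c *: (t ^- r *: _)]scalerA mulrC -scalerA addrACA.
Qed.

HB.instance Definition _ :=
  GRing.isLinear.Build K MP MP *:%R cherednik cherednik_is_linear.

(** At x_n = 0 the factor x_n - 1 is -1, and the T_i carry the zero that Delta puts in front back to
    the end: the second summand cancels p. *)
Lemma cherednik_div p :
  exists2 g, cherednik p = Xv K ord_max * g & (msize g <= msize p)%N.
Proof.
have [|g e h] := @divide_Xmax (cherednik p).
  move=> x x0; rewrite /cherednik mevalD mevalZ mevalM mevalB meval_Xv meval1 x0.
  rewrite sub0r mulN1r meval_Delta meval_hecke_up0 //; last first.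
    by rewrite /shiftx ord_pred0 x0 mul0r.
  rewrite mulrN mulrA mulVf ?expf_neq0 ?(t_neq0 hqt) // mul1r.
  rewrite [X in _ - X](_ : _ = meval x p) ?subrr //; apply: meval_eq => i.
  rewrite /movex; case: (eqVneq i ord_max) => [->|hi].
    by rewrite ltnn eqxx /shiftx ord_pred0 eqxx x0 mul0r.
  have ir : (i < r)%N by have := ltn_ord (ordS i); rewrite (ordS_neq_max hi) ltnS.
  rewrite ir /shiftx.
  have -> : (inord i.+1 : 'I_r.+1) = ordS i.
    by apply/ord_inj; rewrite (ordS_neq_max hi) inordK.
  by rewrite ordSK ordS_eq0 (negPf hi) mulr1.
exists g => //; case: h => [h|->]; last by rewrite mmeasure0.
rewrite -ltnS; apply: leq_trans h _; rewrite /cherednik.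
apply: leq_trans (mmeasureD_le _ _ _) _; rewrite geq_max leqnSn /=.
apply: leq_trans (mmeasureZ_le _ _ _) _; apply: leq_trans (msize_Phi _ _) _.
by rewrite ltnS msize_hecke_up.
Qed.

(* [cherednik p] vanishes where the last coordinate does, so the quotient by that
   coordinate has the degree of p and can be identified by its values. *)
Lemma cherednik_M v :
  cherednik (M v) = (spc v ord_max)^-1 *: (Xv K ord_max * M v).
Proof.
have [g e hg] := cherednik_div (M v); rewrite e scalerAr; congr (_ * _).
apply: M_unique; first exact: leq_trans hg (msize_M v).
move=> w hw; apply: (mulfI (spectral_neq0 hqt w ord_max)).
rewrite -[LHS](_ : meval (spc w) (Xv K ord_max * g) = _); last first.
  by rewrite mevalM meval_Xv.
rewrite -e /cherednik mevalD mevalZ Phi_vanish; last first.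
  by move=> w' hw'; apply: hecke_up_M_small => //; apply: leq_trans hw' hw.
rewrite mulr0 addr0 M_spectral //; case: eqP => [->|_]; last by rewrite !mulr0.
by rewrite !mulr1 mulVKf ?spectral_neq0.
Qed.

(** By induction on |w|: at <w> the second summand involves only values at points of lower
    degree. *)
Lemma cherednik_inj p : cherednik p = 0 -> p = 0.
Proof.
move=> e; apply: (spectral_eq_poly hqt) => w; rewrite meval0.
have [s] := ubnP (mdeg w); elim: s w => // s IH w hw.
have := congr1 (meval (spc w)) e; rewrite mevalD mevalZ Phi_vanish.
  by rewrite mulr0 addr0 meval0.
move=> w' hw'; apply: (@hecke_up_vanish (fun w' => mdeg w' < mdeg w)%N) => //.
  exact: spectral_low_closed.
by move=> w'' hw''; apply: IH; apply: leq_trans hw'' _.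
Qed.

Lemma Phi_inj p : Phi p = 0 -> p = 0.
Proof.
move=> e; apply: (spectral_eq_poly hqt) => w; rewrite meval0.
have := congr1 (meval (spc (shiftm w))) e.
rewrite (Phi_spectral_shiftm hqt) meval0 => /eqP; rewrite mulf_eq0 => /orP[|/eqP //].
rewrite subr_eq0 -spectral_shiftm_max (negPf (spectral_max_eq1 hqt _)) //.
by rewrite shiftm_max.
Qed.

Lemma Phi_X0 p : Phi (Xv K ord0 * p) = q^-1 *: (Xv K ord_max * Phi p).
Proof.
rewrite /Phi; have -> : Delta q (Xv K ord0 * p) = q^-1 *: (Xv K ord_max * Delta q p).
  apply: (spectral_eq_poly hqt) => w.
  rewrite mevalZ !meval_Delta !mevalM !meval_Xv meval_Delta.
  by rewrite {1}/shiftx eqxx ord_pred0; ring.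
by rewrite -scalerAr mulrCA.
Qed.

(** Tested after the injective operator Phi: it turns the bracket into [cherednik] of Phi(M_u), a
    multiple of an eigenvector. The identity is the source of the shift recursion for E_u(<0>). *)
Lemma X0_M u :
  Xv K ord0 * M u = spc u ord0 *: (M u + t ^- r *: hecke_up r (Phi (M u))).
Proof.
apply/eqP; rewrite -subr_eq0; apply/eqP/Phi_inj.
have q0 := q_neq0 hqt; have s0 := spectral_neq0 hqt u ord0.
rewrite linearB /= Phi_X0 linearZ /=.
have -> : Phi (M u + t ^- r *: hecke_up r (Phi (M u))) = cherednik (Phi (M u)).
  by rewrite /cherednik linearD linearZ.
have cZ (c : K) p : cherednik (c *: p) = c *: cherednik p by exact: linearZ.
rewrite Phi_M cZ cherednik_M spectral_shiftm_max.
move: (spc u ord0) s0 => s s0.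
rewrite -scalerAr !scalerA.
rewrite -scalerBl (_ : _ - _ = 0) ?scale0r //.
by move: (phi_coef u) => f; field; rewrite s0 q0.
Qed.

Definition emac u : MP := pihomog mdeg (mdeg u) (M u).

Lemma emacE u : emac u = Etop q t u. Proof. by rewrite /emac imacE. Qed.

Definition e0val u : K := meval (spc (@mnm0 _)) (emac u).

Lemma tau_mnm0 i j : j = i.+1 :> nat -> tau i j (@mnm0 _) = 0.
Proof. by move=> hij; apply: tau_eq0; rewrite // !mnm0E. Qed.

Lemma meval0_hecke i j p : j = i.+1 :> nat ->
  meval (spc (@mnm0 _)) (T i j p) = t * meval (spc (@mnm0 _)) p.
Proof.
by move=> hij; rewrite (hecke_spectral hqt) // tau_mnm0 // mul0r addr0.
Qed.

Lemma meval0_hecke_up k p : (k <= r)%N ->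
  meval (spc (@mnm0 _)) (hecke_up k p) = t ^+ k * meval (spc (@mnm0 _)) p.
Proof.
elim: k p => [|k IH] p h /=; first by rewrite mul1r.
by rewrite IH ?(ltnW h) // meval0_hecke ?inordS // mulrA -exprSr.
Qed.

Lemma pihomogZ d (c : K) p : pihomog mdeg d (c *: p) = c *: pihomog mdeg d p.
Proof. exact: linearZ. Qed.

(** At <0> every adjacent [tau] is 0, so T_i acts there as t; the top-degree part of [hecke_M] is
    evaluated at <0>. *)
Lemma e0val_swapm i j u : j = i.+1 :> nat ->
  tau i j (swapm i j u) * e0val (swapm i j u) = tau i j u * e0val u.
Proof.
move=> hij; have ij := succ_neq hij.
have := congr1 (meval (spc (@mnm0 _)) \o pihomog mdeg (mdeg u)) (hecke_M u hij).
rewrite /= pihomog_hecke // meval0_hecke // pihomogD !pihomogZ.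
rewrite mevalD !mevalZ -/(emac u) -/(e0val u).
have -> : pihomog mdeg (mdeg u) (M (swapm i j u)) = emac (swapm i j u).
  by rewrite /emac mdeg_swapm.
rewrite -/(e0val (swapm i j u)) => h.
by apply: (addrI ((t - tau i j u) * e0val u)); rewrite -h; ring.
Qed.

Lemma pihomog_X0 d p :
  pihomog mdeg d.+1 (Xv K ord0 * p) = Xv K ord0 * pihomog mdeg d p.
Proof.
rewrite {1}(mpolyE p) mulr_sumr (raddf_sum (pihomog mdeg d.+1)) /=.
rewrite pihomogE mulr_sumr [RHS]big_mkcond /=; apply: eq_bigr => m _.
rewrite -scalerAr pihomogZ /Xv -mpolyXD pihomogX /= mdegD mdeg1 add1n eqSS.
by case: eqP => _; rewrite ?scaler0 // -scalerAr -mpolyXD.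
Qed.

(** The component of degree |u| + 1 in [X0_M], to which the bare summand M_u does not contribute,
    evaluated at <0>, where the first coordinate is t^r. *)
Lemma e0val_shiftm u :
  t ^+ r * e0val u = (1 - q * spc u ord0) * e0val (shiftm u).
Proof.
have := congr1 (meval (spc (@mnm0 _)) \o pihomog mdeg (mdeg u).+1) (X0_M u).
rewrite /= pihomog_X0 pihomogZ pihomogD (pihomog_small (msize_M u)) add0r.
rewrite pihomogZ pihomog_hecke_up // Phi_M pihomogZ -mdeg_shiftm.
rewrite mevalM meval_Xv !mevalZ meval0_hecke_up // mevalZ.
rewrite -/(emac u) -/(emac (shiftm u)) -/(e0val u) -/(e0val (shiftm u)).
rewrite {1}/spectral spec_exp0 mnm0E subn0 mul1r => ->.
rewrite mulKf ?expf_neq0 ?(t_neq0 hqt) // mulrA /phi_coef; congr (_ * _).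
by rewrite mulrC divfK ?spectral_neq0.
Qed.

Lemma e0val0 : e0val (@mnm0 _) = 1.
Proof.
rewrite /e0val /emac M0 mdeg0 pihomog_hom ?meval1 //.
by apply/homP => m; rewrite mcoeff1; case: (m =P _) => [->|_]; rewrite ?mdeg0 ?eqxx.
Qed.

Lemma e0val_neq0 u : e0val u != 0.
Proof.
elim/composition_ind: u => [|u IH|u i j hij huij IH].
- by rewrite e0val0 oner_eq0.
- apply/eqP => e; have := e0val_shiftm u; rewrite e mulr0 => /eqP.
  by rewrite mulf_eq0 (negPf IH) orbF (negPf (expf_neq0 _ (t_neq0 hqt))).
apply/eqP => e; have := e0val_swapm u hij; rewrite e mulr0 => /esym/eqP.
have hu : u i != u j by rewrite neq_ltn huij.
by rewrite mulf_eq0 (negPf IH) orbF (negPf (tau_neq0 hqt (succ_neq hij) hu)).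
Qed.

End InterpolationTheory.

(** * Extra vanishing and the binomial formula *)

Section BinomialFormula.
Variables (K : numFieldType) (q t : K) (hqt : generic_qt q t) (r : nat).
Notation MP := (mpoly r.+1 K).
Notation mnm := (multinom r.+1).
Implicit Types (p f g : MP) (u v w m : mnm) (i j : 'I_r.+1) (k : nat).
Local Notation spc := (spectral q t).
Local Notation lc := (gpoch_lc q t).
Local Notation T := (hecke t).
Local Notation Phi := (Phi q).
Local Notation tau := (tau q t).
Local Notation M := (imac q t).
Local Notation E := (emac q t).
Local Notation e0val := (e0val q t).
Local Notation phi_coef := (phi_coef q t).
Local Notation gpoch := (gpoch q t).
Local Notation hecke_up := (@hecke_up K t r).
Local Notation hecke_down := (@hecke_down K t r).
Local Notation cherednik := (@cherednik K q t r).

(** Since t is not 1, the quotient in [tau] is an injective fractional linear function of its first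
    argument. This recovers one spectral entry from the next. *)
Lemma tau_inj (a b X : K) : a != b -> X != b -> b != 0 ->
  (a - t * b) / (a - b) = (X - t * b) / (X - b) -> X = a.
Proof.
move=> ab Xb b0 /eqP; rewrite eqr_div ?subr_eq0 // => /eqP h.
have t1 : 1 - t != 0 by rewrite subr_eq0 eq_sym (t_neq1 hqt).
apply/eqP; rewrite -subr_eq0; apply/eqP.
apply: (mulfI (mulf_neq0 b0 t1)); rewrite mulr0.
move/eqP: h; rewrite -subr_eq0 => /eqP <-; ring.
Qed.

(* M_v is an eigenfunction of commuting operators acting on lattice functions;
   at a point w below which M_v vanishes the eigenvalue equations force the
   spectral vectors of v and w to agree. *)
Lemma M_extra_vanishing v w :
  meval (spc w) (M v) != 0 -> gpoch v %| gpoch w.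
Proof.
have [N] := ubnP (mdeg w); elim: N v w => // N IHN v w hw hM.
apply: contraT => hdv.
(* The data of a minimal counterexample apart from the nonvanishing; they are invariant under
   transpositions of v or w, because [gpoch] and the degree are. *)
pose bad v w := (mdeg w < N.+1)%N /\ ~~ (gpoch v %| gpoch w).
have bads1 v' w' i j : j = i.+1 :> nat -> bad v' w' -> bad (swapm i j v') w'.
  by move=> hij [h1 h2]; split; rewrite ?gpoch_swapm.
have bads2 v' w' i j : j = i.+1 :> nat -> bad v' w' -> bad v' (swapm i j w').
  by move=> hij [h1 h2]; split; rewrite ?gpoch_swapm ?mdeg_swapm.
(* Entries are compared from the last position backwards: [cherednik] treats the last one, and T_i
   passes from i + 1 to i. *)
suff key : forall c v w, (c <= r.+1)%N -> bad v w -> meval (spc w) (M v) != 0 ->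
    forall i, (r.+1 <= i + c)%N -> spc w i = spc v i.
  have e : w = v.
    apply/mnmP => i; apply: (spectral_inj hqt (i := i) (j := i)).
    by apply: (key r.+1) => //; rewrite leq_addl.
  by rewrite e dvdpp in hdv.
clear v w hw hM hdv; elim=> [|c IHc] v w hc hb hne i hi.
  by have := ltn_ord i; rewrite addn0 in hi; rewrite ltnNge hi.
case: (ltnP r (i + c)) => hic; first exact: IHc (ltnW hc) hb hne i hic.
case: c => [|c] in IHc hc hi hic *.
  have -> : i = ord_max by apply/ord_inj; have := ltn_ord i; rewrite /=; lia.
  have [hw' hdv'] := hb.
  have := congr1 (meval (spc w)) (cherednik_M hqt v).
  rewrite /cherednik mevalD !mevalZ.
  rewrite [meval _ (Xv K ord_max * M v)]mevalM meval_Xv.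
  (* Phi lowers w by a box. If [gpoch v] divided [gpoch] of the lowered point it would divide
     [gpoch w]; so M_v vanishes on all transposes of that point by induction. *)
  have -> : meval (spc w) (Phi (hecke_up r (M v))) = 0.
    case: (posnP (w ord_max)) => [/Phi_spectral0 -> //|w0].
    rewrite -(unshiftmK w0) (Phi_spectral_shiftm hqt).
    rewrite [X in _ * X](_ : _ = 0) ?mulr0 //.
    pose S (x : mnm) := (mdeg x < N)%N && ~~ (gpoch v %| gpoch x).
    apply: (@hecke_up_vanish _ _ _ hqt _ S) => //.
    - by move=> i' j' x hij; rewrite /S mdeg_swapm gpoch_swapm.
    - move=> x /andP[hx hdx]; apply/eqP/negPn/negP => h.
      by rewrite (IHN _ _ hx h) in hdx.
    rewrite /S; apply/andP; split; first by rewrite -ltnS -mdeg_unshiftm.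
    apply: contra hdv' => hd.
    have -> : gpoch w = gpoch (shiftm (unshiftm w)) by rewrite unshiftmK.
    by rewrite gpoch_shiftm dvdp_mulr.
  rewrite mulr0 addr0 mulrA -[LHS]mul1r => /(mulIf hne) h.
  apply: (mulfI (invr_neq0 (spectral_neq0 hqt v ord_max))).
  by rewrite -h mulVf ?spectral_neq0.
have hir : (i < r)%N by lia.
pose j : 'I_r.+1 := inord i.+1.
have hij : j = i.+1 :> nat by rewrite inordK.
have ij := succ_neq hij.
have IH' v' w' : bad v' w' -> meval (spc w') (M v') != 0 -> spc w' j = spc v' j.
  by move=> hb' hne'; apply: (IHc v' w' (ltnW hc) hb' hne'); rewrite hij; lia.
have hj := IH' v w hb hne.
have := congr1 (meval (spc w)) (hecke_M hqt v hij).
rewrite (hecke_spectral hqt) // mevalD !mevalZ.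
(* A nonzero value at the swapped point would identify its entry j, which is the entry i of <w>,
   with the entry j of <v> and hence of <w>; but entries of a spectral vector are distinct. *)
have z1 : tau i j w * meval (spc (swapm i j w)) (M v) = 0.
  case: (eqVneq (w i) (w j)) => [e|e]; first by rewrite tau_eq0 ?mul0r.
  case: (eqVneq (meval (spc (swapm i j w)) (M v)) 0) => [->|h].
    by rewrite mulr0.
  have := IH' _ _ (bads2 _ _ _ _ hij hb) h.
  rewrite spectral_swapm // tpermR => e'.
  by have := spectral_neq hqt w ij; rewrite e' -hj eqxx.
have z2 : tau i j (swapm i j v) * meval (spc w) (M (swapm i j v)) = 0.
  case: (eqVneq (v i) (v j)) => [e|e].
    by rewrite tau_eq0 ?mul0r // !swapmE tpermL tpermR.
  case: (eqVneq (meval (spc w) (M (swapm i j v))) 0) => [->|h].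
    by rewrite mulr0.
  have := IH' _ _ (bads1 _ _ _ _ hij hb) h.
  rewrite spectral_swapm // tpermR hj => e'.
  by have := spectral_neq hqt v ij; rewrite e' eqxx.
rewrite mulrBr z1 z2 addr0 sub0r -mulrBl => /(mulIf hne) /addrI /oppr_inj h.
apply: (@tau_inj _ (spc v j)) => //; rewrite ?spectral_neq ?spectral_neq0 //.
  by rewrite -hj spectral_neq.
by rewrite /tau hj in h; rewrite -h.
Qed.

(* The leading terms of the two summands cancel, so [theta v] has degree less
   than |v| and is determined by its values at few lattice points. *)
Definition theta v : MP :=
  (spc v ord_max)^-1 *: DeltaV q (M v) - t ^- r *: hecke_up r (M v).

(** By the eigenvalue equation x_n rho has degree at most |v|, so rho has smaller degree; theta is
    [DeltaV] applied to rho. *)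
Lemma msize_theta v : (msize (theta v) <= mdeg v)%N.
Proof.
pose rho := (spc v ord_max)^-1 *: M v - t ^- r *: Delta q (hecke_up r (M v)).
have e1 : theta v = DeltaV q rho.
  apply: (spectral_eq_poly hqt) => w; rewrite DeltaV_spectral.
  by rewrite !mevalB !mevalZ DeltaV_spectral (Delta_spectral hqt).
have e2 : Xv K ord_max * rho = M v - t ^- r *: Delta q (hecke_up r (M v)).
  have := cherednik_M hqt v; rewrite /cherednik /Phi mulrBl mul1r scalerBr => h.
  rewrite mulrBr -!scalerAr -h; ring.
rewrite e1; apply: leq_trans (msize_DeltaV _ _) _.
have [->|rho0] := eqVneq rho 0; first by rewrite mmeasure0.
have : (msize (Xv K ord_max * rho) <= (mdeg v).+1)%N.
  rewrite e2; apply: leq_trans (mmeasureD_le _ _ _) _.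
  rewrite mmeasureN geq_max (msize_M hqt) /=.
  apply: leq_trans (mmeasureZ_le _ _ _) _; apply: leq_trans (msize_Delta _ _) _.
  exact: leq_trans (msize_hecke_up _ _ (leqnn r)) (msize_M hqt v).
rewrite msizeM //; last by rewrite -(@mmeasure_poly_eq0 _ _ mdeg) mmeasureX.
by rewrite mmeasureX /= mdeg1.
Qed.

Lemma theta_spectral v w : (mdeg w < mdeg v)%N ->
  meval (spc w) (theta v) = (spc v ord_max)^-1 * (lc v * (shiftm w == v)%:R).
Proof.
move=> hw; rewrite mevalB !mevalZ DeltaV_spectral M_spectral ?mdeg_shiftm //.
by rewrite (hecke_up_M_small hqt) // mulr0 subr0.
Qed.

Lemma theta0 v : v ord_max = 0%N -> theta v = 0.
Proof.
move=> h; apply: (spectral_unique hqt (msize_theta v)) => w hw.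
rewrite theta_spectral //; case: eqP => [e|_]; last by rewrite !mulr0.
by rewrite -e shiftm_max in h.
Qed.

Lemma theta_shiftm u : theta (shiftm u) = - q^-1 *: M u.
Proof.
apply: (M_unique hqt); first by rewrite -mdeg_shiftm msize_theta.
move=> w hw; rewrite theta_spectral ?mdeg_shiftm //.
rewrite (inj_eq (can_inj (@shiftmK r))) spectral_shiftm_max gpoch_lc_shiftm //.
rewrite mulrA; congr (_ * _); field.
by rewrite spectral_neq0 // (q_neq0 hqt).
Qed.

(** The factor [e0val] makes T_i act alike in x and in y; both factors enter the shift recursion of
    the kernel. *)
Definition kap v : K := e0val v * lc v.

(* The reproducing kernel sum_v M_v(y) M_v(x) / kap_v, truncated to |v| < d,
   with a linear functional L applied in y. *)
Definition kernel (d : nat) (L : MP -> K) : MP :=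
  \sum_(v : bmultinom r.+1 d) (L (M v) / kap v) *: M v.

Definition bswap i j d (v : bmultinom r.+1 d) : bmultinom r.+1 d :=
  insubd v (swapm i j v).

Lemma bswapE i j d (v : bmultinom r.+1 d) : bswap i j v = swapm i j v :> mnm.
Proof. by rewrite /bswap val_insubd mdeg_swapm bmdeg. Qed.

Lemma bswapK i j d : involutive (@bswap i j d).
Proof. by move=> v; apply/val_inj; rewrite /= !bswapE swapmK. Qed.

Lemma kernel_hecke i j d (L : {linear MP -> K | *%R}) : j = i.+1 :> nat ->
  T i j (kernel d L) = kernel d (L \o T i j).
Proof.
move=> hij; rewrite /kernel linear_sum /=.
have LZ (c : K) p : L (c *: p) = c * L p by exact: linearZ.
under eq_bigr do rewrite linearZ /= (hecke_M hqt _ hij) scalerDr !scalerA.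
under [RHS]eq_bigr do rewrite (hecke_M hqt _ hij) linearD !LZ mulrDl scalerDl.
rewrite !big_split /=; congr (_ + _).
  by apply: eq_bigr => v _; congr (_ *: _); rewrite mulrC mulrA.
rewrite [LHS](reindex_inj (inv_inj (@bswapK i j d))); apply: eq_bigr => v _.
rewrite bswapE swapmK; congr (_ *: _).
rewrite /kap gpoch_lc_swapm //.
have e := e0val_swapm hqt v hij.
have e1 := e0val_neq0 hqt v; have e2 := e0val_neq0 hqt (swapm i j v).
have e3 := gpoch_lc_neq0 hqt v.
have e4 : tau i j v = tau i j (swapm i j v) * e0val (swapm i j v) / e0val v.
  by rewrite e mulfK.
by rewrite e4; field; rewrite e1 e2 e3.
Qed.

Definition evl w : MP -> K := meval (spc w).
HB.instance Definition _ w := GRing.Linear.copy (evl w) (meval (spc w)).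

Lemma kernel_hecke_up k d w : (k <= r)%N ->
  kernel d (evl w \o hecke_up k) = hecke_down k (kernel d (evl w)).
Proof.
elim: k => [//|k IH] h /=; rewrite -IH ?(ltnW h) //.
have -> : kernel d (evl w \o hecke_up k.+1) =
          kernel d ((evl w \o hecke_up k) \o heckek t k) by [].
by rewrite -kernel_hecke ?inordS.
Qed.

Lemma big_bshift d (F : mnm -> MP) : (forall v, v ord_max = 0%N -> F v = 0) ->
  \sum_(v : bmultinom r.+1 d.+1) F v = \sum_(u : bmultinom r.+1 d) F (shiftm u).
Proof.
move=> h.
have bs_proof (u : bmultinom r.+1 d) : (mdeg (shiftm u) < d.+1)%N.
  by rewrite mdeg_shiftm ltnS bmdeg.
pose bs (u : bmultinom r.+1 d) := BMultinom (bs_proof u).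
pose bu (v : bmultinom r.+1 d.+1) : option (bmultinom r.+1 d) :=
  insub (unshiftm v).
rewrite (bigID (fun v : bmultinom r.+1 d.+1 => 0 < v ord_max)%N) /= addrC big1.
  rewrite add0r (reindex_omap bs bu) /=.
    apply: eq_bigl => u; rewrite shiftm_max /=.
    by rewrite /bu /= shiftmK valK eqxx.
  move=> v v0; rewrite /bu insubT; last first.
    by move=> hv; congr Some; apply/val_inj; rewrite /= unshiftmK.
  by rewrite -ltnS -mdeg_unshiftm // bmdeg.
by move=> v; rewrite -eqn0Ngt => /eqP; apply: h.
Qed.

Lemma kernel_widen d w : (mdeg w < d)%N ->
  kernel d.+1 (evl w) = kernel d (evl w).
Proof.
move=> hw; rewrite /kernel.
have wd (u : bmultinom r.+1 d) : (mdeg u < d.+1)%N by apply: ltnW; apply: bmdeg.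
pose bs (u : bmultinom r.+1 d) := BMultinom (wd u).
pose bu (v : bmultinom r.+1 d.+1) : option (bmultinom r.+1 d) :=
  insub (bmnm v).
rewrite (bigID (fun v : bmultinom r.+1 d.+1 => mdeg v < d)%N) /= addrC big1.
  rewrite add0r (reindex_omap bs bu) /=.
    by apply: eq_bigl => u; rewrite bmdeg /bu /= valK eqxx.
  by move=> v v0; rewrite /bu insubT //; congr Some; apply/val_inj.
move=> v; rewrite -leqNgt => hv; rewrite /evl M_small ?mul0r ?scale0r //.
  exact: leq_trans (ltnW hw) hv.
by apply: contraTneq hw => ->; rewrite -leqNgt.
Qed.

(** Compared after the injective [cherednik]. The inverse eigenvalue and M_v(<shiftm w>) = (DeltaV
    M_v)(<w>) combine into the values at <w> of [theta v] and t^{-r} T_0 .. T_{r-1} M_v; since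
    [theta] lowers the index, its terms reassemble into Phi of the smaller kernel. *)
Lemma kernel_shiftm d w : (mdeg w < d)%N ->
  kernel d.+1 (evl (shiftm w)) =
  t ^- r *: (Xv K ord_max * hecke_down r (kernel d (evl w))).
Proof.
move=> hw; set A := kernel d.+1 _; set B := kernel d (evl w).
have q0 := q_neq0 hqt; have t0 := t_neq0 hqt.
have tr0 : t ^+ r != 0 by rewrite expf_neq0.
apply/eqP; rewrite -subr_eq0; apply/eqP/(cherednik_inj hqt).
have cZ (c : K) p : cherednik (c *: p) = c *: cherednik p by exact: linearZ.
have PZ (c : K) p : Phi (c *: p) = c *: Phi p by exact: linearZ.
have UZ (c : K) p : hecke_up r (c *: p) = c *: hecke_up r p by exact: linearZ.
have hA : cherednik A =
    Xv K ord_max * (t ^- r *: hecke_down r B + (t ^- r / q) *: Phi B).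
  rewrite /A /kernel linear_sum /=.
  under eq_bigr do rewrite cZ (cherednik_M hqt) scalerA scalerAr.
  rewrite -mulr_sumr; congr (_ * _).
  transitivity (\sum_(v : bmultinom r.+1 d.+1)
     ((t ^- r * evl w (hecke_up r (M v))) / kap v *: M v
      + (evl w (theta v) / kap v) *: M v)).
    apply: eq_bigr => v _; rewrite -scalerDl; congr (_ *: _).
    rewrite /theta /evl mevalB !mevalZ DeltaV_spectral; ring.
  rewrite big_split /=; congr (_ + _).
    rewrite /B -(kernel_widen hw) -(@kernel_hecke_up r) // scaler_sumr.
    by apply: eq_bigr => v _; rewrite scalerA mulrA.
  pose F v := (evl w (theta v) / kap v) *: M v.
  transitivity (\sum_(u : bmultinom r.+1 d) F (shiftm u)).
    apply: (@big_bshift _ F) => v hv.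
    by rewrite /F theta0 // /evl meval0 mul0r scale0r.
  rewrite /F.
  rewrite /B /kernel linear_sum scaler_sumr; apply: eq_bigr => u _.
  rewrite theta_shiftm /= PZ (Phi_M hqt) !scalerA; congr (_ *: _).
  rewrite /evl mevalZ /kap gpoch_lc_shiftm // /phi_coef.
  have e1 := e0val_neq0 hqt u; have e2 := e0val_neq0 hqt (shiftm u).
  have e3 := gpoch_lc_neq0 hqt u; have e4 := spectral_neq0 hqt u ord0.
  have e5 : e0val u = (1 - q * spc u ord0) * e0val (shiftm u) / t ^+ r.
    by rewrite -(e0val_shiftm hqt) mulrC mulKf.
  have e6 : 1 - q * spc u ord0 != 0.
    by apply: contraNneq e1 => h; rewrite e5 h mul0r mul0r.
  rewrite e5; move: (spc u ord0) e4 e6 (e0val _) e2 (lc u) e3 (t ^+ r) tr0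
    {e5 e1} => s s0 s1 e e0 l l0 tr tr0.
  by field; rewrite q0 s0 s1 e0 l0 tr0.
have hX : cherednik (t ^- r *: (Xv K ord_max * hecke_down r B)) =
    Xv K ord_max * (t ^- r *: hecke_down r B + (t ^- r / q) *: Phi B).
  rewrite cZ /cherednik.
  have -> : (ord_max : 'I_r.+1) = inord r by apply/ord_inj; rewrite inordK.
  rewrite (hecke_up_X_down hqt) // PZ (Phi_X0 hqt) !scalerA mulVf // mul1r.
  have -> : (inord r : 'I_r.+1) = ord_max by apply/ord_inj; rewrite inordK.
  rewrite mulrDr -!scalerAr scalerDr scalerA //.
by rewrite linearB /= hA hX subrr.
Qed.

Lemma kernel_swapm d w i j : j = i.+1 :> nat ->
  T i j (kernel d (evl w)) =
  (t - tau i j w) *: kernel d (evl w) + tau i j w *: kernel d (evl (swapm i j w)).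
Proof.
move=> hij; rewrite kernel_hecke // /kernel !scaler_sumr -big_split /=.
apply: eq_bigr => v _; rewrite !scalerA -scalerDl; congr (_ *: _).
rewrite /evl (hecke_spectral hqt) //; ring.
Qed.

Lemma kernel_hom w d : (mdeg w < d)%N ->
  kernel d (evl w) \is hom K r.+1 (mdeg w).
Proof.
elim/composition_ind: w d => [|w IH|w i j hij huij IH] d hd.
- suff -> : kernel d (evl (@mnm0 _)) = 1.
    apply/homP => m; rewrite mcoeff1.
    by case: (m =P _) => [->|_]; rewrite ?mdeg0 ?eqxx.
  rewrite /kernel (bigD1 (BMultinom hd)) //= (M0 hqt) /evl meval1 big1.
    by rewrite addr0 /kap e0val0 // gpoch_lc0 // mul1r divr1 scale1r.
  move=> v hv; rewrite M_small ?mul0r ?scale0r ?mdeg0 //.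
  by apply: contra hv => /eqP e; apply/eqP/val_inj.
- case: d hd => // d; rewrite mdeg_shiftm ltnS => hd.
  rewrite kernel_shiftm // -[(mdeg w).+1]add1n; apply/dhomogZ/homM; first exact: Xv_hom.
  by apply: hecke_down_hom => //; apply: IH.
rewrite mdeg_swapm in hd *; have hu : w i != w j by rewrite neq_ltn huij.
have t0 := tau_neq0 hqt (succ_neq hij) hu.
have -> : kernel d (evl (swapm i j w)) = (tau i j w)^-1 *:
    (T i j (kernel d (evl w)) - (t - tau i j w) *: kernel d (evl w)).
  by rewrite kernel_swapm // addrAC subrr add0r scalerA mulVf ?scale1r.
apply/dhomogZ; rewrite -scaleN1r; apply: dhomogD.
  exact: hecke_hom (succ_neq hij) (IH _ hd).
by apply/dhomogZ/dhomogZ/IH.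
Qed.

Lemma binomial_formula w d : (mdeg w < d)%N ->
  (e0val w)^-1 *: E w =
  \sum_(v : bmultinom r.+1 d) (meval (spc w) (M v) / (e0val v * lc v)) *: M v.
Proof.
move=> hd; rewrite -[RHS]/(kernel d (evl w)) -[RHS](pihomog_hom (kernel_hom hd)).
rewrite /kernel (raddf_sum (pihomog mdeg (mdeg w))) /=.
rewrite (bigD1 (BMultinom hd)) //= big1 ?addr0.
  rewrite pihomogZ -/(E w) /evl (M_diag hqt) /kap.
  by rewrite invfM mulrCA mulfV ?gpoch_lc_neq0 ?mulr1.
move=> v hv; rewrite pihomogZ; case: (ltnP (mdeg v) (mdeg w)) => h.
  by rewrite pihomog_small ?scaler0 //; apply: leq_trans (msize_M hqt v) h.
rewrite /evl M_small ?mul0r ?scale0r //.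
by apply: contra hv => /eqP e; apply/eqP/val_inj.
Qed.

End BinomialFormula.

(** * Connection coefficients *)

Section SortedParts.
Variable r : nat.
Notation mnm := (multinom r.+1).
Implicit Types (u v w m : mnm) (i j : 'I_r.+1).

(** The position of the entry u_i in the decreasing rearrangement, ties being ordered as in
    [spec_exp]. *)
Definition corank u i : 'I_r.+1 := inord (r - spec_exp u i).

Lemma corankE u i : corank u i = (r - spec_exp u i)%N :> nat.
Proof. by rewrite inordK // ltnS leq_subr. Qed.

Lemma corank_inj u : injective (corank u).
Proof.
move=> i j /(congr1 (@nat_of_ord _)); rewrite !corankE => h.
apply: (@spec_exp_inj _ u); have := spec_exp_bound u i; have := spec_exp_bound u j.
by lia.
Qed.

Lemma nth_sortedparts u i : nth 0%N (sortedparts u) (corank u i) = u i.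
Proof.
pose c := perm (@corank_inj u).
pose s := [seq u (c^-1%g k) | k <- enum 'I_r.+1].
have -> : sortedparts u = s.
  apply: (@sorted_eq _ geq).
  - by move=> x y z h1 h2; apply: leq_trans h2 h1.
  - move=> x y /andP[h1 h2]; apply/eqP; rewrite eqn_leq; apply/andP; split=> //.
  - by apply: sort_sorted => x y; apply: leq_total.
  - rewrite /s sorted_map; apply: (@sub_sorted _ (relpre val ltn)).
      move=> k l /= kl; rewrite leqNgt; apply/negP => h.
      have : below u (c^-1%g k) (c^-1%g l) by rewrite /below h.
      move/spec_exp_lt; have := corankE u (c^-1%g k); have := corankE u (c^-1%g l).
      rewrite -!(permE (@corank_inj u)) -/c !permKV.
      have := spec_exp_bound u (c^-1%g k); have := spec_exp_bound u (c^-1%g l).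
      by lia.
    by rewrite -sorted_map val_enum_ord iota_ltn_sorted.
  rewrite perm_sort /s (map_comp u (c^-1%g)) /codom /image_mem.
  apply: perm_map.
  have eu : uniq (enum 'I_r.+1) := enum_uniq _.
  apply: uniq_perm; [by [] | by rewrite map_inj_uniq //; apply: perm_inj | ].
  move=> k; rewrite mem_enum inE; apply/esym/mapP; exists (c k); rewrite ?mem_enum //.
  by rewrite permK.
rewrite (nth_map ord0) ?size_enum_ord ?ltn_ord // nth_ord_enum.
by rewrite -(permE (@corank_inj u)) permK.
Qed.

Lemma sorted_prod (A : comPzSemiRingType) (F : nat -> nat -> A) u :
  \prod_(i < r.+1) F i (nth 0%N (sortedparts u) i) =
  \prod_i F (r - spec_exp u i)%N (u i).
Proof.
rewrite (reindex_inj (@corank_inj u)); apply: eq_bigr => i _.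
by rewrite nth_sortedparts corankE.
Qed.

End SortedParts.

Section QTPochhammer.
Variables (K : numFieldType) (q t : K) (hqt : generic_qt q t) (r : nat).
Notation mnm := (multinom r.+1).
Implicit Types (u v w m : mnm) (b e : K).
Local Notation gpoch := (gpoch q t).

Lemma horner_gpoch u b : (gpoch u).[b] = qtpoch q t (b * t ^+ r) u.
Proof.
have t0 := t_neq0 hqt.
rewrite /qtpoch (sorted_prod (fun i k => qpoch q (b * t ^+ r / t ^+ i) k)).
rewrite horner_prod; apply: eq_bigr => i _; rewrite horner_prod.
apply: eq_bigr => k _; rewrite hornerD hornerN hornerM hornerZ hornerX hornerC.
rewrite -polyC_exp hornerC; congr (1 - _ * _).
have h : (spec_exp u i <= r)%N by rewrite -ltnS spec_exp_bound.
rewrite -[X in b * t ^+ X / _](subnK h) exprD -mulrA [t ^+ (r - _) * _]mulrC.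
by rewrite mulfK ?expf_neq0 // mulrC.
Qed.

Lemma qtpochX_gpoch u e : qtpochX q t (e * t ^+ r) u = gpoch u \Po (e *: 'X).
Proof.
have t0 := t_neq0 hqt.
rewrite /qtpochX /qtpoch (sorted_prod (fun i k =>
  qpoch q%:P ((e * t ^+ r) *: 'X / t%:P ^+ i) k)).
rewrite /gpoch rmorph_prod; apply: eq_bigr => i _; rewrite /qpoch /= rmorph_prod.
apply: eq_bigr => k _ /=.
rewrite -!polyC_exp comp_polyB comp_polyM !comp_polyC.
congr (1 - _ * _); rewrite comp_polyZ comp_polyX scalerA.
rewrite polyCV mulrC mul_polyC scalerA; congr (_ *: _).
have h : (spec_exp u i <= r)%N by rewrite -ltnS spec_exp_bound.
by rewrite -[X in e * t ^+ X](subnK h) exprD mulrCA mulKf ?expf_neq0 // mulrC.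
Qed.

End QTPochhammer.

(** * Connection coefficients from the binomial formula *)

Section Connection.
Variables (K : numFieldType) (q t : K) (hqt : generic_qt q t) (r : nat).
Notation MP := (mpoly r.+1 K).
Notation mnm := (multinom r.+1).
Implicit Types (p f g : MP) (u v w m : mnm) (i j : 'I_r.+1) (k d : nat).
Implicit Types (a b e s : K).
Local Notation spc := (spectral q t).
Local Notation lc := (gpoch_lc q t).
Local Notation M := (imac q t).
Local Notation E := (emac q t).
Local Notation e0val := (e0val q t).

Definition bcoef u v : K := meval (spc u) (M v) / lc v.

Lemma bcoef_small u v : (mdeg u <= mdeg v)%N -> u != v -> bcoef u v = 0.
Proof. by move=> h1 h2; rewrite /bcoef M_small // mul0r. Qed.

Lemma bcoef_lt u v : (mdeg u < mdeg v)%N -> bcoef u v = 0.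
Proof.
move=> h; apply: bcoef_small; first exact: ltnW.
by apply: contraTneq h => ->; rewrite ltnn.
Qed.

Lemma bcoef_diag u : bcoef u u = 1.
Proof. by rewrite /bcoef M_diag // mulfV // gpoch_lc_neq0. Qed.

Lemma spectral_expansion d f : (msize f <= d)%N ->
  exists c : mnm -> K, f = \sum_(v : bmultinom r.+1 d) c v *: M v.
Proof.
move=> hf.
suff [c hc] : exists c : mnm -> K, forall w, (mdeg w < d)%N ->
    meval (spc w) f = \sum_(v : bmultinom r.+1 d) c v * meval (spc w) (M v).
  exists c; apply/eqP; rewrite -subr_eq0; apply/eqP.
  apply: (spectral_unique hqt (d := d)).
    apply: leq_trans (mmeasureD_le _ _ _) _; rewrite mmeasureN geq_max hf /=.
    apply: leq_trans (mmeasure_sum _ _ _ _) _; apply/bigmax_leqP => v _.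
    apply: leq_trans (mmeasureZ_le _ _ _) _; apply: leq_trans (msize_M hqt v) _.
    exact: bmdeg.
  move=> w hw; rewrite mevalB hc // (raddf_sum (meval (spc w))) /=.
  by under [X in _ - X]eq_bigr do rewrite mevalZ; rewrite subrr.
suff h k : (k <= d)%N -> exists c : mnm -> K, forall w, (mdeg w < k)%N ->
    meval (spc w) f = \sum_(v : bmultinom r.+1 d) c v * meval (spc w) (M v).
  exact: (h d).
elim: k => [|k IH] hk; first by exists (fun=> 0).
have [c hc] := IH (ltnW hk).
pose S w := \sum_(v : bmultinom r.+1 d) c v * meval (spc w) (M v).
(* The correction lives in degree k only and leaves the values at points of lower degree
   unchanged. *)
pose D v := if mdeg v == k then (meval (spc v) f - S v) / lc v else 0.
exists (fun v => c v + D v) => w; rewrite ltnS leq_eqVlt => hw.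
under eq_bigr do rewrite mulrDl.
rewrite big_split /= -/(S w); case/predU1P: hw => hw; last first.
  rewrite big1 ?addr0; first exact: hc.
  move=> v _; rewrite /D; case: eqP => [e|_]; last by rewrite mul0r.
  rewrite M_small ?mulr0 // ?e ?(ltnW hw) //.
  by apply: contraTneq hw => ->; rewrite e ltnn.
have hwd : (mdeg w < d)%N by rewrite hw.
rewrite (bigD1 (BMultinom hwd)) //= big1; last first.
  move=> v hv; rewrite /D; case: eqP => [e|_]; last by rewrite mul0r.
  rewrite M_small ?mulr0 // ?e ?hw //.
  by apply: contra hv => /eqP e'; apply/eqP/val_inj.
by rewrite /D hw eqxx M_diag // divfK ?gpoch_lc_neq0 // addr0 addrC subrK.
Qed.

Lemma M_indep d (c : mnm -> K) :
  (forall w, (mdeg w < d)%N ->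
     \sum_(v : bmultinom r.+1 d) c v * meval (spc w) (M v) = 0) ->
  forall w, (mdeg w < d)%N -> c w = 0.
Proof.
move=> h w; have [N] := ubnP (mdeg w); elim: N w => // N IH w hw hwd.
have := h w hwd; rewrite (bigD1 (BMultinom hwd)) //= big1.
  rewrite addr0 M_diag // => /eqP; rewrite mulf_eq0.
  by rewrite (negPf (gpoch_lc_neq0 hqt w)) orbF => /eqP.
move=> v hv; case: (ltnP (mdeg v) (mdeg w)) => hvw.
  by rewrite IH ?mul0r ?bmdeg //; apply: leq_trans hvw _.
rewrite M_small ?mulr0 //.
by apply: contra hv => /eqP e; apply/eqP/val_inj.
Qed.

Lemma meval_emac_scale u s (x : 'I_r.+1 -> K) :
  meval (fun i => s * x i) (E u) = s ^+ mdeg u * meval x (E u).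
Proof.
rewrite !mevalE mulr_sumr; apply: eq_big_seq => m hm.
have -> : mdeg u = mdeg m.
  apply/esym; move: m hm; apply/dhomogP; rewrite /emac; exact: pihomogP.
rewrite mulrCA; congr (_ * _); rewrite mdegE -prodrXr -big_split /=.
by apply: eq_bigr => i _; rewrite exprMn.
Qed.

(** [is_connection] with bounded support, so that the sum is an ordinary finite one. *)
Definition is_conn u a b (c : mnm -> K) :=
  (forall v, (mdeg u < mdeg v)%N -> c v = 0) /\
  forall x : 'I_r.+1 -> K, meval (fun i => a * x i) (M u) =
    \sum_(v : bmultinom r.+1 (mdeg u).+1) c v * meval (fun i => b * x i) (M v).

Definition scalep s : MP -> MP := mlin (fun m => s ^+ mdeg m *: mpolyX K m).

Lemma meval_scalep s p (x : 'I_r.+1 -> K) :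
  meval x (scalep s p) = meval (fun i => s * x i) p.
Proof.
rewrite meval_mlin mevalE; apply: eq_bigr => m _; congr (_ * _).
rewrite mevalZ mevalX mdegE -prodrXr -big_split /=.
by apply: eq_bigr => i _; rewrite exprMn.
Qed.

Lemma is_conn_ex u a b : b != 0 -> exists c, is_conn u a b c.
Proof.
move=> b0; pose f := scalep (a / b) (M u).
have hf : (msize f <= (mdeg u).+1)%N.
  apply: leq_trans (msize_M hqt u).
  rewrite -[X in (_ <= X)%N]addn0; apply: msize_mlin => m.
  by rewrite addn1; apply: leq_trans (mmeasureZ_le _ _ _) _; rewrite mmeasureX.
have [c hc] := spectral_expansion hf.
exists (fun v => if (mdeg v <= mdeg u)%N then c v else 0); split.
  by move=> v; rewrite ltnNge => /negPf ->.
move=> x; have := congr1 (meval (fun i => b * x i)) hc.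
rewrite meval_scalep (raddf_sum (meval _)) /= => h.
transitivity (meval (fun i => a / b * (b * x i)) (M u)).
  by apply: meval_eq => i; rewrite mulrA divfK.
rewrite h; apply: eq_bigr => v _; rewrite mevalZ.
by have := bmdeg v; rewrite ltnS => ->.
Qed.

(** The matrix Q(a). The truncated exponent is harmless, since [bcoef u v] is 0 when |u| < |v|. *)
Definition qa a u v : K := a ^+ (mdeg u - mdeg v) * bcoef u v.

Lemma binomial_meval u d (x : 'I_r.+1 -> K) : (mdeg u < d)%N ->
  meval x (E u) / e0val u =
  \sum_(v : bmultinom r.+1 d) bcoef u v / e0val v * meval x (M v).
Proof.
move=> hd; have := congr1 (meval x) (binomial_formula hqt hd).
rewrite mevalZ mulrC => ->; rewrite (raddf_sum (meval x)) /=.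
apply: eq_bigr => v _; rewrite mevalZ; congr (_ * _).
by rewrite /bcoef invfM mulrA mulrAC.
Qed.

Lemma conn_bcoef (c : mnm -> mnm -> K) a b d u v : a != 0 -> b != 0 ->
  (forall w, is_conn w a b (c w)) -> (mdeg u < d)%N -> (mdeg v < d)%N ->
  \sum_(w : bmultinom r.+1 d) bcoef u w / e0val w * c w v =
  (a / b) ^+ mdeg u * bcoef u v / e0val v.
Proof.
move=> a0 b0 hc hu hv; apply/eqP; rewrite -subr_eq0; apply/eqP.
pose F v := \sum_(w : bmultinom r.+1 d) bcoef u w / e0val w * c w v -
  (a / b) ^+ mdeg u * bcoef u v / e0val v.
apply: (@M_indep d F) => // y hy.
(* Chosen so that b x is a lattice point, where independence of the M_v can be tested. *)
pose x i := spc y i / b.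
have xE : meval (fun i => b * x i) =1 meval (spc y) :> (MP -> K).
  by move=> p; apply: meval_eq => i; rewrite /x mulrC divfK.
have ext w : (mdeg w < d)%N -> meval (fun i => a * x i) (M w) =
    \sum_(v : bmultinom r.+1 d) c w v * meval (spc y) (M v).
  move=> hw; have [c0 ->] := hc w.
  have wd (l : bmultinom r.+1 (mdeg w).+1) : (mdeg l < d)%N.
    by apply: leq_trans (bmdeg l) _.
  pose bs (l : bmultinom r.+1 (mdeg w).+1) := BMultinom (wd l).
  pose bu (l : bmultinom r.+1 d) : option (bmultinom r.+1 (mdeg w).+1) :=
    insub (bmnm l).
  rewrite [RHS](bigID (fun v : bmultinom r.+1 d => mdeg v < (mdeg w).+1)%N) /=.
  rewrite [X in _ = _ + X]big1 ?addr0.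
    rewrite (reindex_omap bs bu) /=.
      transitivity (\sum_(l : bmultinom r.+1 (mdeg w).+1)
        c w l * meval (spc y) (M l)).
        by apply: eq_bigr => l _; rewrite xE.
      by apply: eq_bigl => l; rewrite bmdeg /bu /= valK eqxx.
    by move=> l l0; rewrite /bu insubT //; congr Some; apply/val_inj.
  by move=> l; rewrite -leqNgt => hl; rewrite c0 ?mul0r.
have h1 := binomial_meval (fun i => a * x i) hu.
have h2 : meval (fun i => a * x i) (E u) = (a / b) ^+ mdeg u * meval (spc y) (E u).
  rewrite -(meval_emac_scale u (a / b)); apply: meval_eq => i.
  by rewrite /x mulrA mulrAC.
rewrite h2 -mulrA (binomial_meval _ hu) in h1.
under eq_bigr do rewrite mulrBl mulr_suml.
rewrite sumrB exchange_big /=; apply/eqP; rewrite subr_eq0; apply/eqP.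
transitivity (\sum_(w : bmultinom r.+1 d)
    bcoef u w / e0val w * meval (fun i => a * x i) (M w)).
  apply: eq_bigr => w _; rewrite ext ?bmdeg // mulr_sumr.
  by apply: eq_bigr => l _; rewrite mulrA.
rewrite -h1 mulr_sumr; apply: eq_bigr => l _; ring.
Qed.

(** [conn_bcoef] rescaled by the factors that turn connection coefficients into E_{w/v}(a, b). *)
Lemma qa_conn (c : mnm -> mnm -> K) a b d u v : a != 0 -> b != 0 ->
  (forall w, is_conn w a b (c w)) -> (mdeg u < d)%N -> (mdeg v < d)%N ->
  \sum_(w : bmultinom r.+1 d) qa b u w *
    ((a ^- mdeg v * e0val v) / (b ^- mdeg w * e0val w) * c w v) = qa a u v.
Proof.
move=> a0 b0 hc hu hv.
have ea (l : mnm) := e0val_neq0 hqt l.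
have av : a ^+ mdeg v != 0 by rewrite expf_neq0.
have bu : b ^+ mdeg u != 0 by rewrite expf_neq0.
transitivity (b ^+ mdeg u * a ^- mdeg v * e0val v *
    \sum_(w : bmultinom r.+1 d) bcoef u w / e0val w * c w v).
  rewrite [RHS]mulr_sumr; apply: eq_bigr => w _; rewrite /qa.
  case: (leqP (mdeg w) (mdeg u)) => h; last by rewrite bcoef_lt // !(mul0r, mulr0).
  rewrite -[X in _ = b ^+ X * _ * _ * _](subnK h) exprD.
  have bw : b ^+ mdeg w != 0 by rewrite expf_neq0.
  by have ew := ea w; field; rewrite av bw ew.
rewrite (conn_bcoef a0 b0 hc hu hv) /qa.
case: (leqP (mdeg v) (mdeg u)) => h; last by rewrite bcoef_lt // !(mul0r, mulr0).
rewrite exprMn exprVn -[X in a ^+ X / _](subnK h) exprD.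
have ev := ea v; field; rewrite av bu ev //.
Qed.

End Connection.

(** * Power series in z *)

Section PowerSeriesRing.
Variable K : fieldType.
Implicit Types f g h : fps K.

(** A copy of [fps] carrying a ring structure whose product is [fps_mul], so that statements about
    [fps] convert to it and [ring] applies. *)
Definition pser : Type := nat -> K.
HB.instance Definition _ := gen_eqMixin pser.
HB.instance Definition _ := gen_choiceMixin pser.

Definition pser_zero : pser := fun=> 0.
Definition pser_opp (f : pser) : pser := fun N => - f N.
Definition pser_add (f g : pser) : pser := fun N => f N + g N.

Lemma pser_addA : associative pser_add.
Proof. by move=> f g h; apply/funext => N; apply: addrA. Qed.
Lemma pser_addC : commutative pser_add.
Proof. by move=> f g; apply/funext => N; apply: addrC. Qed.
Lemma pser_add0 : left_id pser_zero pser_add.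
Proof. by move=> f; apply/funext => N; apply: add0r. Qed.
Lemma pser_addN : left_inverse pser_zero pser_opp pser_add.
Proof. by move=> f; apply/funext => N; apply: addNr. Qed.

HB.instance Definition _ :=
  GRing.isZmodule.Build pser pser_addA pser_addC pser_add0 pser_addN.

Definition trunc f (N : nat) : {poly K} := \poly_(i < N.+1) f i.

Lemma fps_mul_trunc f g (k N : nat) : (k <= N)%N ->
  fps_mul f g k = (trunc f N * trunc g N)`_k.
Proof.
move=> kN; rewrite coefM; apply: eq_bigr => j _; rewrite !coef_poly !ltnS.
have jk : (j <= k)%N by rewrite -ltnS.
by rewrite (leq_trans jk kN) (leq_trans (leq_subr _ _) kN).
Qed.

Lemma coefM_eq (p1 p2 q1 q2 : {poly K}) (N : nat) :
  (forall k, (k <= N)%N -> p1`_k = p2`_k) ->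
  (forall k, (k <= N)%N -> q1`_k = q2`_k) ->
  (p1 * q1)`_N = (p2 * q2)`_N.
Proof.
move=> h1 h2; rewrite !coefM; apply: eq_bigr => j _.
by rewrite h1 ?h2 ?leq_subr // -ltnS.
Qed.

Lemma coef_trunc f (k N : nat) : (k <= N)%N -> (trunc f N)`_k = f k.
Proof. by move=> h; rewrite coef_poly ltnS h. Qed.

(** Each coefficient depends only on truncations, so associativity is inherited from polynomials. *)
Lemma fps_mulA : associative (@fps_mul K : pser -> pser -> pser).
Proof.
move=> f g h; apply/funext => N.
rewrite (fps_mul_trunc f _ (leqnn N)) (fps_mul_trunc _ h (leqnn N)).
transitivity ((trunc f N * (trunc g N * trunc h N))`_N).
  by apply: coefM_eq => // k hk; rewrite coef_trunc // (fps_mul_trunc _ _ hk).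
rewrite mulrA; apply: coefM_eq => // k hk.
by rewrite coef_trunc // (fps_mul_trunc _ _ hk).
Qed.

Lemma fps_mulC : commutative (@fps_mul K : pser -> pser -> pser).
Proof.
move=> f g; apply/funext => N.
by rewrite !(fps_mul_trunc _ _ (leqnn N)) mulrC.
Qed.

Lemma fps_mul1 : left_id (fps_one K) (@fps_mul K : pser -> pser -> pser).
Proof.
move=> f; apply/funext => N; rewrite (fps_mul_trunc _ _ (leqnn N)).
transitivity ((1 * trunc f N)`_N); last by rewrite mul1r coef_trunc.
by apply: coefM_eq => // k hk; rewrite coef_trunc.
Qed.

Lemma fps_mulDl : left_distributive (@fps_mul K : pser -> pser -> pser) pser_add.
Proof.
move=> f g h; apply/funext => N; rewrite /pser_add /fps_mul -big_split /=.
by apply: eq_bigr => k _; rewrite mulrDl.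
Qed.

Lemma fps_one_neq0 : (fps_one K : pser) != 0.
Proof.
apply/eqP => /(congr1 (fun f : pser => f 0%N)) /eqP.
by rewrite /fps_one /fps_of_poly coef1 /= oner_eq0.
Qed.

HB.instance Definition _ := GRing.Zmodule_isComNzRing.Build pser
  fps_mulA fps_mulC fps_mul1 fps_mulDl fps_one_neq0.

Definition pofp (p : {poly K}) : pser := fps_of_poly p.

Lemma pofpM p q : pofp (p * q) = pofp p * pofp q.
Proof. by apply/funext => N; rewrite /pofp /fps_of_poly coefM. Qed.
Lemma pofpB p q : pofp (p - q) = pofp p - pofp q.
Proof. by apply/funext => N; rewrite /pofp /fps_of_poly coefB. Qed.
Lemma pofp1 : pofp 1 = 1. Proof. by []. Qed.

Lemma pofp_prod (I : Type) (s : seq I) (P : pred I) (F : I -> {poly K}) :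
  pofp (\prod_(i <- s | P i) F i) = \prod_(i <- s | P i) pofp (F i).
Proof. exact: (big_morph pofp pofpM pofp1). Qed.

Definition pinv (f : pser) : pser := fps_inv f.

Lemma pmulV (f : pser) : f 0%N != 0 -> f * pinv f = 1.
Proof. by move=> f0; apply/funext => N; apply: fps_mulV. Qed.

Lemma pmul_coef (f g : pser) (N : nat) :
  (f * g) N = \sum_(k < N.+1) f k * g (N - k)%N.
Proof. by []. Qed.

Lemma pmul_coef0 (f g : pser) : (f * g) 0%N = f 0%N * g 0%N.
Proof. by rewrite pmul_coef big_ord1. Qed.

Lemma pmul_monomial (c : K) (k N : nat) (f : pser) :
  (pofp (c *: 'X^k) * f) N = if (k <= N)%N then c * f (N - k)%N else 0.
Proof.
rewrite pmul_coef; case: leqP => h.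
  have hk : (k < N.+1)%N by [].
  rewrite (bigD1 (Ordinal hk)) //= /pofp /fps_of_poly coefZ coefXn eqxx mulr1.
  rewrite big1 ?addr0 // => j hj; rewrite coefZ coefXn.
  have -> : (j == k :> nat) = false.
    by apply: contraNF hj => /eqP e; apply/eqP/val_inj.
  by rewrite mulr0 mul0r.
apply: big1 => j _; rewrite /pofp /fps_of_poly coefZ coefXn.
by have -> : (j == k :> nat) = false; [have := ltn_ord j; lia | rewrite mulr0 mul0r].
Qed.

Lemma pprod_coef0 (I : Type) (s : seq I) (P : pred I) (F : I -> pser) :
  (\prod_(i <- s | P i) F i) 0%N = \prod_(i <- s | P i) F i 0%N.
Proof.
apply: (big_morph (fun f : pser => f 0%N)) => [f g|]; first exact: pmul_coef0.
by rewrite /GRing.one /= /fps_one /fps_of_poly coef1.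
Qed.

Lemma pinv_coef0 (f : pser) : (pinv f) 0%N = (f 0%N)^-1.
Proof. by []. Qed.

Lemma psum_coef (I : Type) (s : seq I) (P : pred I) (F : I -> pser) (N : nat) :
  (\sum_(i <- s | P i) F i) N = \sum_(i <- s | P i) F i N.
Proof. by apply: (big_morph (fun f : pser => f N)). Qed.

End PowerSeriesRing.

(** * Series with polynomial coefficients of bounded degree *)

Section GradedSeries.
Variables (K : numFieldType) (n : nat).
Notation MP := (mpoly n K).
Notation pser := (pser K).
Implicit Types F G : ('I_n -> K) -> pser.

(** The coefficient of z^k is then determined by its values at the lattice points of degree at most
    k. *)
Definition graded F := forall k : nat, exists2 g : MP, (msize g <= k.+1)%N &
  forall x, F x k = meval x g.

Lemma msizeM_bound (f g : MP) (k l : nat) : (msize f <= k.+1)%N ->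
  (msize g <= l.+1)%N -> (msize (f * g) <= (k + l).+1)%N.
Proof.
move=> hf hg; case: (f =P 0) => [->|/eqP f0]; first by rewrite mul0r mmeasure0.
case: (g =P 0) => [->|/eqP g0]; first by rewrite mulr0 mmeasure0.
rewrite msizeM //; move: hf hg; move: (mmeasure _ f) (mmeasure _ g) => y z; lia.
Qed.

Lemma gradedM F G : graded F -> graded G -> graded (fun x => F x * G x).
Proof.
move=> hF hG k.
have [f hf] : {f : nat -> MP & forall k, (msize (f k) <= k.+1)%N /\
    forall x, F x k = meval x (f k)}.
  apply: (@choice _ _ (fun k g => (msize g <= k.+1)%N /\
    forall x, F x k = meval x g)) => l; by have [g] := hF l; exists g.
have [g hg] : {g : nat -> MP & forall k, (msize (g k) <= k.+1)%N /\
    forall x, G x k = meval x (g k)}.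
  apply: (@choice _ _ (fun k g => (msize g <= k.+1)%N /\
    forall x, G x k = meval x g)) => l; by have [h] := hG l; exists h.
exists (\sum_(j < k.+1) f j * g (k - j)%N); last first.
  move=> x; rewrite pmul_coef (raddf_sum (meval x)); apply: eq_bigr => j _ /=.
  by rewrite mevalM; case: (hf j) => _ ->; case: (hg (k - j)%N) => _ ->.
apply: leq_trans (mmeasure_sum _ _ _ _) _; apply/bigmax_leqP => j _.
have [h1 _] := hf j; have [h2 _] := hg (k - j)%N.
by have := msizeM_bound h1 h2; rewrite subnKC // -ltnS.
Qed.

Lemma graded_const (f : pser) : graded (fun=> f).
Proof.
move=> k; exists (mpolyC n (f k)); last by move=> x; rewrite mevalC.
by rewrite mmeasureC; case: eqP.
Qed.

Lemma graded_prod (I : Type) (s : seq I) (F : I -> ('I_n -> K) -> pser) :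
  (forall i, graded (F i)) -> graded (fun x => \prod_(i <- s) F i x).
Proof.
move=> h; elim: s => [|i s IH].
  by under eq_fun do rewrite big_nil; apply: graded_const.
by under eq_fun do rewrite big_cons; apply: gradedM.
Qed.

Lemma graded_inv F : (forall x, F x 0%N = 1) -> graded F ->
  graded (fun x => pinv (F x)).
Proof.
move=> F0 hF k; have [N] := ubnP k; elim: N k => // N IH k hk.
case: k hk => [|k] hk.
  exists (mpolyC n 1); first by rewrite mmeasureC; case: eqP.
  by move=> x; rewrite mevalC pinv_coef0 F0 invr1.
have [f hf] : {f : nat -> MP & forall k, (msize (f k) <= k.+1)%N /\
    forall x, F x k = meval x (f k)}.
  apply: (@choice _ _ (fun k g => (msize g <= k.+1)%N /\
    forall x, F x k = meval x g)) => l; by have [g] := hF l; exists g.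
have [g hg] : {g : nat -> MP & forall l, (l < k.+1)%N -> (msize (g l) <= l.+1)%N /\
    forall x, pinv (F x) l = meval x (g l)}.
  apply: (@choice _ _ (fun l g => (l < k.+1)%N -> (msize g <= l.+1)%N /\
    forall x, pinv (F x) l = meval x g)) => l.
  case: (ltnP l k.+1) => hl; last by exists 0.
  by have [|h h1 h2] := IH l; [apply: leq_trans hl _ | exists h].
exists (- \sum_(j < k.+1) f j.+1 * g (k - j)%N).
  rewrite mmeasureN; apply: leq_trans (mmeasure_sum _ _ _ _) _.
  apply/bigmax_leqP => j _.
  have [h1 _] := hf j.+1; have [h2 _] := hg (k - j)%N (leq_subr _ _).
  by have := msizeM_bound h1 h2; rewrite addSn subnKC // -ltnS.
move=> x; have : (F x * pinv (F x)) k.+1 = 0.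
  by rewrite pmulV ?F0 ?oner_eq0 // /GRing.one /= /fps_one /fps_of_poly coef1.
rewrite pmul_coef big_ord_recl F0 mul1r subn0 => /eqP.
rewrite addr_eq0 => /eqP ->; rewrite mevalN (raddf_sum (meval x)); congr (- _).
apply: eq_bigr => j _; rewrite lift0 subSS /= mevalM.
case: (hf j.+1) => _ ->; case: (hg (k - j)%N (leq_subr _ _)) => _ -> //.
Qed.

End GradedSeries.

(** * The transformation formula *)

Section GeneratingFunction.
Variables (K : numFieldType) (q t : K) (hqt : generic_qt q t) (r : nat).
Notation MP := (mpoly r.+1 K).
Notation mnm := (multinom r.+1).
Implicit Types (p f g : MP) (u v w y : mnm) (i j : 'I_r.+1) (k d N m : nat).
Implicit Types (a b c e s : K) (x : 'I_r.+1 -> K).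
Local Notation spc := (spectral q t).
Local Notation lc := (gpoch_lc q t).
Local Notation M := (imac q t).
Local Notation gpoch := (gpoch q t).
Local Notation bcoef := (bcoef q t).
Local Notation qa := (qa q t).

Definition qexp_coef N : K := \prod_(j < N) (- q ^+ j / (1 - q ^+ j.+1)).

(* Euler's expansion of (c z)_oo. *)
Definition qexp c : pser K := fun N => c ^+ N * qexp_coef N.

Lemma qexp_coef0 : qexp_coef 0 = 1. Proof. by rewrite /qexp_coef big_ord0. Qed.

Lemma qexp0 c : qexp c 0%N = 1.
Proof. by rewrite /qexp qexp_coef0 mulr1. Qed.

Lemma qexp_step c : qexp c = pofp (1 - c *: 'X) * qexp (c * q).
Proof.
rewrite pofpB pofp1 mulrBl mul1r; apply/funext => N.
have -> (f g : pser K) : (f - g) N = f N - g N by [].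
rewrite -['X]expr1 pmul_monomial; case: N => [|N] /=.
  by rewrite subr0 !qexp0.
rewrite subn1 /= /qexp /qexp_coef big_ord_recr /=.
set E := \prod_(_ < N) _.
have h := qt_neq1 hqt 0 (ltn0Sn N); rewrite expr0 mulr1 in h.
by rewrite !exprMn !exprS in h *; field.
Qed.

Lemma qexp_steps c m :
  qexp c = pofp (qpoch q%:P (c *: 'X) m) * qexp (c * q ^+ m).
Proof.
elim: m c => [|m IH] c.
  by rewrite /qpoch big_ord0 pofp1 mul1r mulr1.
rewrite {1}IH /qpoch big_ord_recr /= pofpM -mulrA; congr (_ * _).
rewrite {1}qexp_step exprSr mulrA; congr (pofp (1 - _) * _).
by rewrite -polyC_exp [RHS]mulrC mul_polyC scalerA mulrC.
Qed.

(* The product of (e t^{n-i})_oo / (e x_i)_oo over i; at a spectral vector it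
   collapses to the polynomial (e t^{n-1})_y. *)
Definition gser e x : pser K :=
  \prod_(i < r.+1) (qexp (e * t ^+ (r.+1 - i.+1)) * pinv (qexp (e * x i))).

Lemma gser0 e x : gser e x 0%N = 1.
Proof.
rewrite /gser pprod_coef0 big1 // => i _.
by rewrite pmul_coef0 pinv_coef0 !qexp0 mulfV ?oner_eq0.
Qed.

Lemma gser_graded e : graded (gser e).
Proof.
rewrite /gser; apply: (@graded_prod _ _ _ _ (fun i x =>
  qexp (e * t ^+ (r.+1 - i.+1)) * pinv (qexp (e * x i)))) => i.
apply: gradedM; first exact: graded_const.
apply: (@graded_inv _ _ (fun x => qexp (e * x i))); first by move=> x; rewrite qexp0.
move=> k; exists ((e ^+ k * qexp_coef k) *: mpolyX K (mnm_muln (mnm1 i) k)).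
  apply: leq_trans (mmeasureZ_le _ _ _) _; rewrite mmeasureX; apply: eq_leq.
  by have h := mdegMn (mnm1 i) k; rewrite mdeg1 mul1n in h; rewrite -[in RHS]h.
move=> x; rewrite mevalZ mevalX /qexp exprMn (bigD1 i) //= big1.
  by rewrite mulmnE mnm1E eqxx mul1n mulr1; ring.
by move=> j hj; rewrite mulmnE mnm1E eq_sym (negPf hj) mul0n.
Qed.

(** Reordering the numerators by [corank] pairs t^{spec_exp} with the coordinate q^{y_i}
    t^{spec_exp}; each quotient then telescopes to y_i factors. *)
Lemma gser_spec e y : gser e (spc y) = pofp (gpoch y \Po (e *: 'X)).
Proof.
rewrite /gser big_split /=.
rewrite (reindex_inj (@corank_inj r y)) -big_split /=.
rewrite /gpoch rmorph_prod pofp_prod; apply: eq_bigr => i _ /=.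
have hi := spec_exp_bound y i.
have -> : (r.+1 - (corank y i).+1)%N = spec_exp y i.
  by rewrite subSS corankE subKn // -ltnS.
have -> : qpoch q%:P (t ^+ spec_exp y i *: 'X) (y i) \Po (e *: 'X) =
    qpoch q%:P ((e * t ^+ spec_exp y i) *: 'X) (y i) :> {poly K}.
  rewrite /qpoch rmorph_prod; apply: eq_bigr => k _ /=.
  rewrite -!polyC_exp comp_polyB comp_polyM !comp_polyC comp_polyZ comp_polyX scalerA.
  by rewrite [_ * e]mulrC.
rewrite [X in X * pinv _](qexp_steps _ (y i)) -[LHS]mulrA.
have -> : e * spc y i = e * t ^+ spec_exp y i * q ^+ y i.
  by rewrite /spectral -mulrA [_ * q ^+ _]mulrC.
by rewrite pmulV ?mulr1 // qexp0 oner_eq0.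
Qed.

Lemma coef_comp_scale (p : {poly K}) e k : (p \Po (e *: 'X))`_k = e ^+ k * p`_k.
Proof.
rewrite comp_polyE coef_sum; under eq_bigr do rewrite exprZn !coefZ coefXn.
case: (ltnP k (size p)) => h.
  rewrite (bigD1 (Ordinal h)) //= eqxx mulr1 big1 ?addr0; first exact: mulrC.
  by move=> j hj; rewrite eq_sym (_ : (j == k :> nat) = false) ?mulr0 //;
    apply: contraNF hj => /eqP e'; apply/eqP/val_inj.
rewrite nth_default // mulr0 big1 // => j _.
by rewrite (_ : (k == j :> nat) = false) ?mulr0 //; have := ltn_ord j; lia.
Qed.

Definition hser e u : pser K := pinv (pofp (gpoch u \Po (e *: 'X))).

Lemma pofp_gpoch0 e u : pofp (gpoch u \Po (e *: 'X)) 0%N = 1.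
Proof. by rewrite /pofp /fps_of_poly coef_comp_scale gpoch_coef0 // mulr1. Qed.

(** Both sides have degree at most |v| + k, so lattice points up to there decide. At <y> either M_v
    vanishes or, by extra vanishing, the series is a polynomial of degree |y| - |v|: its coefficient
    of z^k is 0 for |y| < |v| + k and the leading one for equality. *)
Lemma gser_M e v k d x : (mdeg v + k < d)%N ->
  (gser e x * hser e v) k * meval x (M v) =
  \sum_(w : bmultinom r.+1 d | mdeg w == (mdeg v + k)%N) qa e w v * meval x (M w).
Proof.
move=> hd.
have hG : graded (fun x => gser e x * hser e v).
  exact: gradedM (gser_graded e) (graded_const _ _).
have [g hg gE] := hG k.
pose Rhs := \sum_(w : bmultinom r.+1 d | mdeg w == (mdeg v + k)%N) qa e w v *: M w.
suff gR : g * M v = Rhs.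
  rewrite gE -mevalM gR (raddf_sum (meval x)) /=.
  by apply: eq_bigr => w _; rewrite mevalZ.
apply/eqP; rewrite -subr_eq0; apply/eqP.
apply: (spectral_unique hqt (d := (mdeg v + k).+1)).
  apply: leq_trans (mmeasureD_le _ _ _) _; rewrite mmeasureN geq_max.
  apply/andP; split; first by rewrite addnC; apply: msizeM_bound (msize_M hqt v).
  apply: leq_trans (mmeasure_sum _ _ _ _) _; apply/bigmax_leqP => w /eqP hw.
  by apply: leq_trans (mmeasureZ_le _ _ _) _; rewrite -hw; apply: msize_M.
move=> y hy; apply/eqP; rewrite mevalB subr_eq0; apply/eqP.
have -> : meval (spc y) Rhs =
    if mdeg y == (mdeg v + k)%N then qa e y v * lc y else 0.
  rewrite /Rhs (raddf_sum (meval (spc y))) /=; case: eqP => hyd.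
    have hyd' : (mdeg y < d)%N by rewrite hyd.
    rewrite (bigD1 (BMultinom hyd')) /=; last by apply/eqP.
    rewrite mevalZ M_diag // big1 ?addr0 // => w /andP[/eqP hw hwy].
    rewrite mevalZ M_small ?mulr0 ?hw // eq_sym.
    by apply: contra hwy => /eqP e'; apply/eqP/val_inj.
  apply: big1 => w /eqP hw; rewrite mevalZ M_small ?mulr0 ?hw //.
  by apply/eqP => e'; apply: hyd; rewrite e'.
rewrite mevalM -gE gser_spec.
case: (eqVneq (meval (spc y) (M v)) 0) => [h0|h0].
  by rewrite h0 mulr0 /qa /bcoef h0; case: ifP => _; rewrite ?mul0r ?mulr0 // mul0r.
have /dvdpP [rho hrho] := M_extra_vanishing hqt h0.
have rho0 : rho != 0.
  by apply: contraNneq (gpoch_neq0 hqt y) => e'; rewrite hrho e' mul0r.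
have srho : (size rho + mdeg v)%N = (mdeg y).+1.
  have := size_gpoch hqt y; rewrite hrho size_mul ?gpoch_neq0 // size_gpoch //.
  by rewrite addnS.
have lrho : lc y = lead_coef rho * lc v by rewrite /gpoch_lc hrho lead_coefM.
rewrite hrho rmorphM /= pofpM -mulrA pmulV ?pofp_gpoch0 ?oner_eq0 // mulr1.
rewrite /pofp /fps_of_poly coef_comp_scale; case: eqP => hyd.
  have -> : rho`_k = lead_coef rho.
    by rewrite lead_coefE; congr (_`_ _); move: srho hyd; lia.
  rewrite /qa /bcoef hyd addKn lrho; have := gpoch_lc_neq0 hqt v => h; field.
  exact: h.
rewrite nth_default ?mulr0 ?mul0r //; move: srho hyd hy.
by rewrite ltnS; move: (size rho) => z; lia.
Qed.
(** [gser_M] summed over k at a lattice point. Where M_v does not vanish, the series is the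
    polynomial [gpoch w] / [gpoch v] in b z, and adding its coefficients evaluates the quotient at
    b. *)
Lemma gpoch_M b v w d : (mdeg w < d)%N ->
  (gpoch w).[b] * meval (spc w) (M v) =
  (gpoch v).[b] * \sum_(u : bmultinom r.+1 d) qa b u v * meval (spc w) (M u).
Proof.
move=> hw.
have -> : \sum_(u : bmultinom r.+1 d) qa b u v * meval (spc w) (M u) =
    \sum_(k < d - mdeg v) (gser b (spc w) * hser b v) k * meval (spc w) (M v).
  under [RHS]eq_bigr => k _.
    rewrite (@gser_M b v k d); last by have := ltn_ord k; lia.
    over.
  rewrite (exchange_big_dep xpredT) //=; apply: eq_bigr => u _.
  have hu := bmdeg u; case: (leqP (mdeg v) (mdeg u)) => huv.
    have hk : (mdeg u - mdeg v < d - mdeg v)%N by lia.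
    rewrite (big_pred1 (Ordinal hk)) // => k /=.
    by rewrite -val_eqE /=; apply/eqP/eqP; lia.
  rewrite big_pred0; last by move=> k; apply/eqP; lia.
  by rewrite /qa bcoef_lt // mulr0 mul0r.
case: (eqVneq (meval (spc w) (M v)) 0) => [h0|h0].
  by rewrite h0 mulr0 big1 ?mulr0 // => k _; rewrite mulr0.
have /dvdpP [rho hrho] := M_extra_vanishing hqt h0.
have rho0 : rho != 0.
  by apply: contraNneq (gpoch_neq0 hqt w) => e'; rewrite hrho e' mul0r.
have srho : (size rho <= d - mdeg v)%N.
  have := size_gpoch hqt w; rewrite hrho size_mul ?gpoch_neq0 // size_gpoch //.
  by rewrite addnS; move: (size rho) hw => z; lia.
rewrite -mulr_suml mulrA hrho hornerM; congr (_ * _).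
rewrite mulrC; congr (_ * _).
rewrite (horner_coef_wide _ srho); apply: eq_bigr => k _.
rewrite gser_spec hrho rmorphM /= pofpM -mulrA pmulV ?pofp_gpoch0 ?oner_eq0 //.
by rewrite mulr1 /pofp /fps_of_poly coef_comp_scale mulrC.
Qed.

(* For s = 1 this is, in the basis M_v of functions on the lattice, the
   multiplication by w -> (gpoch w).[a]; for s <> 0 it is a diagonal conjugate of
   such an operator. *)
Definition amat s a u v : K := qa a u v * (gpoch v).[a * s].

Lemma amat1_comm a e d u v : (mdeg u < d)%N ->
  \sum_(w : bmultinom r.+1 d) amat 1 a u w * amat 1 e w v =
  \sum_(w : bmultinom r.+1 d) amat 1 e u w * amat 1 a w v.
Proof.
move=> hu; apply/eqP; rewrite -subr_eq0; apply/eqP.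
apply: (@M_indep _ _ _ hqt _ d (fun u => \sum_(w : bmultinom r.+1 d)
  amat 1 a u w * amat 1 e w v - \sum_(w : bmultinom r.+1 d)
  amat 1 e u w * amat 1 a w v)) => // y hy.
have step b b' : (gpoch y).[b] * ((gpoch y).[b'] * meval (spc y) (M v)) =
    \sum_(u : bmultinom r.+1 d) (\sum_(w : bmultinom r.+1 d)
      amat 1 b u w * amat 1 b' w v) * meval (spc y) (M u).
  rewrite (gpoch_M b' v hy) mulr_sumr mulr_sumr.
  under [RHS]eq_bigr do rewrite mulr_suml.
  rewrite exchange_big /=; apply: eq_bigr => w _.
  transitivity (qa b' w v * (gpoch v).[b'] *
    ((gpoch y).[b] * meval (spc y) (M w))); first by ring.
  rewrite (gpoch_M b w hy) !mulr_sumr.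
  by apply: eq_bigr => z _; rewrite /amat !mulr1; ring.
under eq_bigr do rewrite mulrBl.
by rewrite sumrB -!step mulrCA subrr.
Qed.

Lemma poly_eq_neq0 (p1 p2 : {poly K}) :
  (forall z : K, z != 0 -> p1.[z] = p2.[z]) -> p1 = p2.
Proof.
move=> h; apply/eqP; rewrite -subr_eq0; apply: contraT => p0.
(* In characteristic 0 the integers 1, 2, .. supply more nonzero roots than the degree allows. *)
have := @max_poly_roots _ (p1 - p2) [seq N.+1%:R | N <- iota 0 (size (p1 - p2))] p0.
rewrite size_map size_iota ltnn; apply.
  apply/allP => _ /mapP[l _ ->]; by rewrite /root hornerD hornerN h ?subrr ?pnatr_eq0.
rewrite map_inj_uniq ?iota_uniq // => i j /eqP.
by rewrite eqr_nat => /eqP[].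
Qed.

Lemma amat_scale s a u v : s != 0 ->
  amat s a u v = s ^- mdeg u * amat 1 (a * s) u v * s ^+ mdeg v.
Proof.
move=> s0; rewrite /amat mulr1 /qa.
case: (leqP (mdeg v) (mdeg u)) => h; last by rewrite bcoef_lt // !(mulr0, mul0r).
rewrite exprMn -[X in s ^- X](subnK h) exprD.
have h1 : s ^+ mdeg v != 0 by rewrite expf_neq0.
have h2 : s ^+ (mdeg u - mdeg v) != 0 by rewrite expf_neq0.
by field; rewrite h1.
Qed.

(** For s <> 0 conjugation by powers of s reduces to s = 1. Both sides are polynomials in s, which
    covers s = 0 as well; that value occurs when the parameter d of the theorem is 0. *)
Lemma amat_comm s a e d u v : (mdeg u < d)%N ->
  \sum_(w : bmultinom r.+1 d) amat s a u w * amat s e w v =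
  \sum_(w : bmultinom r.+1 d) amat s e u w * amat s a w v.
Proof.
move=> hu.
pose P a e : {poly K} := \sum_(w : bmultinom r.+1 d) (qa a u w * qa e w v) *:
  ((gpoch w \Po (a *: 'X)) * (gpoch v \Po (e *: 'X))).
have PE a' e' z : (P a' e').[z] =
    \sum_(w : bmultinom r.+1 d) amat z a' u w * amat z e' w v.
  rewrite horner_sum; apply: eq_bigr => w _.
  by rewrite hornerZ hornerM !horner_comp !hornerZ hornerX /amat; ring.
rewrite -!PE; congr (_.[s]); apply: poly_eq_neq0 => z z0; rewrite !PE.
have step a' e' : \sum_(w : bmultinom r.+1 d) amat z a' u w * amat z e' w v =
    z ^- mdeg u * z ^+ mdeg v * \sum_(w : bmultinom r.+1 d)
      amat 1 (a' * z) u w * amat 1 (e' * z) w v.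
  rewrite mulr_sumr; apply: eq_bigr => w _.
  rewrite (amat_scale a' u w z0) (amat_scale e' w v z0).
  have h1 : z ^+ mdeg w != 0 by rewrite expf_neq0.
  have h2 : z ^+ mdeg u != 0 by rewrite expf_neq0.
  by field; rewrite h1 h2.
by rewrite !step (amat1_comm _ _ _ hu).
Qed.

Lemma amat_inj s (f : K) d (Z Z' : mnm -> K) : (forall u, (gpoch u).[f * s] != 0) ->
  (forall y, (mdeg y < d)%N ->
    \sum_(w : bmultinom r.+1 d) amat s f y w * Z w =
    \sum_(w : bmultinom r.+1 d) amat s f y w * Z' w) ->
  forall y, (mdeg y < d)%N -> Z y = Z' y.
Proof.
move=> hf h y; have [N] := ubnP (mdeg y); elim: N y => // N IH y hy hyd.
have E (Z1 : mnm -> K) : \sum_(w : bmultinom r.+1 d) amat s f y w * Z1 w =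
    amat s f y y * Z1 y +
    \sum_(w : bmultinom r.+1 d | w != BMultinom hyd) amat s f y w * Z1 w.
  by rewrite (bigD1 (BMultinom hyd)).
have := h y hyd; rewrite (E Z) (E Z').
rewrite [X in _ = _ + X](eq_bigr (fun w : bmultinom r.+1 d => amat s f y w * Z w)).
  move/addIr; rewrite /amat /qa subnn bcoef_diag // mulr1 mul1r.
  by move/(mulfI (hf y)).
move=> w hw; case: (ltnP (mdeg w) (mdeg y)) => hwy.
  by rewrite IH ?bmdeg //; apply: leq_trans hwy _.
rewrite /amat /qa bcoef_small ?mulr0 ?mul0r //.
by apply: contra hw => /eqP e'; apply/eqP/val_inj.
Qed.

(* Both sides agree after applying the triangular matrix [amat s f]: they turn
   into the two products of [amat s a] and [amat s e]. *)
Lemma skew_identity s a e (f : K) d (X X' : mnm -> mnm -> K) v w :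
  (forall u, (gpoch u).[f * s] != 0) -> (mdeg v < d)%N -> (mdeg w < d)%N ->
  (forall u, (mdeg u < d)%N ->
    \sum_(y : bmultinom r.+1 d) qa f u y * X y v = qa a u v) ->
  (forall u, (mdeg u < d)%N ->
    \sum_(y : bmultinom r.+1 d) qa f u y * X' y v = qa e u v) ->
  (gpoch v).[a * s] * \sum_(u : bmultinom r.+1 d)
    qa e w u * ((gpoch u).[e * s] / (gpoch u).[f * s]) * X u v =
  (gpoch v).[e * s] * \sum_(u : bmultinom r.+1 d)
    qa a w u * ((gpoch u).[a * s] / (gpoch u).[f * s]) * X' u v.
Proof.
move=> hf hv hw hX hX'.
pose Y a e (X : mnm -> mnm -> K) w := (gpoch v).[a * s] * \sum_(u : bmultinom r.+1 d)
  qa e w u * ((gpoch u).[e * s] / (gpoch u).[f * s]) * X u v.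
rewrite -/(Y a e X w) -/(Y e a X' w).
have step a' e' (X1 : mnm -> mnm -> K) : (forall u, (mdeg u < d)%N ->
      \sum_(y : bmultinom r.+1 d) qa f u y * X1 y v = qa a' u v) ->
    forall y, (mdeg y < d)%N -> \sum_(w : bmultinom r.+1 d)
      amat s f y w * Y a' e' X1 w =
    \sum_(w : bmultinom r.+1 d) amat s e' y w * amat s a' w v.
  move=> hX1 y hy.
  transitivity ((gpoch v).[a' * s] * \sum_(u : bmultinom r.+1 d)
      (\sum_(w : bmultinom r.+1 d) amat s f y w * amat s e' w u) *
      (X1 u v / (gpoch u).[f * s])).
    under [in RHS]eq_bigr do rewrite mulr_suml.
    rewrite exchange_big mulr_sumr /=; apply: eq_bigr => z _.
    rewrite /Y mulrCA mulr_sumr; congr (_ * _); apply: eq_bigr => u _.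
    by rewrite /amat; ring.
  (* Commuting brings [amat s f] next to [X1]: the denominators cancel its diagonal factor, and the
     hypothesis on Q(f) applies. *)
  under eq_bigr do rewrite (amat_comm _ _ _ _ hy) mulr_suml.
  rewrite exchange_big mulr_sumr /=; apply: eq_bigr => z _.
  rewrite [in RHS]/amat -hX1 ?bmdeg // mulr_suml !mulr_sumr; apply: eq_bigr => u _.
  by have := hf u => h; rewrite /amat; field.
apply: (amat_inj (s := s) (f := f) (d := d)) => // y hy.
by rewrite !step // (amat_comm _ _ _ _ hy).
Qed.

End GeneratingFunction.

(** * From the matrix identity to power series *)

Section Assembly.
Local Open Scope classical_set_scope.
Variables (K : numFieldType) (q t : K) (hqt : generic_qt q t) (r : nat).
Notation MP := (mpoly r.+1 K).
Notation mnm := (multinom r.+1).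
Implicit Types (u v w y : mnm) (i j : 'I_r.+1) (k d N m : nat).
Implicit Types (a b e s z : K) (c : mnm -> K) (x : 'I_r.+1 -> K).
Local Notation spc := (spectral q t).
Local Notation M := (imac q t).
Local Notation gpoch := (gpoch q t).
Local Notation qa := (qa q t).
Local Notation e0val := (e0val q t).

Definition bm_seq d : seq mnm := [seq bmnm l | l <- enum {: bmultinom r.+1 d}].

Lemma bm_seqP d u : (u \in bm_seq d) = (mdeg u < d)%N.
Proof.
apply/mapP/idP => [[l _ ->]|h]; first exact: bmdeg.
by exists (BMultinom h); rewrite ?mem_enum.
Qed.

Lemma fsum_bm (F : mnm -> K) d : (forall u, F u != 0 -> (mdeg u < d)%N) ->
  \sum_(u \in [set: mnm]) F u = \sum_(u : bmultinom r.+1 d) F u.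
Proof.
move=> h; rewrite (fsbigE (bm_seq d)) //.
- rewrite big_map big_enum_cond /=; apply: eq_bigl => u.
  exact: mem_set.
- by rewrite map_inj_uniq ?enum_uniq //; apply: val_inj.
- move=> u _; rewrite bm_seqP -leqNgt => hu; apply/eqP.
  by apply: contraT => /h; rewrite ltnNge hu.
Qed.

Lemma is_conn_bound u a b c d x : is_conn q t u a b c -> (mdeg u < d)%N ->
  meval (fun i => a * x i) (M u) =
  \sum_(v : bmultinom r.+1 d) c v * meval (fun i => b * x i) (M v).
Proof.
move=> [c0 ->] hd.
pose F v := c v * meval (fun i => b * x i) (M v).
have hF v : F v != 0 -> (mdeg v < (mdeg u).+1)%N.
  by apply: contraNT; rewrite -leqNgt => h; rewrite /F c0 ?mul0r.
rewrite -(fsum_bm hF) (fsum_bm (d := d)) // => v /hF h.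
exact: leq_trans h hd.
Qed.

Lemma finite_conn_bound (c : mnm -> K) : finite_set [set v | c v != 0] ->
  exists d, forall v, c v != 0 -> (mdeg v < d)%N.
Proof.
move=> /finite_seqP [s hs]; exists (\max_(v <- s) mdeg v).+1 => v hv.
have vs : v \in s by have : [set v | c v != 0] v by []; rewrite hs.
by rewrite ltnS; apply: leq_bigmax_seq.
Qed.

Lemma conn_unique b d c c' : b != 0 ->
  (forall v, c v != 0 -> (mdeg v < d)%N) -> (forall v, c' v != 0 -> (mdeg v < d)%N) ->
  (forall x, \sum_(v : bmultinom r.+1 d) c v * meval (fun i => b * x i) (M v) =
    \sum_(v : bmultinom r.+1 d) c' v * meval (fun i => b * x i) (M v)) ->
  c = c'.
Proof.
move=> b0 hc hc' h; apply/funext => v; case: (ltnP (mdeg v) d) => hv; last first.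
  have -> : c v = 0 by apply/eqP; move: hv; rewrite leqNgt; apply: contraNT; apply: hc.
  by apply/esym/eqP; move: hv; rewrite leqNgt; apply: contraNT; apply: hc'.
apply/eqP; rewrite -subr_eq0; apply/eqP.
apply: (@M_indep _ _ _ hqt _ d (fun v => c v - c' v)) => // y hy.
under eq_bigr do rewrite mulrBl.
rewrite sumrB; apply/eqP; rewrite subr_eq0; apply/eqP.
have xE : meval (fun i => b * (spc y i / b)) =1 meval (spc y) :> (MP -> K).
  by move=> p; apply: meval_eq => i; rewrite mulrC divfK.
have := h (fun i => spc y i / b).
by under eq_bigr do rewrite xE; under [in RHS]eq_bigr do rewrite xE.
Qed.

(** Coefficients of finite support are unique, so the family picked by [xget] is the one already
    found. Its support is bounded a priori only by some d1, hence the comparison up to a maximum. *)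
Lemma is_conn_connection u a b : b != 0 ->
  is_conn q t u a b (connection q t u a b).
Proof.
move=> b0; have [c0 hc0] := is_conn_ex hqt u a b0.
have ex : is_connection q t u a b c0.
  have hv v : c0 v != 0 -> (mdeg v < (mdeg u).+1)%N.
    by case: hc0 => h _; apply: contraNT; rewrite -leqNgt => /h ->.
  split.
    apply: (sub_finite_set _ (finite_seq (bm_seq (mdeg u).+1))) => v /= /hv.
    by rewrite bm_seqP.
  move=> x; rewrite -imacE (is_conn_bound x hc0 (ltnSn _)).
  under eq_fsbigr do rewrite -imacE.
  rewrite (fsum_bm (d := (mdeg u).+1)) // => v.
  by move=> h; apply: hv; apply: contraNneq h => ->; rewrite mul0r.
have [/finite_conn_bound [d1 hd1] hM] : is_connection q t u a b (connection q t u a b).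
  exact: (xgetI (fun=> 0) ex).
suff -> : connection q t u a b = c0 by [].
pose d := maxn d1 (mdeg u).+1.
apply: (conn_unique (d := d) b0) => [v|v hv|x].
- by move/hd1 => h; rewrite leq_max h.
- rewrite leq_max orbC ltnS leqNgt; apply/orP; left.
  by apply: contra hv => h; case: hc0 => ->.
- rewrite -(is_conn_bound x hc0) ?leq_maxr // imacE hM.
  under eq_fsbigr do rewrite -imacE.
  rewrite (fsum_bm (d := d)) // => v h; have {}h : connection q t u a b v != 0.
    by apply: contraNneq h => ->; rewrite mul0r.
  by have := hd1 _ h; rewrite leq_max => ->.
Qed.

Lemma is_conn_unique u a b c c' : b != 0 ->
  is_conn q t u a b c -> is_conn q t u a b c' -> c = c'.
Proof.
move=> b0 hc hc'; have supp c1 v : is_conn q t u a b c1 -> c1 v != 0 ->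
    (mdeg v < (mdeg u).+1)%N.
  by case=> h _; apply: contraNT; rewrite -leqNgt => /h ->.
apply: (conn_unique (d := (mdeg u).+1) b0) => [v|v|x]; try exact: supp.
by case: hc hc' => _ <- [_ <-].
Qed.

Lemma connection_scale u a b z : b != 0 -> z != 0 ->
  connection q t u (z * a) (z * b) = connection q t u a b.
Proof.
move=> b0 z0; have zb0 : z * b != 0 by rewrite mulf_neq0.
have [h1 h2] := is_conn_connection u a b0.
apply: (is_conn_unique zb0 (is_conn_connection u (z * a) zb0)); split=> // x.
transitivity (meval (fun i => a * (z * x i)) (M u)).
  by apply: meval_eq => i; ring.
rewrite h2; apply: eq_bigr => v _; congr (_ * _); apply: meval_eq => i; ring.
Qed.

Lemma EskewE u v a b : Eskew q t u v a b =
  (a ^- mdeg v * e0val v) / (b ^- mdeg u * e0val u) * connection q t u a b v.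
Proof.
rewrite /Eskew -!emacE -!exprVn -!meval_emac_scale.
by congr (_ / _ * _); apply: meval_eq => i; rewrite mulrC.
Qed.

Lemma Eskew_qa a b d u v : a != 0 -> b != 0 -> (mdeg u < d)%N -> (mdeg v < d)%N ->
  \sum_(w : bmultinom r.+1 d) qa b u w * Eskew q t w v a b = qa a u v.
Proof.
move=> a0 b0 hu hv; have hc w := is_conn_connection w a b0.
by rewrite -(qa_conn hqt a0 b0 hc hu hv); apply: eq_bigr => w _; rewrite EskewE.
Qed.

Lemma Eskew_lt u v a b : b != 0 -> (mdeg u < mdeg v)%N -> Eskew q t u v a b = 0.
Proof.
by move=> b0 h; rewrite EskewE; have [-> //] := is_conn_connection u a b0; rewrite mulr0.
Qed.

(** Homogeneity: [connection] is unchanged when a and b are scaled together. For |u| < |v| the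
    exponent is truncated, but the coefficient is 0. *)
Lemma EskewXE u v a b : a != 0 -> b != 0 ->
  EskewX q t u v a b = Eskew q t u v a b *: 'X^(mdeg u - mdeg v).
Proof.
move=> a0 b0; apply: xget_subset1 => [z z0|p1 p2 h1 h2]; last first.
  by apply: poly_eq_neq0 => z z0; rewrite h1 ?h2.
rewrite hornerZ hornerXn; case: (ltnP (mdeg u) (mdeg v)) => h.
  by rewrite !Eskew_lt ?mul0r // mulf_neq0.
rewrite !EskewE connection_scale // !exprMn.
rewrite -[in z ^+ mdeg u](subnK h) exprD.
have := e0val_neq0 hqt u => eu.
have h1 : z ^+ mdeg v != 0 by rewrite expf_neq0.
have h2 : z ^+ (mdeg u - mdeg v) != 0 by rewrite expf_neq0.
have h3 : a ^+ mdeg v != 0 by rewrite expf_neq0.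
have h4 : b ^+ mdeg u != 0 by rewrite expf_neq0.
by field; rewrite h1 h2 h3 h4 eu.
Qed.

(** The summand u contributes z^{|u| - |v|}, and expanding the product times M_u contributes z^{|w|
    - |u|} at M_w. Hence z^N selects |w| = |v| + N, and the sums become finite matrix products. *)
Lemma gser_sum (C : mnm -> K) e a b v x N : a != 0 -> b != 0 ->
  (gser q t e x * ((fun N => \sum_(u \in [set: mnm])
     (pofp ((C u * meval x (M u)) *: EskewX q t u v a b) * hser q t e u) N) : pser K)) N =
  \sum_(w : bmultinom r.+1 (mdeg v + N).+1 | mdeg w == (mdeg v + N)%N)
    (\sum_(u : bmultinom r.+1 (mdeg v + N).+1) qa e w u * C u * Eskew q t u v a b) *
    meval x (M w).
Proof.
move=> a0 b0; set d := (mdeg v + N).+1.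
pose c u := C u * meval x (M u) * Eskew q t u v a b.
have termE u : pofp ((C u * meval x (M u)) *: EskewX q t u v a b) =
    pofp (c u *: 'X^(mdeg u - mdeg v)) by rewrite EskewXE // scalerA.
have hsum k : (k <= N)%N -> \sum_(u \in [set: mnm])
     (pofp ((C u * meval x (M u)) *: EskewX q t u v a b) * hser q t e u) k =
   (\sum_(u : bmultinom r.+1 d) pofp (c u *: 'X^(mdeg u - mdeg v)) * hser q t e u) k.
  move=> hk; under eq_fsbigr do rewrite termE.
  rewrite psum_coef; apply: fsum_bm => u.
  rewrite pmul_monomial; case: (leqP (mdeg u - mdeg v) k) => h; rewrite ?eqxx // => _.
  by rewrite /d; move: h hk; lia.
rewrite pmul_coef.
under eq_bigr do rewrite hsum ?leq_subr //.
rewrite -pmul_coef mulr_sumr psum_coef.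
under [RHS]eq_bigr do rewrite mulr_suml.
rewrite [RHS]exchange_big /=; apply: eq_bigr => u _.
rewrite mulrCA pmul_monomial.
have hu := bmdeg u; have -> : (mdeg u - mdeg v <= N)%N by move: hu; rewrite /d; lia.
case: (ltnP (mdeg u) (mdeg v)) => huv.
  by rewrite /c Eskew_lt // mulr0 mul0r big1 // => w _; rewrite mulr0 mul0r.
have hN : (mdeg u + (N - (mdeg u - mdeg v)))%N = (mdeg v + N)%N.
  by move: hu huv; rewrite /d; lia.
transitivity (C u * Eskew q t u v a b *
    ((gser q t e x * hser q t e u) (N - (mdeg u - mdeg v))%N * meval x (M u))).
  by rewrite /c; ring.
rewrite (@gser_M K q t hqt r e u _ d x) ?hN ?ltnSn // mulr_sumr.
by apply: eq_bigr => w _; ring.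
Qed.

Lemma pmulr_coef (s : K) (F : pser K) N : (pofp s%:P * F) N = s * F N.
Proof.
have -> : s%:P = s *: 'X^0 by rewrite expr0 alg_polyC.
by rewrite pmul_monomial subn0.
Qed.

Lemma gser_quotient a e x :
  gser q t e x * \prod_(i < r.+1)
    ((qexp q (a * t ^+ (r.+1 - i.+1)) * qexp q (e * x i)) *
     pinv (qexp q (e * t ^+ (r.+1 - i.+1)) * qexp q (a * x i))) = gser q t a x.
Proof.
rewrite /gser -big_split /=; apply: eq_bigr => i _.
set A := qexp q (a * t ^+ _); set E := qexp q (e * x i).
set B := qexp q (e * t ^+ _); set D := qexp q (a * x i).
have hq s : qexp q s 0%N != 0 by rewrite qexp0 oner_eq0.
have hE : E * pinv E = 1 by apply: pmulV; apply: hq.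
have hD : D * pinv D = 1 by apply: pmulV; apply: hq.
have hBD : B * D * pinv (B * D) = 1.
  by apply: pmulV; rewrite pmul_coef0 mulf_neq0 //; apply: hq.
transitivity (A * (B * pinv (B * D)) * (E * pinv E)); first by ring.
rewrite hE mulr1; transitivity (A * (B * pinv (B * D)) * (D * pinv D)).
  by rewrite hD mulr1.
by transitivity (A * pinv D * (B * D * pinv (B * D))); [ring | rewrite hBD mulr1].
Qed.

Lemma skew_transformation a b (c d : K) e v x :
  (forall b, qpoch_inf q b = qexp q b) ->
  (forall u, qtpoch q t d u != 0) -> qtpoch q t (d / c) v != 0 ->
  a != 0 -> c != 0 -> e != 0 -> a * b * c = d * e ->
  (\sum_(u : multinom r.+1)
     fps_of_poly ((qtpoch q t b u / qtpoch q t d u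
                   * meval x (Minterp q t u))
                  *: EskewX q t u v a (a * c))
     / fps_of_poly (qtpochX q t (e * t ^+ r) u))%fps
  = (fps_of_poly (qtpoch q t b v / qtpoch q t (d / c) v)%:P
     * (\prod_(i < r.+1)
          ((qpoch_inf q (a * t ^+ (r.+1 - i.+1)) * qpoch_inf q (e * x i))
           / (qpoch_inf q (e * t ^+ (r.+1 - i.+1)) * qpoch_inf q (a * x i))))
     * (\sum_(u : multinom r.+1)
          fps_of_poly ((qtpoch q t (d / c) u / qtpoch q t d u
                        * meval x (Minterp q t u))
                       *: EskewX q t u v e (a * c))
          / fps_of_poly (qtpochX q t (a * t ^+ r) u)))%fps.
Proof.
move=> hinf hd hdc a0 c0 e0 habc.
have f0 : a * c != 0 by rewrite mulf_neq0.
have t0 : t ^+ r != 0 by rewrite expf_neq0 // (t_neq0 hqt).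
pose S (C : mnm -> K) a' e' : pser K := fun N => \sum_(u \in [set: mnm])
  (pofp ((C u * meval x (M u)) *: EskewX q t u v a' (a * c)) * hser q t e' u) N.
have SE (C : mnm -> K) a' e' : (fps_sum (fun u : mnm =>
    fps_div (fps_of_poly ((C u * meval x (Minterp q t u))
                  *: EskewX q t u v a' (a * c)))
     (fps_of_poly (qtpochX q t (e' * t ^+ r) u)))) = S C a' e'.
  apply/funext => N; apply: eq_fsbigr => u _.
  by rewrite (qtpochX_gpoch hqt) -imacE.
rewrite (SE (fun u => qtpoch q t b u / qtpoch q t d u)).
rewrite (SE (fun u => qtpoch q t (d / c) u / qtpoch q t d u)).
set C1 := fun u => _; set C2 := fun u => _.
pose P : pser K := \prod_(i < r.+1)
    ((qexp q (a * t ^+ (r.+1 - i.+1)) * qexp q (e * x i)) *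
     pinv (qexp q (e * t ^+ (r.+1 - i.+1)) * qexp q (a * x i))).
have -> : (\prod_(i < r.+1)
          ((qpoch_inf q (a * t ^+ (r.+1 - i.+1)) * qpoch_inf q (e * x i))
           / (qpoch_inf q (e * t ^+ (r.+1 - i.+1)) * qpoch_inf q (a * x i))))%fps = P.
  by apply: eq_bigr => i _; rewrite !hinf.
set kappa := _ / _.
suff h : gser q t e x * S C1 a e = gser q t e x * (pofp kappa%:P * P * S C2 e a).
  have gV : pinv (gser q t e x) * gser q t e x = 1.
    by rewrite mulrC; apply: pmulV; rewrite gser0 oner_eq0.
  have := congr1 (fun F => pinv (gser q t e x) * F) h.
  by rewrite /= !(mulrA (pinv _)) gV !mul1r.
transitivity (pofp kappa%:P * (gser q t a x * S C2 e a)); last first.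
  by rewrite -(gser_quotient a e x) -/P; ring.
apply/funext => N; rewrite pmulr_coef !gser_sum // mulr_sumr.
apply: eq_bigr => w _; rewrite mulrA; congr (_ * _).
(* With f = a c this value turns the factors at f s, e s and a s into (d)_u, (b)_u and (d/c)_u; the
   second of these uses abc = de. *)
pose s := d / (a * c * t ^+ r).
have gd u : (gpoch u).[a * c * s] = qtpoch q t d u.
  by rewrite (horner_gpoch hqt) /s; congr qtpoch; field; rewrite t0 a0 c0.
have gb u : (gpoch u).[e * s] = qtpoch q t b u.
  rewrite (horner_gpoch hqt) /s; congr qtpoch.
  have -> : b = d * e / (a * c) by rewrite -habc; field; rewrite a0 c0.
  by field; rewrite t0 a0 c0.
have gdc u : (gpoch u).[a * s] = qtpoch q t (d / c) u.
  by rewrite (horner_gpoch hqt) /s; congr qtpoch; field; rewrite t0 a0 c0.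
have hv : (mdeg v < (mdeg v + N).+1)%N by rewrite ltnS leq_addr.
have := @skew_identity K q t hqt r s a e (a * c) (mdeg v + N).+1
  (fun u v => Eskew q t u v a (a * c)) (fun u v => Eskew q t u v e (a * c)) v w.
rewrite gdc gb => h; rewrite /kappa mulrAC; apply: (canRL (mulfK hdc)).
rewrite mulrC.
transitivity (qtpoch q t (d / c) v *
  \sum_(u : bmultinom r.+1 (mdeg v + N).+1)
    qa e w u * ((gpoch u).[e * s] / (gpoch u).[a * c * s]) * Eskew q t u v a (a * c)).
  by congr (_ * _); apply: eq_bigr => u _; rewrite gb gd.
rewrite h ?bmdeg //.
- by congr (_ * _); apply: eq_bigr => u _; rewrite gdc gd.
- by move=> u; rewrite gd.
- by move=> u hu; apply: Eskew_qa.
- by move=> u hu; apply: Eskew_qa.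
Qed.

End Assembly.

(** * The infinite product as a limit *)

Section EulerLimit.
Local Open Scope classical_set_scope.

(** The finite q-binomial theorem, with the dependence on k confined to q^k: letting q^k tend to 0
    gives Euler's coefficients. *)
Lemma coef_qpoch (K : numFieldType) (q c : K) (k N : nat) :
  (forall m, 1 - q ^+ m.+1 != 0) ->
  (qpoch q%:P (c *: 'X) k)`_N =
  c ^+ N * \prod_(j < N) ((q ^+ k - q ^+ j) / (1 - q ^+ j.+1)).
Proof.
move=> hq; elim: k N => [|k IH] N.
  rewrite /qpoch big_ord0 coef1; case: N => [|N]; first by rewrite big_ord0 mulr1.
  by rewrite big_ord_recl subrr mul0r mul0r mulr0.
rewrite /qpoch big_ord_recr /= -/(qpoch q%:P (c *: 'X) k) mulrBr mulr1.
rewrite -polyC_exp [c *: 'X * _]mulrC mul_polyC scalerA -scalerAr coefB coefZ coefMX.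
case: N => [|N] /=.
  by rewrite mulr0 subr0 IH !big_ord0.
rewrite !IH [in LHS]big_ord_recr [in RHS]big_ord_recl /=.
have -> : \prod_(i < N) ((q ^+ k.+1 - q ^+ bump 0 i) / (1 - q ^+ (bump 0 i).+1)) =
    \prod_(i < N) (q * (q ^+ k - q ^+ i) / (1 - q ^+ i.+2)).
  by apply: eq_bigr => i _; rewrite /bump add1n !exprS mulrBr.
have h : \prod_(i < N) (1 - q ^+ i.+2) != 0 by apply/prodf_neq0 => i _.
rewrite !big_split /= !prodfV prodr_const card_ord.
have e1 : (\prod_(i < N) (1 - q ^+ i.+1)) * (1 - q ^+ N.+1) =
   (1 - q ^+ 1) * \prod_(i < N) (1 - q ^+ i.+2).
  by rewrite -(big_ord_recr N (fun i => 1 - q ^+ i.+1)) big_ord_recl.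
have h1 : \prod_(i < N) (1 - q ^+ i.+1) != 0 by apply/prodf_neq0 => i _.
have -> : \prod_(i < N) (1 - q ^+ i.+2) =
    (\prod_(i < N) (1 - q ^+ i.+1)) * (1 - q ^+ N.+1) / (1 - q ^+ 1).
  by rewrite e1 mulrAC mulfV ?mul1r.
have h2 := hq N; have h3 := hq 0%N.
set A := \prod_(i < N) (q ^+ k - q ^+ i); set B := \prod_(i < N) (1 - q ^+ i.+1) in h1 *.
rewrite !exprS expr0 mulr1 in h2 h3 *.
by field; rewrite h1 h2 h3.
Qed.

Lemma qpoch_inf_euler (K : numFieldType) (q c : K) :
  (forall m, 1 - q ^+ m.+1 != 0) ->
  (forall eps : K, 0 < eps -> \forall k \near \oo, `|q ^+ k| < eps) ->
  qpoch_inf q c = qexp q c.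
Proof.
move=> hq /cvgr0Pnorm_lt h0; apply/funext => N.
apply: (cvg_lim (@norm_hausdorff _ _)).
under eq_fun do rewrite coef_qpoch //.
apply: cvgM; first exact: cvg_cst.
rewrite /qexp_coef; elim: N => [|N IH].
  by under eq_fun do rewrite big_ord0; rewrite big_ord0; apply: cvg_cst.
under eq_fun do rewrite big_ord_recr; rewrite big_ord_recr /=.
apply: cvgM => //; apply: cvgM; last exact: cvg_cst.
rewrite -[X in _ --> X]sub0r; apply: cvgB => //; exact: cvg_cst.
Qed.

(** The order on [R[i]] is partial: eps > 0 forces eps to be real, and the claim reduces to powers
    of a real number in [0, 1). *)
Lemma near_expC_lt (R : realType) (q eps : R[i]) : `|q| < 1 -> 0 < eps ->
  \forall k \near \oo, `|q ^+ k| < eps.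
Proof.
move=> hq.
pose rho := Num.sqrt ((complex.Re q) ^+ 2 + (complex.Im q) ^+ 2).
have nq : `|q| = rho%:C%C by rewrite normc_def.
have rho0 : 0 <= rho by apply: sqrtr_ge0.
move: hq; rewrite nq -[1]/(1%:C%C) ltcR => hq.
rewrite ltcE /= => /andP[/eqP e1 e2].
have h := @cvg_expr R rho; rewrite ger0_norm // in h.
move: (h hq) => /cvgr0Pnorm_lt/(_ _ e2); apply: filterS => k.
rewrite ger0_norm ?exprn_ge0 // => hk.
by rewrite [`|q ^+ k|]normrX nq -rmorphXn ltcE /= e1 eqxx.
Qed.

End EulerLimit.

Theorem theorem10p1 (R : realType) (n : nat) (q t : R[i]) (v : multinom n)
    (a b c d e : R[i]) (x : 'I_n -> R[i])
    (hn : (1 <= n)%N) (hq : `|q| < 1) (hqt : generic_qt q t)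
    (ha : a != 0) (hc : c != 0) (he : e != 0)
    (hd : forall u : multinom n, qtpoch q t d u != 0)
    (hdc : qtpoch q t (d / c) v != 0)
    (habcde : a * b * c = d * e) :
  (\sum_(u : multinom n)
     fps_of_poly ((qtpoch q t b u / qtpoch q t d u
                   * meval x (Minterp q t u))
                  *: EskewX q t u v a (a * c))
     / fps_of_poly (qtpochX q t (e * t ^+ n.-1) u))%fps
  = (fps_of_poly (qtpoch q t b v / qtpoch q t (d / c) v)%:P
     * (\prod_(i < n)
          ((qpoch_inf q (a * t ^+ (n - i.+1)) * qpoch_inf q (e * x i))
           / (qpoch_inf q (e * t ^+ (n - i.+1)) * qpoch_inf q (a * x i))))
     * (\sum_(u : multinom n)
          fps_of_poly ((qtpoch q t (d / c) u / qtpoch q t d u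
                        * meval x (Minterp q t u))
                       *: EskewX q t u v e (a * c))
          / fps_of_poly (qtpochX q t (a * t ^+ n.-1) u)))%fps.
Proof.
case: n v x hn hd hdc => [//|r] v x _ hd hdc.
apply: skew_transformation => // z; apply: qpoch_inf_euler; last first.
  by move=> eps; apply: near_expC_lt.
by move=> m; have := qt_neq1 hqt 0 (ltn0Sn m); rewrite expr0 mulr1.
Qed.
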